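(* There is an algorithm which accepts as input a Lipschitz function $f : S^2 \to \mathbb{R}$ and an integer parameter $N \geq 46$, and produces as output a real number which differs from $\zeta(f)$ by no more than $$\frac{C}{N}\cdot\|f\|_{\mathrm{Lip}}\,,\qquad \text{where } C \approx 197.778\dots \text{ is a constant (independent of } f \text{ and } N).$$ Here $\zeta$ is the median quasi-state on $S^2$. The algorithm has complexity $O(N^2\log N)$.
   Context: $S^2\subset\mathbb{R}^3$ is the unit sphere, endowed with the metric $d$ obtained by restricting the Euclidean metric of $\mathbb{R}^3$; $\|f\|_{\mathrm{Lip}}$ is the Lipschitz constant of $f$ with respect to $d$. Quasi-states: for a compact Hausdorff space $X$, let $C(X)$ be the Banach algebra of real-valued continuous functions with the norm $\|f\|_{C^0}=\max_X|f|$. For $f\in C(X)$ let $C(f)=\{\phi\circ f \mid \phi:\mathbb{R}\to\mathbb{R}\text{ continuous}\}$. A quasi-state on $X$ is a functional $\zeta:C(X)\to\mathbb{R}$ such that (i) $\zeta(1)=1$; (ii) $\zeta(f)\le\zeta(g)$ whenever $f\le g$; (iii) for each $f\in C(X)$, $\zeta$ is linear on $C(f)$. Every quasi-state is $1$-Lipschitz with respect to $\|\cdot\|_{C^0}$, hence a quasi-state on a closed manifold is determined by its values on the $C^0$-dense set of Morse functions. Median quasi-state $\zeta$ on $S^2$: let $\nu$ be the normalized (total mass $1$) Lebesgue measure on $S^2$ coming from the standard round area form. For a Morse function $f:S^2\to\mathbb{R}$ there is a unique connected component $m_\nu(f)$ of a level set of $f$ such that $\nu(C)\le\frac12$ for every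 connected component $C$ of $S^2\setminus m_\nu(f)$. The median quasi-state is the unique quasi-state $\zeta$ on $S^2$ with $\zeta(f)=f(m_\nu(f))$ (the constant value of $f$ on $m_\nu(f)$) for every Morse function $f$. Complexity: the number of elementary operations performed (arithmetic operations and comparisons on real numbers, evaluations of elementary functions, and evaluations of $f$ at points of $S^2$), as a function of $N$; the implied constant does not depend on $f$. *)

(* Defs.v *)
From HB Require Import structures.
From mathcomp Require Import all_boot all_order all_algebra.
From mathcomp Require Import all_classical all_reals all_analysis.
From mathcomp Require Import ring.
Set Implicit Arguments.
Unset Strict Implicit.
Unset Printing Implicit Defensive.
Import Order.TTheory GRing.Theory Num.Theory.
Import numFieldNormedType.Exports.
Local Open Scope classical_set_scope.
Local Open Scope ring_scope.

(* [X -> R] stands for the ambient space of C(X): every axiom only constrains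
   the values of [zeta] at continuous functions. *)
Definition quasi_state (R : realType) (X : topologicalType)
    (zeta : (X -> R) -> R) : Prop :=
  [/\ zeta (fun=> 1) = 1,
      forall f g : X -> R, continuous f -> continuous g ->
        (forall x, f x <= g x) -> zeta f <= zeta g
    & forall f : X -> R, continuous f ->
      forall phi psi : R -> R, continuous phi -> continuous psi ->
      forall a b : R,
        zeta (fun x => a * phi (f x) + b * psi (f x)) =
        a * zeta (phi \o f) + b * zeta (psi \o f)].

Section Sphere.
Context {R : realType}.

Definition vec3 (x y z : R) : 'rV[R]_3 := \row_(i < 3) [:: x; y; z]`_i.

(* The library norm on ['rV_3] is the sup norm, so the Euclidean metric is
   spelled out. *)
Definition edist (x y : 'rV[R]_3) : R :=
  Num.sqrt (\sum_(i < 3) (x 0 i - y 0 i) ^+ 2).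

Definition sphere : set 'rV[R]_3 := [set x | \sum_(i < 3) x 0 i ^+ 2 = 1].

Lemma sphere_vec3 (x y z : R) :
  x ^+ 2 + y ^+ 2 + z ^+ 2 = 1 -> vec3 x y z \in sphere.
Proof.
by move=> h; apply/mem_set; rewrite /sphere /= !big_ord_recl big_ord0 !mxE /=
  addr0 addrA.
Qed.

End Sphere.

Arguments sphere : clear implicits.

(* [set_type] carries the subspace topology. *)
Definition S2 (R : realType) := set_type (sphere R).

Section Lipschitz.
Context {R : realType}.

Definition S2dist (x y : S2 R) : R := edist (\val x) (\val y).

Definition S2_lipschitz (f : S2 R -> R) : Prop :=
  exists L : R, forall x y, `|f x - f y| <= L * S2dist x y.

Definition lip_const (f : S2 R -> R) : R :=
  sup [set q | exists x y : S2 R, x <> y /\ q = `|f x - f y| / S2dist x y].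

End Lipschitz.

Section Spherical.
Context {R : realType}.

Lemma sph_subproof (phi theta : R) :
  vec3 (sin phi * cos theta) (sin phi * sin theta) (cos phi) \in sphere R.
Proof.
apply: sphere_vec3; rewrite !exprMn -mulrDr cos2Dsin2 mulr1 addrC.
exact: cos2Dsin2.
Qed.

(* colatitude [phi], longitude [theta] *)
Definition sph (phi theta : R) : S2 R :=
  exist (fun x => x \in sphere R) _ (sph_subproof phi theta).

(* The round area form is sin phi dphi /\ dtheta, of total mass 4 pi. *)
Definition nu (A : set (S2 R)) : \bar R :=
  (((4 * pi)^-1)%:E *
   \int[lebesgue_measure]_(phi in `[0%R, pi])
     \int[lebesgue_measure]_(theta in `[0%R, (2 * pi)%R])
       (sin phi * \1_A (sph phi theta))%:E)%E.

End Spherical.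

Section Morse.
Context {R : realType}.

Definition stereo_vec (s : bool) (u : 'rV[R]_2) : 'rV[R]_3 :=
  let q := u 0 0 ^+ 2 + u 0 1 ^+ 2 in
  vec3 (2 * u 0 0 / (1 + q)) (2 * u 0 1 / (1 + q))
       ((-1) ^+ s * (q - 1) / (1 + q)).

Lemma stereo_subproof (s : bool) (u : 'rV[R]_2) : stereo_vec s u \in sphere R.
Proof.
rewrite /stereo_vec; set q := u 0 0 ^+ 2 + u 0 1 ^+ 2; apply: sphere_vec3.
have q0 : 1 + q != 0.
  by rewrite gt_eqF// ltr_wpDr// addr_ge0// sqr_ge0.
have -> : ((-1) ^+ s * (q - 1) / (1 + q)) ^+ 2 = ((q - 1) / (1 + q)) ^+ 2.
  by rewrite -mulrA exprMn sqrr_sign mul1r.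
rewrite !expr_div_n -!mulrDl.
have -> : (2 * u 0 0) ^+ 2 + (2 * u 0 1) ^+ 2 + (q - 1) ^+ 2 = (1 + q) ^+ 2.
  by rewrite /q; ring.
by rewrite divff// expf_neq0.
Qed.

(* Inverse stereographic projections, from the north ([s = false]) and the
   south ([s = true]) pole; together they form the standard smooth atlas. *)
Definition stereo (s : bool) (u : 'rV[R]_2) : S2 R :=
  exist (fun x => x \in sphere R) _ (stereo_subproof s u).

Definition partial (i : 'I_2) (g : 'rV[R]_2 -> R) : 'rV[R]_2 -> R :=
  fun u => derive (g : 'rV[R]_2 -> R^o) u (delta_mx 0 i).

Definition iter_partial (l : seq 'I_2) (g : 'rV[R]_2 -> R) : 'rV[R]_2 -> R :=
  foldr partial g l.

Definition smooth (g : 'rV[R]_2 -> R) : Prop :=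
  forall l : seq 'I_2, continuous (iter_partial l g) /\
    forall (u : 'rV[R]_2) (i : 'I_2),
      derivable (iter_partial l g : 'rV[R]_2 -> R^o) u (delta_mx 0 i).

Definition hessian (g : 'rV[R]_2 -> R) (u : 'rV[R]_2) : 'M[R]_2 :=
  \matrix_(i, j) partial i (partial j g) u.

Definition morse (f : S2 R -> R) : Prop :=
  forall s : bool, smooth (f \o stereo s) /\
    forall u : 'rV[R]_2, (forall i, partial i (f \o stereo s) u = 0) ->
      \det (hessian (f \o stereo s) u) != 0.

End Morse.

Section Median.
Context {R : realType}.

Definition level_component (f : S2 R -> R) (m : set (S2 R)) : Prop :=
  exists x, m = connected_component (f @^-1` [set f x]) x.

Definition is_median (f : S2 R -> R) (m : set (S2 R)) : Prop :=
  level_component f m /\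
  forall y, (~` m) y -> (nu (connected_component (~` m) y) <= (2^-1)%:E)%E.

Definition median_quasi_state (zeta : (S2 R -> R) -> R) : Prop :=
  quasi_state zeta /\
  forall f, morse f -> forall m, is_median f m ->
  forall x, m x -> zeta f = f x.

End Median.

(* Algorithms are programs for a real RAM: a finite program text over finitely
   many named arrays of naturals and of exact reals, with unit-cost operations.
   Naturals serve for indexing and counting; there is no rounding from reals to
   naturals, and no real constants besides embedded naturals. *)

Inductive elem_fun := Sqrt | Exp | Ln | Sin | Cos | Atan.

Inductive nexp :=
| NConst of nat
| NGet of nat & nexp
| NAdd of nexp & nexp
| NSub of nexp & nexp
| NMul of nexp & nexp.

Inductive rexp :=
| ROfNat of nexp
| RGet of nat & nexp
| RAdd of rexp & rexp
| RSub of rexp & rexp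
| RMul of rexp & rexp
| RDiv of rexp & rexp
| RFun of elem_fun & rexp.

Inductive bexp :=
| BNLe of nexp & nexp
| BRLe of rexp & rexp
| BNot of bexp
| BAnd of bexp & bexp.

(* In [NSet], [RSet] and [Query] the first two arguments are the name of the
   target array and the index in it; [Query x i a b c] stores there the value
   of the input function at the point (a, b, c). *)
Inductive com :=
| Skip
| NSet of nat & nexp & nexp
| RSet of nat & nexp & rexp
| Query of nat & nexp & rexp & rexp & rexp
| Seq of com & com
| If of bexp & com & com
| While of bexp & com.

Fixpoint ncost (e : nexp) : nat :=
  match e with
  | NConst _ => 1
  | NGet _ i => (ncost i).+1
  | NAdd a b | NSub a b | NMul a b => (ncost a + ncost b).+1
  end.

Fixpoint rcost (e : rexp) : nat :=
  match e with
  | ROfNat a => (ncost a).+1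
  | RGet _ i => (ncost i).+1
  | RAdd a b | RSub a b | RMul a b | RDiv a b => (rcost a + rcost b).+1
  | RFun _ a => (rcost a).+1
  end.

Fixpoint bcost (e : bexp) : nat :=
  match e with
  | BNLe a b => (ncost a + ncost b).+1
  | BRLe a b => (rcost a + rcost b).+1
  | BNot a => (bcost a).+1
  | BAnd a b => (bcost a + bcost b).+1
  end.

Section Semantics.
Context {R : realType}.

Record state := State {
  nats : nat -> nat -> nat;
  reals : nat -> nat -> R
}.

Definition upd (T : Type) (m : nat -> nat -> T) (x i : nat) (v : T) :
    nat -> nat -> T :=
  fun x' i' => if (x' == x) && (i' == i) then v else m x' i'.

Definition set_nat (st : state) (x i v : nat) : state :=
  State (upd (nats st) x i v) (reals st).

Definition set_real (st : state) (x i : nat) (v : R) : state :=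
  State (nats st) (upd (reals st) x i v).

Definition eval_fun (g : elem_fun) : R -> R :=
  match g with
  | Sqrt => Num.sqrt
  | Exp => expR
  | Ln => @ln R
  | Sin => sin
  | Cos => cos
  | Atan => atan
  end.

Fixpoint neval (st : state) (e : nexp) : nat :=
  match e with
  | NConst n => n
  | NGet x i => nats st x (neval st i)
  | NAdd a b => (neval st a + neval st b)%N
  | NSub a b => (neval st a - neval st b)%N
  | NMul a b => (neval st a * neval st b)%N
  end.

Fixpoint reval (st : state) (e : rexp) : R :=
  match e with
  | ROfNat a => (neval st a)%:R
  | RGet x i => reals st x (neval st i)
  | RAdd a b => reval st a + reval st b
  | RSub a b => reval st a - reval st b
  | RMul a b => reval st a * reval st b
  | RDiv a b => reval st a / reval st b
  | RFun g a => eval_fun g (reval st a)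
  end.

Fixpoint beval (st : state) (e : bexp) : bool :=
  match e with
  | BNLe a b => (neval st a <= neval st b)%N
  | BRLe a b => reval st a <= reval st b
  | BNot a => ~~ beval st a
  | BAnd a b => beval st a && beval st b
  end.

(* [exec f c st t st']: with input function [f], running [c] from [st]
   terminates in [st'] after [t] operations.  Every operation counts, also those
   on indices, memory accesses and branchings.  A query at a point off the
   sphere blocks. *)
Inductive exec (f : S2 R -> R) : com -> state -> nat -> state -> Prop :=
| ExecSkip st : exec f Skip st 1 st
| ExecNSet st x i e :
    exec f (NSet x i e) st (ncost i + ncost e).+1
      (set_nat st x (neval st i) (neval st e))
| ExecRSet st x i e :
    exec f (RSet x i e) st (ncost i + rcost e).+1
      (set_real st x (neval st i) (reval st e))
| ExecQuery st x i a b c (p : S2 R) :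
    \val p = vec3 (reval st a) (reval st b) (reval st c) ->
    exec f (Query x i a b c) st (ncost i + rcost a + rcost b + rcost c).+1
      (set_real st x (neval st i) (f p))
| ExecSeq c1 c2 st t1 st1 t2 st2 :
    exec f c1 st t1 st1 -> exec f c2 st1 t2 st2 ->
    exec f (Seq c1 c2) st (t1 + t2) st2
| ExecIfTrue b c1 c2 st t st' :
    beval st b -> exec f c1 st t st' ->
    exec f (If b c1 c2) st (bcost b + t) st'
| ExecIfFalse b c1 c2 st t st' :
    ~~ beval st b -> exec f c2 st t st' ->
    exec f (If b c1 c2) st (bcost b + t) st'
| ExecWhileFalse b c st :
    ~~ beval st b -> exec f (While b c) st (bcost b) st
| ExecWhileTrue b c st t1 st1 t2 st2 :
    beval st b -> exec f c st t1 st1 -> exec f (While b c) st1 t2 st2 ->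
    exec f (While b c) st (bcost b + t1 + t2) st2.

(* The parameter is in cell 0 of array 0 of the naturals, all other cells are
   zero; the output is in cell 0 of array 0 of the reals. *)
Definition init_state (N : nat) : state :=
  State (upd (fun _ _ => 0%N) 0 0 N) (fun _ _ => 0).

Definition computes (P : com) (f : S2 R -> R) (N : nat) (t : nat) (y : R) :
    Prop :=
  exists2 st, exec f P (init_state N) t st & reals st 0 0 = y.

End Semantics.

(* Main.v *)
Require Import Defs.
From HB Require Import structures.
From mathcomp Require Import all_boot all_order all_algebra.
From mathcomp Require Import all_classical all_reals all_analysis.
From mathcomp Require Import measurable_realfun lebesgue_measure lebesgue_integral ftc.
From mathcomp Require Import ring lra zify.
Set Implicit Arguments.
Unset Strict Implicit.
Unset Printing Implicit Defensive.
Import Order.TTheory GRing.Theory Num.Theory.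
Import numFieldNormedType.Exports.
Local Open Scope ring_scope.

(** Call a closed connected set [K] of the sphere big if every component of its
    complement has measure at most 1/2. The median of a Morse function is big
    by definition, and any two big sets meet ([big_meet]): if they were
    disjoint, the component of each complement that contains the other set
    would be an open set of measure at most 1/2, the two of them would cover
    the sphere, and they would overlap in a set of positive measure. Hence, if
    [f] stays within [D] of [y] on some big set, the median of every Morse
    function near [f] contains a point where [f] is within [D] of [y]. Since
    quasi-states are 1-Lipschitz and Morse functions are dense, this gives
    [`|y - zeta f| <= D] ([big_value]). It requires that medians exist,
    which are obtained as intersections of nested big sets on which the function
    is more and more constant ([median_exists]).

    The algorithm therefore looks for a big set on which [f] is nearly constant.
    It cuts the sphere into [N * N] cells along parallels and meridians and
    samples [f] at one point of each. Let [e] be the largest difference between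
    neighbouring samples, which is [O(L / N)] for a function with Lipschitz
    constant [L]. Colour a cell by the sign of [sin ((v - v0) / e)], where [v] is
    its sample and [v0] a fixed one. Along a path of cells of one colour the
    phase [(v - v0) / e] moves by steps of size at most 1, so it cannot jump out
    of a half period, and [f] varies by at most [pi * e] over a monochromatic
    component of cells ([mono_comp_osc]). With the variation inside a cell, this
    is where the error [C * L / N] comes from ([grid_error]).

    Some monochromatic component is big, and it is found in linear time. A
    search that prefers edges between cells of the same colour builds a spanning
    tree in which every monochromatic component is entered by a single edge of
    changing colour, leading to its head. Among the heads whose subtree has at
    least half of the total area, the last one visited lies in a component all
    of whose complementary regions have at most half of the area
    ([last_heavy_head_big]). The planarity of the sphere enters through one
    combinatorial statement: the grid is simply connected in the sense of
    cohomology modulo 2, and so each complementary region of a connected set of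
    cells borders it along a connected layer ([layer_connected]).

    The density of Morse functions is proved without transversality theory.
    A Lipschitz function is approximated by a function that is rational in
    stereographic charts, to which a small linear function with coefficients
    [a] is added. The [a] for which this fails to be Morse lie on an algebraic
    hypersurface, because they are parametrised by a double cover of the plane
    ([degenerate_slopes_algebraic]). *)

(** * Layers around a connected set in a simply connected graph *)

Section Layer.
Variables (V : finType) (adj : rel V).
Hypothesis adj_sym : symmetric adj.

Definition reach (S : {set V}) : rel V :=
  connect [rel u v | [&& u \in S, v \in S & adj u v]].

Implicit Types (S : {set V}).

Lemma reach_sym S : symmetric (reach S).
Proof. by apply: sym_connect_sym => u v /=; rewrite adj_sym andbCA. Qed.

Lemma reach1 S x y : x \in S -> y \in S -> adj x y -> reach S x y.
Proof. by move=> xS yS xy; apply: connect1; rewrite /= xS yS. Qed.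

Definition region (S : {set V}) x := [set y | reach S x y].

Lemma region_sub S x : x \in S -> region S x \subset S.
Proof.
move=> xS; apply/fintype.subsetP => y; rewrite inE => /connectP[p pth ->].
elim: p x xS pth => [|z p ih] x xS //= /andP[/and3P[_ zS _]].
exact: ih.
Qed.

(** A cocycle modulo 2 on the clique complex of [adj] that vanishes on [base]
    is a coboundary: first cohomology vanishes relative to [base], which thus
    plays the part of a set collapsed to one point. *)
Definition simply_connected (base : {set V}) := forall c : rel V, symmetric c ->
  (forall x y z, adj x y -> adj y z -> adj x z -> c x y (+) c y z = c x z) ->
  (forall x y, x \in base -> y \in base -> adj x y -> c x y = false) ->
  exists h : V -> bool, forall x y, adj x y -> c x y = h x (+) h y.

(** Discrete unicoherence. Were the cells of a complementary region [W] that
    touch the connected set [D] to split, the edges leaving [W] from the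
    component [B] of [w] would form a cocycle. It is the coboundary of some
    [h], which is constant on [D] and on [W], so all edges from [D] to [W]
    have the same value, namely that of the edge into [w]. *)
Lemma layer_connected (base D : {set V}) x w w' :
  simply_connected base -> (base \subset D) || [disjoint base & D] ->
  {in D &, forall d d', reach D d d'} -> x \notin D ->
  w \in region (~: D) x -> w' \in region (~: D) x ->
  forall d d', d \in D -> d' \in D -> adj d w -> adj d' w' ->
  reach [set v in region (~: D) x | [exists d in D, adj d v]] w w'.
Proof.
move=> sc baseD Dconn xD; set W := region _ x; set L := [set v in W | _].
move=> wW w'W d d' dD d'D dw d'w'.
have inW v : (v \in W) = reach (~: D) x v by rewrite /W inE.
have WD v : v \in W -> v \notin D.
  by move=> vW; rewrite -finset.in_setC; apply: (fintype.subsetP (region_sub _)) vW; rewrite inE.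
have exitW u v : u \in W -> adj u v -> v \notin W -> v \in D.
  move=> uW uv; apply: contraR => vD; have uD := WD u uW; rewrite inW in uW.
  by rewrite inW; apply: connect_trans uW _; apply: reach1; rewrite ?inE.
pose B := [set v in L | reach L w v].
have inLE v : (v \in L) = (v \in W) && [exists d in D, adj d v] by rewrite /L inE.
have inBE v : (v \in B) = (v \in L) && reach L w v by rewrite /B inE.
pose c u v := ((u \notin W) && (v \in B)) || ((v \notin W) && (u \in B)).
have BW v : v \in B -> v \in W by rewrite inBE inLE => /andP[/andP[]].
have inL u v : u \in W -> v \notin W -> adj u v -> u \in L.
  move=> uW vW uv; rewrite inLE uW; apply/existsP; exists v.
  by rewrite (exitW u)// adj_sym.
have Badj u v : u \in L -> v \in L -> adj u v -> (u \in B) = (v \in B).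
  move=> uL vL uv; rewrite !inBE uL vL /=.
  apply/idP/idP => h; apply: connect_trans h _; apply: reach1 => //.
  by rewrite adj_sym.
have [||y z yb zb yz|h ch] := sc c.
- by move=> u v; rewrite /c orbC.
- move=> u v z uv vz uz; rewrite /c.
  have h1 := BW u; have h2 := BW v; have h3 := BW z.
  case uW : (u \in W) h1; case vW : (v \in W) h2; case zW : (z \in W) h3 => h3 h2 h1 /=;
    rewrite ?orbF//=.
  + by apply: Badj; [apply: (inL v z)|apply: (inL u z)|]; rewrite ?zW// adj_sym.
  + have -> : (u \in B) = (z \in B).
      by apply: Badj => //; [apply: (inL u v)|apply: (inL z v)] => //; rewrite ?vW// adj_sym.
    by rewrite addbb.
  + have -> : (z \in B) = false by apply/negP => /h3.
    have -> : (v \in B) = false by apply/negP => /h2.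
    by rewrite addbF.
  + have -> : (v \in B) = (z \in B).
      by apply: Badj => //; [apply: (inL v u)|apply: (inL z u)] => //; rewrite ?uW// adj_sym.
    by rewrite addbF.
  + have -> : (z \in B) = false by apply/negP => /h3.
    have -> : (u \in B) = false by apply/negP => /h1.
    by rewrite addbb.
  + have -> : (v \in B) = false by apply/negP => /h2.
    have -> : (u \in B) = false by apply/negP => /h1.
    by rewrite addFb.
  + have -> : (v \in B) = false by apply/negP => /h2.
    have -> : (u \in B) = false by apply/negP => /h1.
    by have -> : (z \in B) = false by apply/negP => /h3.
- rewrite /c; have nW u v : u \in base -> v \in base -> adj u v -> u \notin W -> v \notin W.
    move=> ub vb uv uW; apply: contra uW => vW.
    case/orP: baseD => [/fintype.subsetP bD|].
      by move: (WD _ vW); rewrite bD.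
    rewrite disjoint_sym => /pred0P dis; apply: contraT => uW.
    have := dis u; rewrite /= ub andbT; suff -> : u \in D by [].
    by apply: (exitW v) => //; rewrite adj_sym.
  apply/negbTE; rewrite negb_or !negb_and !negbK; apply/andP; split.
    rewrite -implyNb; apply/implyP => yW; apply: contra (nW y z yb zb yz yW); exact: BW.
  rewrite -implyNb; apply/implyP => zW; rewrite adj_sym in yz.
  by apply: contra (nW z y zb yb yz zW); exact: BW.
have hD u v : u \in D -> v \in D -> h u = h v.
  move=> uD vD; have /connectP[p + ->] := Dconn u v uD vD.
  elim: p u {uD} => [|z p ih] u //= /andP[/and3P[uD zD uz] /ih <-].
  have := ch u z uz; rewrite /c.
  have -> : z \in B = false by apply/negP => /BW/WD; rewrite zD.
  have -> : u \in B = false by apply/negP => /BW/WD; rewrite uD.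
  by rewrite !andbF; case: (h u); case: (h z).
have hW u v : u \in W -> v \in W -> h u = h v.
  move=> uW vW; have : reach (~: D) u v.
    by rewrite !inW in uW vW; apply: connect_trans vW; rewrite -/(reach _ _ _) reach_sym.
  move=> /connectP[p + ev]; rewrite {}ev in vW *.
  elim: p u uW vW => [|z p ih] u uW //= vW /andP[/and3P[uD zD uz] pth].
  have zW : z \in W.
    by apply: contraT => /(exitW u z uW uz) zD'; rewrite inE zD' in zD.
  rewrite -(ih z)//; have := ch u z uz; rewrite /c uW zW /=.
  by case: (h u); case: (h z).
have := ch d w dw; have := ch d' w' d'w'.
have nDW e : e \in D -> e \notin W by apply: contraL => /WD.
rewrite /c (nDW d)// (nDW d')// w'W wW /= !orbF (hD d' d)// (hW w' w)// => <-.
have wL : w \in L by apply: (inL w d) => //; rewrite ?nDW// adj_sym.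
have -> : w \in B by rewrite inBE wL; exact: connect0.
by move=> /esym; rewrite inBE => /andP[].
Qed.

End Layer.

Section Mono.
Variables (V : finType) (adj : rel V) (col : V -> bool).
Hypothesis adj_sym : symmetric adj.

Definition mono : rel V := connect [rel u v | adj u v && (col u == col v)].

Lemma mono_sym : symmetric mono.
Proof. by apply: sym_connect_sym => u v /=; rewrite adj_sym eq_sym. Qed.

Lemma mono1 x y : adj x y -> col x = col y -> mono x y.
Proof. by move=> xy c; apply: connect1; rewrite /= xy c eqxx. Qed.

Definition mono_comp x := [set y | mono x y].

Lemma mono_comp_trans x y z : y \in mono_comp x -> mono y z -> z \in mono_comp x.
Proof. by rewrite !inE => xy yz; apply: connect_trans yz. Qed.

Lemma mono_col x y : mono x y -> col x = col y.
Proof.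
move=> /connectP[p + ->]; elim: p x => [|z p ih] x //= /andP[/andP[_ /eqP ->]].
exact: ih.
Qed.

Lemma mono_comp_reach x : {in mono_comp x &, forall d d', reach adj (mono_comp x) d d'}.
Proof.
suff h y : y \in mono_comp x -> reach adj (mono_comp x) x y.
  by move=> y z /h xy /h; apply: connect_trans; rewrite -/(reach _ _ _ _) reach_sym.
have walk p u : u \in mono_comp x -> path [rel u v | adj u v && (col u == col v)] u p ->
    reach adj (mono_comp x) u (last u p).
  elim: p u => [|z p ih] u /= ux; first by move=> _; exact: connect0.
  move=> /andP[/andP[uz /eqP cuz] pth].
  have zx : z \in mono_comp x by apply: mono_comp_trans ux (mono1 uz cuz).
  by apply: connect_trans (ih z zx pth); exact: reach1.
rewrite inE => /connectP[p pth ->]; apply: walk pth.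
by rewrite inE; exact: connect0.
Qed.

(** The cells of a region that touch a monochromatic component all have the
    other colour, so a connected layer of them is monochromatic. *)
Lemma layer_mono (base : {set V}) a x w w' : simply_connected adj base ->
  {in base &, forall u v, mono u v} -> x \notin mono_comp a ->
  w \in region adj (~: mono_comp a) x -> w' \in region adj (~: mono_comp a) x ->
  forall d d', d \in mono_comp a -> d' \in mono_comp a -> adj d w -> adj d' w' -> mono w w'.
Proof.
move=> sc baseM xa wW w'W d d' da d'a dw d'w'.
have : reach adj [set v in region adj (~: mono_comp a) x | [exists d in mono_comp a, adj d v]] w w'.
  apply: (layer_connected adj_sym sc _ _ xa wW w'W da d'a dw d'w'); last exact: mono_comp_reach.
  have [/existsP[b /andP[bb ba]]|] := boolP [exists b in base, b \in mono_comp a].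
    apply/orP; left; apply/fintype.subsetP => b' b'b.
    by apply: mono_comp_trans ba _; exact: baseM.
  rewrite negb_exists => /forallP nb; apply/orP; right.
  by apply/pred0P => b /=; apply: negbTE; have := nb b.
move=> /connectP[p + ->]; elim: p w {wW dw} => [|z p ih] w /=.
  by move=> _; exact: connect0.
move=> /andP[/and3P[wL zL wz] pth]; apply: connect_trans (ih z pth).
suff flip v : v \in [set v in region adj (~: mono_comp a) x | [exists d in mono_comp a, adj d v]] ->
    col v = ~~ col a by apply: mono1 => //; rewrite (flip w)// (flip z).
rewrite inE => /andP[vW /existsP[e /andP[ea ev]]].
have ce : col a = col e by apply: mono_col; rewrite inE in ea.
have vna : v \notin mono_comp a.
  by rewrite -finset.in_setC; apply: (fintype.subsetP (region_sub _ _)) vW; rewrite inE.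
apply/eqP; rewrite -[_ == _]negbK -addbN; apply: contra vna; rewrite ce negbK => cve.
apply: mono_comp_trans ea (mono1 ev _).
by case: (col v) (col e) cve => [] [].
Qed.

End Mono.

Section Tree.
Variables (R : realFieldType) (V : finType) (adj : rel V) (col : V -> bool).
Hypothesis adj_sym : symmetric adj.
Variables (base : {set V}).
Hypotheses (sc : simply_connected adj base)
  (baseM : {in base &, forall u v, mono adj col u v}).
Variables (root : V) (pc : V -> V) (pos : V -> nat).
Hypotheses (pc_root : pc root = root)
  (pc_adj : forall v, v != root -> adj (pc v) v)
  (pc_pos : forall v, v != root -> (pos (pc v) < pos v)%N).

(** The first vertex of a monochromatic component that the tree reaches: its
    parent has the other colour. *)
Definition head v := (v == root) || (col (pc v) != col v).

Hypothesis head_uniq : forall u v, head u -> head v -> mono adj col u v -> u = v.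

(** Parents come earlier, so induction along the tree starts at the root. *)
Lemma pos_ind (P : V -> Prop) : P root ->
  (forall v, v != root -> P (pc v) -> P v) -> forall v, P v.
Proof.
move=> P0 PS v; have [n] := ubnP (pos v); elim: n v => // n ih v vn.
have [->//|vr] := eqVneq v root.
by apply: PS => //; apply: ih; exact: leq_trans (pc_pos vr) vn.
Qed.

Lemma head_first h y : head h -> mono adj col h y -> (pos h <= pos y)%N.
Proof.
move=> hh; elim/pos_ind: y => [|v vr ih] hy.
  by rewrite (head_uniq hh _ hy)// /head eqxx.
have [hv|] := boolP (head v); first by rewrite (head_uniq hh hv hy).
rewrite /head negb_or negbK => /andP[_ /eqP cv].
apply: leq_trans (ltnW (pc_pos vr)); apply: ih; apply: connect_trans hy _.
by apply: mono1 => //; rewrite adj_sym pc_adj.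
Qed.

Definition subtree v := [set u | fconnect pc u v].

Lemma subtree_root : subtree root = [set: V].
Proof.
apply/setP => v; rewrite !inE; elim/pos_ind: v => [|v vr ih]; first exact: connect0.
by apply: connect_trans ih; exact: fconnect1.
Qed.

Variable area : V -> R.
Hypothesis area_ge0 : forall v, 0 <= area v.

Lemma chain_exit (W : {set V}) w z : w \in W -> z \notin W -> fconnect pc w z ->
  exists v, [/\ v \in W, pc v \notin W & fconnect pc w v].
Proof.
move=> wW zW /iter_findex; move: (findex _ _ _) => n E.
elim: n w wW E => [|n ih] w wW; first by move=> /= E; rewrite -E wW in zW.
rewrite iterSr => E; have [pW|pW] := boolP (pc w \in W).
  have [v [vW pv wv]] := ih _ pW E; exists v; split => //.
  by apply: connect_trans wv; exact: fconnect1.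
by exists w; split => //; exact: connect0.
Qed.

Lemma area_le (P Q : pred V) : (forall v, P v -> Q v) ->
  \sum_(v | P v) area v <= \sum_(v | Q v) area v.
Proof.
move=> PQ; rewrite [leRHS](bigID P) /= -[leLHS]addr0 lerD ?sumr_ge0//.
rewrite le_eqVlt; apply/orP; left; apply/eqP/eq_bigl => v.
by rewrite andbC; case: (boolP (P v)) => //= /PQ ->.
Qed.

(** Let [A] be the component of [h] and [W] a complementary region. If the
    root lies in [W], then [W] misses the subtree of [h], which has at least
    half of the area: a tree path from [W] up to [h] would leave [W] at a head
    [z] visited after [h], yet by the layer lemma [z] lies in the
    monochromatic component of the parent of [h], which is visited before. If
    the root lies outside [W], every tree path from [W] to the root leaves [W]
    at a head that borders [A]; by the layer lemma these heads share a
    component, so they are one vertex [z], and [W] is contained in the subtree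
    of [z]. As [z] comes after [h], this subtree is light. *)
Theorem last_heavy_head_big h x :
  head h -> \sum_v area v <= 2 * \sum_(v in subtree h) area v ->
  (forall v, head v -> (pos h < pos v)%N ->
     2 * \sum_(u in subtree v) area u < \sum_v area v) ->
  x \notin mono_comp adj col h ->
  2 * \sum_(v in region adj (~: mono_comp adj col h) x) area v <= \sum_v area v.
Proof.
move=> hh heavy light; set A := mono_comp _ _ _ => xA; set W := region _ _ _.
have inW v : (v \in W) = reach adj (~: A) x v by rewrite /W inE.
have WA v : v \in W -> v \notin A.
  move=> vW; rewrite -finset.in_setC; apply: (fintype.subsetP (region_sub _ _)) vW.
  by rewrite finset.in_setC.
have exitW u v : u \in W -> adj u v -> v \notin W -> v \in A.
  move=> uW uv; apply: contraR => vD; have uD := WA u uW; rewrite inW in uW.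
  by rewrite inW; apply: connect_trans uW _; apply: reach1; rewrite ?finset.in_setC.
have posA v : v \in A -> (pos h <= pos v)%N by rewrite inE; exact: head_first.
have exitP v : v \in W -> pc v \notin W -> [/\ pc v \in A, head v, v != root & adj (pc v) v].
  move=> vW pvW; have vr : v != root by apply: contraNneq pvW => E; rewrite E pc_root -E.
  have pa := pc_adj vr; have pA : pc v \in A by apply: (exitW v) => //; rewrite adj_sym.
  split=> //; rewrite /head (negbTE vr) /=; apply: contra (WA v vW) => /eqP c.
  exact: mono_comp_trans pA (mono1 pa c).
have layer v u d : v \in W -> pc v \notin W -> u \in W -> d \in A -> adj d u -> mono adj col v u.
  move=> vW pvW uW dA du; have [pA _ _ pa] := exitP v vW pvW.
  exact: (layer_mono adj_sym sc baseM xA vW uW pA dA pa du).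
have [rW|rW] := boolP (root \in W).
- have disj : [disjoint W & subtree h].
    apply/pred0P => w /=; apply/negP => /andP[wW]; rewrite inE => wh.
    have hA : h \in A by rewrite inE; exact: connect0.
    have hW : h \notin W by apply/negP => /WA; rewrite hA.
    have [z [zW pzW _]] := chain_exit wW hW wh.
    have [pzA hz zr za] := exitP z zW pzW.
    have early v : (pos v < pos h)%N -> v \in W.
      elim/pos_ind: v => // v vr ih vh.
      have pW := ih (ltn_trans (pc_pos vr) vh).
      apply: contraT => vW; have := exitW _ _ pW (pc_adj vr) vW.
      by move=> /posA; rewrite leqNgt vh.
    have hr : h != root by apply: contraNneq hW => ->.
    have yW := early _ (pc_pos hr).
    have zy : mono adj col z (pc h).
      by apply: layer hA _ => //; rewrite adj_sym pc_adj.
    have := head_first hz zy; rewrite leqNgt => /negP; apply.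
    by apply: (ltn_trans (pc_pos hr)); apply: leq_ltn_trans (pc_pos zr); exact: posA.
  have : \sum_(v in W) area v <= \sum_(v | v \notin subtree h) area v.
    by apply: area_le => v vW; apply/negP => vh; have /pred0P/(_ v) := disj; rewrite /= vW vh.
  have := heavy; rewrite [X in X <= _](bigID (mem (subtree h))) /=.
  rewrite [X in _ -> _ -> _ <= X](bigID (mem (subtree h))) /=.
  move=> hv; lra.
- have [W0|[w0 w0W]] := set_0Vmem W.
    rewrite W0 big_set0 mulr0; exact: sumr_ge0.
  have toroot w : fconnect pc w root.
    have : w \in subtree root by rewrite subtree_root finset.in_setT.
    by rewrite inE.
  have [z [zW pzW _]] := chain_exit w0W rW (toroot w0).
  have [pzA hz zr za] := exitP z zW pzW.
  have sub : W \subset subtree z.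
    apply/fintype.subsetP => w wW; rewrite inE.
    have [z' [z'W pz'W wz']] := chain_exit wW rW (toroot w).
    have [pA' hz' _ pa'] := exitP z' z'W pz'W.
    by rewrite (head_uniq hz hz' (layer _ _ _ zW pzW z'W pA' pa')).
  have lz : 2 * \sum_(u in subtree z) area u < \sum_v area v.
    by apply: light => //; apply: leq_ltn_trans (pc_pos zr); exact: posA.
  have : \sum_(v in W) area v <= \sum_(v in subtree z) area v.
    by apply: area_le => v; exact: (fintype.subsetP sub).
  lra.
Qed.

End Tree.

(** * A search that exhausts a colour before changing it *)

Section Search.
Variables (V : finType) (col : V -> bool) (nbs : V -> seq V) (root : V).
Definition nadj : rel V := fun x y => y \in nbs x.
Hypothesis nadj_sym : symmetric nadj.

(** Two stacks of edges to be explored, leading to a vertex of the same and of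
    the other colour, and the list of visited vertices paired with their
    parents, latest first. *)
Record search := Search {
  sfront : seq (V * V); sback : seq (V * V); sord : seq (V * V) }.

Definition push (w : V) (s : search) (x : V) : search :=
  if col x == col w then Search ((x, w) :: sfront s) (sback s) (sord s)
  else Search (sfront s) ((x, w) :: sback s) (sord s).

Definition visit (e : V * V) (s : search) : search :=
  if e.1 \in unzip1 (sord s) then s
  else foldl (push e.1) (Search (sfront s) (sback s) (e :: sord s)) (nbs e.1).

Definition search_step (s : search) : search :=
  match sfront s, sback s with
  | e :: f, b => visit e (Search f b (sord s))
  | [::], e :: b => visit e (Search [::] b (sord s))
  | [::], [::] => s
  end.

Definition search_init := Search [::] [:: (root, root)] [::].

Local Notation m := (mono nadj col).

(** The condition on an edge of changing colour says that it opens a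
    monochromatic component not met before. *)
Fixpoint search_tree (o : seq (V * V)) : Prop :=
  match o with
  | [::] => False
  | [:: e] => e = (root, root)
  | (w, p) :: o' => [/\ w \notin unzip1 o', p \in unzip1 o', nadj p w,
      (col p != col w -> forall v, v \in unzip1 o' -> ~~ m v w) & search_tree o']
  end.

Definition front_ok s := forall x w, (x, w) \in sfront s ->
  [/\ w \in unzip1 (sord s), nadj w x & col x = col w].
Definition back_ok s := forall x w, (x, w) \in sback s ->
  [/\ w \in unzip1 (sord s), nadj w x & col x <> col w].
Definition pending s := forall v x, v \in unzip1 (sord s) -> nadj v x ->
  [\/ x \in unzip1 (sord s), (x, v) \in sfront s | (x, v) \in sback s].

Definition search_inv s := s = search_init \/
  [/\ front_ok s, back_ok s, pending s & search_tree (sord s)].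

Lemma foldl_push w s l : let s' := foldl (push w) s l in
  [/\ sord s' = sord s,
      forall x v, ((x, v) \in sfront s') =
        ((x, v) \in sfront s) || [&& v == w, x \in l & col x == col w],
      forall x v, ((x, v) \in sback s') =
        ((x, v) \in sback s) || [&& v == w, x \in l & col x != col w]
    & size (sfront s') + size (sback s') = size (sfront s) + size (sback s) + size l]%N.
Proof.
elim: l s => [|y l ih] s /=.
  by split => //; [move=> x v; rewrite andbF orbF|move=> x v; rewrite andbF orbF|rewrite addn0].
have [e1 e2 e3 e4] := ih (push w s y); split.
- by rewrite e1 /push; case: ifP.
- move=> x v; rewrite e2 /push in_cons.
  have [cy|/negbTE cy] := boolP (col y == col w); have [->|xy] := eqVneq x y;
    rewrite /= ?in_cons ?xpair_eqE ?cy ?(negbTE xy) ?eqxx ?andbF ?andbT ?orbF //=;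
    by case: (v == w); case: (_ \in sfront s); rewrite ?orbT ?orbF ?andbT.
- move=> x v; rewrite e3 /push in_cons.
  have [cy|/negbTE cy] := boolP (col y == col w); have [->|xy] := eqVneq x y;
    rewrite /= ?in_cons ?xpair_eqE ?cy ?(negbTE xy) ?eqxx ?andbF ?andbT ?orbF //=;
    by case: (v == w); case: (_ \in sback s); rewrite ?orbT ?orbF ?andbT.
- by rewrite e4 /push; case: ifP => /= _; lia.
Qed.

Lemma closed_mono (o : seq V) v w :
  (forall v x, v \in o -> nadj v x -> col x = col v -> x \in o) ->
  v \in o -> m v w -> w \in o.
Proof.
move=> cl + /connectP[p + ->]; elim: p v => [|z p ih] v //= vs.
by move=> /andP[/andP[vz /eqP cz]]; apply: ih; apply: cl vs vz _.
Qed.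

(** The stack [sback] is used only when [sfront] is empty. At that time the
    visited set is closed under edges within a colour, so an unvisited vertex
    belongs to a new monochromatic component. *)
Lemma visit_inv e s : front_ok s -> back_ok s ->
  (forall v x, v \in unzip1 (sord s) -> nadj v x ->
    [\/ x \in unzip1 (sord s), (x, v) \in sfront s, (x, v) \in sback s | (x, v) = e]) ->
  search_tree (sord s) -> e.2 \in unzip1 (sord s) -> nadj e.2 e.1 ->
  (col e.2 != col e.1 -> sfront s = [::]) ->
  search_inv (visit e s).
Proof.
case: e => w p /= fo bo pd tr ps pw cpw; right; rewrite /visit /=.
have [ws|ws] := boolP (w \in unzip1 (sord s)).
  split => // v x vs vx; have [h|h|h|[-> _]] := pd v x vs vx;
  by [constructor 1|constructor 2|constructor 3|constructor 1].
have [e1 e2 e3 _] := foldl_push w (Search (sfront s) (sback s) ((w, p) :: sord s)) (nbs w).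
set s' := foldl _ _ _ in e1 e2 e3 *.
split.
- move=> x v; rewrite e2 e1 /= => /orP[/fo[a b c]|/and3P[/eqP-> xw /eqP->]].
    by rewrite in_cons a orbT.
  by rewrite in_cons eqxx.
- move=> x v; rewrite e3 e1 /= => /orP[/bo[a b c]|/and3P[/eqP-> xw /eqP cx]].
    by rewrite in_cons a orbT.
  by rewrite in_cons eqxx.
- move=> v x; rewrite e1 e2 e3 /= !in_cons => /predU1P[->|vs] vx.
    have [cx|cx] := boolP (col x == col w); [constructor 2|constructor 3];
      by rewrite eqxx [x \in nbs w]vx orbT.
  have [h|h|h|[-> _]] := pd v x vs vx.
  + by constructor 1; rewrite h orbT.
  + by constructor 2; rewrite h.
  + by constructor 3; rewrite h.
  + by constructor 1; rewrite eqxx.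
(* every edge within a colour that starts at a visited vertex has been
   followed *)
- have new : col p != col w -> forall v, v \in unzip1 (sord s) -> ~~ m v w.
    move=> cp v vs; apply: contra ws; apply: closed_mono vs => u x us ux cx.
    have [//|h|h|[E1 E2]] := pd u x us ux.
    + by rewrite (cpw cp) in h.
    + by have [_ _] := bo _ _ h; rewrite cx.
    + by move: cp; rewrite -E2 -E1 cx eqxx.
  by rewrite e1 /=; case: (sord s) tr ws ps new.
Qed.

Lemma search_step_inv s : search_inv s -> search_inv (search_step s).
Proof.
case=> [->|[fo bo pd tr]].
  right; rewrite /search_step /= /visit /=.
  have [e1 e2 e3 _] := foldl_push root (Search [::] [::] [:: (root, root)]) (nbs root).
  set s' := foldl _ _ _ in e1 e2 e3 *; split.
  - move=> x v; rewrite e2 e1 /= => /and3P[/eqP-> xw /eqP->].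
    by rewrite in_cons eqxx.
  - move=> x v; rewrite e3 e1 /= => /and3P[/eqP-> xw /eqP cx].
    by rewrite in_cons eqxx.
  - move=> v x; rewrite e1 e2 e3 /= !inE => /eqP-> vx.
    have [cx|cx] := boolP (col x == col root); [constructor 2|constructor 3];
      by rewrite eqxx [x \in nbs root]vx.
  - by rewrite e1.
rewrite /search_step; case E : (sfront s) => [|[x w] f].
  case E' : (sback s) => [|[x w] b]; first by right.
  have [ws wx cx] : [/\ w \in unzip1 (sord s), nadj w x & col x <> col w].
    by apply: bo; rewrite E' in_cons eqxx.
  apply: visit_inv => //=.
  - by move=> y v yb; apply: bo; rewrite E' in_cons yb orbT.
  - move=> v y vs vy; have [h|h|] := pd v y vs vy; first by constructor 1.
      by rewrite E in h.
    by rewrite E' in_cons => /predU1P[->|h]; [constructor 4|constructor 3].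
have [ws wx cx] : [/\ w \in unzip1 (sord s), nadj w x & col x = col w].
  by apply: fo; rewrite E in_cons eqxx.
apply: visit_inv => //=.
- by move=> y v yb; apply: fo; rewrite E in_cons yb orbT.
- move=> v y vs vy; have [h||h] := pd v y vs vy; [by constructor 1| |by constructor 3].
  by rewrite E in_cons => /predU1P[->|h]; [constructor 4|constructor 2].
- by rewrite cx eqxx.
Qed.

Lemma search_tree_size o : search_tree o -> (size o <= #|V|)%N /\ uniq (unzip1 o).
Proof.
move=> tr; suff u : uniq (unzip1 o).
  split => //; rewrite -(size_map fst) -(card_uniqP u); exact: max_card.
elim: o tr => [|[w p] o ih] // tr; case: o ih tr => [|e o] ih // [ws _ _ _ tr].
by change (uniq (w :: unzip1 (e :: o))); rewrite cons_uniq ws ih.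
Qed.

Variable d : nat.
Hypothesis deg : forall v, (size (nbs v) <= d)%N.

(** Each step pops an edge, and a visit pushes at most [d] edges but uses up a
    vertex worth [d.+1]. *)
Definition fuel s := (d.+1 * (#|V| - size (sord s)) + size (sfront s) + size (sback s))%N.

Lemma visit_fuel e s : search_inv (visit e s) -> (fuel (visit e s) <= fuel s)%N.
Proof.
rewrite /visit; case: ifP => // ws inv.
have [e1 _ _ e4] := foldl_push e.1 (Search (sfront s) (sback s) (e :: sord s)) (nbs e.1).
set s' := foldl _ _ _ in e1 e4 inv *.
have : (size (sord s') <= #|V|)%N.
  case: inv => [->//|[_ _ _ /search_tree_size[]]//].
rewrite /fuel e1 /= => le; rewrite -addnA e4 /=.
have := deg e.1.
move: le; move: (size (sord s)) (size (sfront s)) (size (sback s)) (size (nbs e.1)) => a f b k.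
move: #|V| => n an kd.
have -> : (n - a = (n - a.+1).+1)%N by lia.
rewrite mulnS; lia.
Qed.

Hypothesis nadj_conn : forall x y, connect nadj x y.

Lemma search_exhausted s : search_inv s -> sfront s = [::] -> sback s = [::] ->
  search_tree (sord s) /\ forall v, v \in unzip1 (sord s).
Proof.
case=> [->//|[_ _ pd tr]] f0 b0; split => // v.
have [u us] : exists u, u \in unzip1 (sord s).
  by case: (sord s) tr => // -[u p] o _; exists u; rewrite inE eqxx.
have /connectP[p + ->] := nadj_conn u v.
elim: p u us => [|z p ih] u us //= /andP[uz]; apply: ih.
by have [//||] := pd u z us uz; rewrite ?f0 ?b0.
Qed.

Lemma search_step_fuel s : search_inv s -> (fuel (search_step s) <= (fuel s).-1)%N.
Proof.
move=> inv; have := search_step_inv inv; rewrite /search_step.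
case E : (sfront s) => [|e f]; last first.
  by move=> /visit_fuel; rewrite /fuel E /=; lia.
case E' : (sback s) => [|e b]; last first.
  by move=> /visit_fuel; rewrite /fuel E E' /=; lia.
move=> _; have [tr all] := search_exhausted inv E E'.
have [_ u] := search_tree_size tr.
have : size (unzip1 (sord s)) = #|V|.
  by rewrite -(card_uniqP u); apply: eq_card => v; rewrite inE all.
by rewrite /fuel E E' /= size_map => ->; rewrite subnn muln0.
Qed.

Theorem search_complete n : (d.+1 * #|V| + 1 <= n)%N ->
  let o := sord (iter n search_step search_init) in
  search_tree o /\ forall v, v \in unzip1 o.
Proof.
move=> nb /=.
have [inv le] : search_inv (iter n search_step search_init) /\
    (fuel (iter n search_step search_init) <= d.+1 * #|V| + 1 - n)%N.
  elim: n {nb} => [|n [inv le]]; first by split; [left|rewrite /fuel /= !subn0; lia].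
  rewrite iterS; split; first exact: search_step_inv.
  by apply: leq_trans (search_step_fuel inv) _; lia.
have {le} : fuel (iter n search_step search_init) = 0%N.
  by move: nb le; move: (d.+1 * #|V|)%N => a; lia.
move: (iter _ _ _) inv => s inv /eqP; rewrite /fuel !addn_eq0 => /andP[/andP[_ /eqP f0] /eqP b0].
by apply: search_exhausted inv _ _; exact/size0nil.
Qed.

End Search.

(** * Subtree areas and the choice of a component *)

Section Centroid.
Variables (R : realFieldType) (V : finType) (col : V -> bool) (nbs : V -> seq V) (root : V).
Local Notation nadj := (nadj nbs).
Local Notation tree := (search_tree col nbs root).
Hypothesis nadj_sym : symmetric nadj.
Implicit Types (o : seq (V * V)).

Fixpoint parent o v := match o with
  | [::] => root
  | (w, p) :: o' => if v == w then p else parent o' v end.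

Fixpoint rank o v : nat := match o with
  | [::] => 0
  | (w, p) :: o' => if v == w then size o else rank o' v end.

Lemma unzip1_cons w p o : unzip1 ((w, p) :: o) = w :: unzip1 o.
Proof. by []. Qed.

Lemma tree_root o : tree o -> root \in unzip1 o.
Proof.
elim: o => [//|[w p] [|e o] ih].
  by move=> [-> _]; rewrite inE eqxx.
by move=> [_ _ _ _ /ih h]; rewrite unzip1_cons in_cons h orbT.
Qed.

Lemma tree_cons_neq w p o v : tree ((w, p) :: o) -> v \in unzip1 o -> (v == w) = false.
Proof.
case: o => [|e o] // [ws _ _ _ _] vo; apply/negbTE; apply: contraNneq ws => <-.
exact: vo.
Qed.

Lemma rank_le o v : (rank o v <= size o)%N.
Proof. by elim: o => [|[w p] o ih] //=; case: ifP => // _; rewrite (leq_trans ih). Qed.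

(** Dispenses with the singleton case in the definition of [search_tree]. *)
Lemma tree_ind (P : seq (V * V) -> Prop) : P [:: (root, root)] ->
  (forall w p o, tree ((w, p) :: o) -> tree o -> w \notin unzip1 o ->
     p \in unzip1 o -> nadj p w ->
     (col p != col w -> forall v, v \in unzip1 o -> ~~ mono nadj col v w) ->
     P o -> P ((w, p) :: o)) ->
  forall o, tree o -> P o.
Proof.
move=> P1 PS; elim=> [//|[w p] [|e o] ih].
  by move=> [-> ->].
by move=> t; have [a b c d f] := t; apply: PS => //; exact: ih.
Qed.

Lemma parent_in o v : tree o -> v \in unzip1 o -> parent o v \in unzip1 o.
Proof.
move=> t; elim/tree_ind: t v => [|w p o' t to wo po pw _ ih] v.
  by rewrite !inE /= => /eqP ->; rewrite eqxx.
rewrite unzip1_cons !in_cons /=; have [_ _|_ /=] := eqVneq v w.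
  by rewrite po orbT.
by move=> /ih ->; rewrite orbT.
Qed.

Lemma parent_root o : tree o -> parent o root = root.
Proof.
elim/tree_ind => [|w p o' t to wo po pw _ ih] /=; first by rewrite eqxx.
by rewrite (tree_cons_neq t (tree_root to)).
Qed.

Lemma parent_adj o v : tree o -> v \in unzip1 o -> v != root -> nadj (parent o v) v.
Proof.
move=> t; elim/tree_ind: t v => [|w p o' t to wo po pw _ ih] v.
  by rewrite inE => /eqP ->; rewrite eqxx.
rewrite unzip1_cons in_cons /=; have [-> //|_ /=] := eqVneq v w.
exact: ih.
Qed.

Lemma parent_rank o v : tree o -> v \in unzip1 o -> v != root ->
  (rank o (parent o v) < rank o v)%N.
Proof.
move=> t; elim/tree_ind: t v => [|w p o' t to wo po pw _ ih] v.
  by rewrite inE => /eqP ->; rewrite eqxx.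
rewrite unzip1_cons in_cons /=; have [_ _ _|_ /= vo vr] := eqVneq v w.
  by rewrite (tree_cons_neq t po) ltnS rank_le.
by rewrite (tree_cons_neq t (parent_in to vo)); exact: ih.
Qed.

(** A second head of the same component would have been reached by an edge of
    changing colour into a component already met. *)
Lemma tree_head_uniq o u v : tree o -> u \in unzip1 o -> v \in unzip1 o ->
  head col root (parent o) u -> head col root (parent o) v -> mono nadj col u v -> u = v.
Proof.
move=> t; elim/tree_ind: t u v => [|w p o' t to wo po pw new ih] u v.
  by rewrite !inE => /eqP-> /eqP->.
have wr : (w == root) = false.
  by rewrite eq_sym (tree_cons_neq t (tree_root to)).
rewrite unzip1_cons !in_cons /head /=.
have [->|uw] := eqVneq u w; have [->|vw] := eqVneq v w => //=.
- rewrite wr /= => _ vo /new h _; rewrite (mono_sym col nadj_sym) => vu.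
  by have /negP := h v vo.
- rewrite wr /= => uo _ _ /new h uv.
  by have /negP := h u uo.
- by move=> uo vo; exact: ih.
Qed.

(** Children precede their parents in [o], so one pass that adds the value of
    each vertex to its parent computes the sums over subtrees in place. *)
Fixpoint branch_sums o (S : V -> R) : V -> R := match o with
  | (w, p) :: o' => if o' is [::] then S
      else branch_sums o' (fun v => if v == p then S p + S w else S v)
  | [::] => S end.

Lemma branch_sums_cons w p o S : o != [::] -> branch_sums ((w, p) :: o) S =
  branch_sums o (fun v => if v == p then S p + S w else S v).
Proof. by case: o. Qed.

Lemma tree_neq0 o : tree o -> o != [::]. Proof. by case: o. Qed.

Lemma branch_sums_out o S v : tree o -> v \notin unzip1 o -> branch_sums o S v = S v.
Proof.
move=> t; elim/tree_ind: t S v => [|w p o' t to wo po pw _ ih] S v //.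
rewrite unzip1_cons in_cons negb_or => /andP[vw vo].
rewrite branch_sums_cons ?tree_neq0// ih//.
by case: eqP vo => // ->; rewrite po.
Qed.

(** Moving the value of the latest vertex to its parent does not change the
    sums over the subtrees of the other vertices. *)
Lemma branch_sums_sum o (pc : V -> V) S v : tree o ->
  {in unzip1 o, pc =1 parent o} -> v \in unzip1 o ->
  branch_sums o S v = \sum_(u | (u \in unzip1 o) && fconnect pc u v) S u.
Proof.
move=> t; elim/tree_ind: t S v => [|w p o' t to wo po pw _ ih] S v pcE.
  rewrite inE => /eqP -> /=; rewrite (bigD1 root) /= ?inE ?eqxx ?connect0//.
  rewrite big1 ?addr0// => u /andP[/andP[]]; rewrite inE => /eqP-> _.
  by rewrite eqxx.
have pcE' : {in unzip1 o', pc =1 parent o'}.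
  move=> u uo; rewrite pcE /= ?(tree_cons_neq t uo)//.
  by rewrite ?unzip1_cons in_cons uo orbT.
have pcw : pc w = p by rewrite pcE /= ?eqxx// inE eqxx.
have stay u x : u \in unzip1 o' -> fconnect pc u x -> x \in unzip1 o'.
  move=> uo /iter_findex <-; elim: (findex _ _ _) => // n; rewrite iterS => h.
  by rewrite pcE'//; exact: parent_in.
rewrite branch_sums_cons ?tree_neq0// unzip1_cons in_cons => vin.
have split_w : \sum_(u | (u \in w :: unzip1 o') && fconnect pc u v) S u =
   (if fconnect pc w v then S w else 0) +
   \sum_(u | (u \in unzip1 o') && fconnect pc u v) S u.
  rewrite (bigID (pred1 w)) /=; congr (_ + _).
    rewrite (eq_bigl (fun u => fconnect pc w v && (u == w))); last first.
      move=> u; rewrite in_cons; case: eqP => [->|]; rewrite ?andbF ?andbT//.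
    by rewrite big_mkcondl; case: ifP => _; rewrite big_pred1_eq // .
  apply: eq_bigl => u; rewrite in_cons; case: eqP => [->|] /=; last by rewrite andbT.
  by rewrite (negbTE wo) andbF.
rewrite split_w; case: (eqVneq v w) vin => [->|vw] /= vin.
  rewrite connect0 branch_sums_out//.
  have -> : (w == p) = false.
    by apply/negbTE; apply: contraNneq wo => ->.
  rewrite big1 ?addr0// => u /andP[uo /(stay _ _ uo)]; by rewrite (negbTE wo).
rewrite ih//.
have -> : fconnect pc w v = fconnect pc p v.
  apply/idP/idP => [/iter_findex|h]; last first.
    by apply: connect_trans h; rewrite -pcw fconnect1.
  case: (findex _ _ _) => [E|n]; first by rewrite /= in E; rewrite E eqxx in vw.
  by rewrite iterSr pcw => <-; exact: fconnect_iter.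
case: ifP => pv; last first.
  rewrite add0r; apply: eq_bigr => u /andP[uo uv].
  by case: eqP uv => // ->; rewrite pv.
rewrite (bigD1 p) /= ?po ?pv// [in RHS](bigD1 p) /= ?po ?pv// eqxx addrA [_ + S w]addrC.
by congr (_ + _); apply: eq_bigr => u /andP[_ /negbTE ->].
Qed.

(** The recursion meets the latest vertex first, so this is the last head
    whose subtree has at least half of [T]. *)
Definition select o (S : V -> R) (T : R) : V :=
  foldr (fun e b => if (col e.2 != col e.1) && (T <= 2 * S e.1) then e.1 else b) root o.

Lemma select_last o S T : tree o -> T <= 2 * S root ->
  let h := select o S T in
  [/\ h \in unzip1 o, head col root (parent o) h, T <= 2 * S h &
      forall v, v \in unzip1 o -> head col root (parent o) v ->
        (rank o h < rank o v)%N -> 2 * S v < T].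
Proof.
move=> t hr; elim/tree_ind: t => [|w p o' t to wo po pw _ [ho hh hS hl]] /=.
  rewrite eqxx /= inE eqxx /head eqxx; split=> // v.
  by rewrite inE => /eqP-> _; rewrite eqxx ltnn.
have wr : (w == root) = false.
  by rewrite eq_sym (tree_cons_neq t (tree_root to)).
case: ifP => [/andP[cpw Tw]|good].
  rewrite !inE eqxx /head /= eqxx wr cpw; split => // v.
  rewrite in_cons; case: eqP => [->|_ /= _ _]; first by rewrite ltnn.
  by rewrite ltnNge (leq_trans (rank_le _ _)).
have hw := tree_cons_neq t ho.
rewrite /head /= hw in_cons ho orbT; split => // v.
rewrite in_cons; case: eqP => [-> _|_ /=]; last exact: hl.
by rewrite wr /= => cpw _; rewrite ltNge; move: good; rewrite cpw /= => ->.
Qed.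

Theorem centroid_big (base : {set V}) o (area : V -> R) x :
  simply_connected nadj base -> {in base &, forall u v, mono nadj col u v} ->
  tree o -> (forall v, v \in unzip1 o) -> (forall v, 0 <= area v) ->
  let h := select o (branch_sums o area) (\sum_v area v) in
  x \notin mono_comp nadj col h ->
  2 * \sum_(v in region nadj (~: mono_comp nadj col h) x) area v <= \sum_v area v.
Proof.
move=> sc baseM t all area0 h xh.
have SE v : branch_sums o area v = \sum_(u in subtree (parent o) v) area u.
  rewrite (branch_sums_sum _ t (fun _ _ => erefl) (all v)).
  by apply: eq_bigl => u; rewrite all inE.
have pr := parent_root t.
have pa v := parent_adj t (all v); have pp v := parent_rank t (all v).
have rootT : branch_sums o area root = \sum_v area v.
  by rewrite SE (subtree_root pp); apply: eq_bigl => u; rewrite finset.in_setT.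
have [|_ hh hS hl] := @select_last o (branch_sums o area) (\sum_v area v) t.
  rewrite rootT ler_peMl ?ler1n//; exact: sumr_ge0.
apply: (last_heavy_head_big nadj_sym sc baseM pr pa pp _ area0 hh _ _ xh).
- by move=> u v; exact: tree_head_uniq.
- by rewrite -SE.
- by move=> v hv hlt; rewrite -SE; exact: hl.
Qed.

End Centroid.

(** * The grid of cells *)

Section Grid.
Variable M : nat.
Local Notation V := ('I_M.+1 * 'I_M.+1)%type.

(** Row [i - 1], [i] or [i + 1] for [d = 0, 1, 2], clamped to the range from
    [0] to [M]; the form uses only the operations of index expressions of
    programs. *)
Definition next_row (i d : nat) : nat := ((i + d - 1) - ((i + d - 1) - M))%N.
(** Column [j + d - 1] modulo [M.+1]; the factors [1 - (1 - _)] and [1 - (M.+2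
    - _)] are truncated subtractions used as tests. *)
Definition next_col (j d : nat) : nat :=
  (j + d + M - M.+1 * (1 - (1 - (j + d))) - M.+1 * (1 - (M.+2 - (j + d))))%N.

(** Neighbours share at least a corner, and a cell is among its own
    neighbours. *)
Definition grid_nbs (v : V) : seq V :=
  [seq (inord (next_row v.1 d), inord (next_col v.2 e)) | d <- iota 0 3, e <- iota 0 3].

Definition close (a b : nat) : bool := (a <= b.+1)%N && (b <= a.+1)%N.
Definition cyc_close (a b : nat) : bool :=
  [|| close a b, (a == 0%N) && (b == M) | (a == M) && (b == 0%N)].

Lemma next_rowE i d : (i <= M)%N -> (d < 3)%N ->
  (next_row i d <= M)%N /\ close i (next_row i d).
Proof. by move=> iM d3; rewrite /next_row /close; split; lia. Qed.

Lemma next_colE j d : (j <= M)%N -> (d < 3)%N ->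
  (next_col j d <= M)%N /\ cyc_close j (next_col j d).
Proof.
move=> jM d3; rewrite /next_col /cyc_close /close.
have [j0|j0] := posnP (j + d)%N.
  have [-> ->] : j = 0%N /\ d = 0%N by lia.
  have -> : (1 - (1 - (0 + 0)) = 0)%N by [].
  have -> : (1 - (M.+2 - (0 + 0)) = 0)%N by lia.
  by rewrite !muln0; split; lia.
have -> : (1 - (1 - (j + d)) = 1)%N by lia.
have [h|h] := leqP M.+2 (j + d).
  have -> : (1 - (M.+2 - (j + d)) = 1)%N by lia.
  by rewrite muln1; split; lia.
have -> : (1 - (M.+2 - (j + d)) = 0)%N by lia.
by rewrite muln1 muln0 subn0; split; lia.
Qed.

Lemma next_row_onto i i' : (i <= M)%N -> (i' <= M)%N -> close i i' ->
  exists2 d, (d < 3)%N & next_row i d = i'.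
Proof.
move=> iM i'M /andP[a b]; exists (i'.+1 - i)%N; first by lia.
by rewrite /next_row; lia.
Qed.

Lemma next_col_onto j j' : (j <= M)%N -> (j' <= M)%N -> cyc_close j j' ->
  exists2 d, (d < 3)%N & next_col j d = j'.
Proof.
move=> jM j'M /or3P[/andP[a b]|/andP[/eqP-> /eqP->]|/andP[/eqP-> /eqP->]].
- exists (j'.+1 - j)%N; first by lia.
  rewrite /next_col; have -> : (j + (j'.+1 - j) = j'.+1)%N by lia.
  have -> : (1 - (1 - j'.+1) = 1)%N by lia.
  have -> : (1 - (M.+2 - j'.+1) = 0)%N by lia.
  by rewrite muln1 muln0; lia.
- exists 0%N => //; rewrite /next_col.
  have -> : (1 - (1 - (0 + 0)) = 0)%N by [].
  have -> : (1 - (M.+2 - (0 + 0)) = 0)%N by lia.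
  by rewrite !muln0; lia.
- exists 2%N => //; rewrite /next_col.
  have -> : (1 - (1 - (M + 2)) = 1)%N by lia.
  have -> : (1 - (M.+2 - (M + 2)) = 1)%N by lia.
  by rewrite muln1; lia.
Qed.

Local Notation gadj := (nadj grid_nbs).

Lemma gadjE x y : gadj x y = close x.1 y.1 && cyc_close x.2 y.2.
Proof.
case: x y => [i j] [i' j']; apply/idP/idP.
  move=> /allpairsP[[d e] []]; rewrite !mem_iota !add0n => d3 e3 [-> ->].
  have [a a'] := next_rowE (ltn_ord i : i <= M)%N d3.
  have [b b'] := next_colE (ltn_ord j : j <= M)%N e3.
  by rewrite /= !inordK ?ltnS// a' b'.
move=> /= /andP[ii jj].
have [d d3 dE] := next_row_onto (ltn_ord i : i <= M)%N (ltn_ord i' : i' <= M)%N ii.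
have [e e3 eE] := next_col_onto (ltn_ord j : j <= M)%N (ltn_ord j' : j' <= M)%N jj.
apply/allpairsP; exists (d, e); split; rewrite ?mem_iota//=.
by rewrite dE eE !inord_val.
Qed.

Lemma cyc_close_sym a b : cyc_close a b = cyc_close b a.
Proof. by rewrite /cyc_close /close; lia. Qed.

Lemma gadj_sym : symmetric gadj.
Proof.
by move=> x y; rewrite !gadjE cyc_close_sym; congr andb; rewrite /close andbC.
Qed.

Lemma close_refl a : close a a. Proof. by rewrite /close; lia. Qed.
Lemma cyc_close_refl a : cyc_close a a. Proof. by rewrite /cyc_close close_refl. Qed.

(** Meant for the polar rows, whose cells share their sample. *)
Lemma row_mono (col : V -> bool) i : (forall j j', col (i, j) = col (i, j')) ->
  forall j j', mono gadj col (i, j) (i, j').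
Proof.
move=> ci; suff h j : mono gadj col (i, ord0) (i, j).
  by move=> j j'; apply: connect_trans (h j'); rewrite -/(mono _ _ _ _) mono_sym//; exact: gadj_sym.
case: j => j; elim: j => [|j ih] jM.
  by rewrite (_ : Ordinal jM = ord0); [exact: connect0|exact: val_inj].
apply: connect_trans (ih (ltnW jM)) _; apply: mono1 => //.
by rewrite gadjE /= close_refl /cyc_close /close; lia.
Qed.

Lemma gadj_conn x y : connect gadj x y.
Proof.
have e : connect gadj =2 mono gadj (fun=> true).
  by apply: eq_connect => u v /=; rewrite eqxx andbT.
suff h z : connect gadj (ord0, ord0) z.
  by apply: connect_trans (h y); rewrite (sym_connect_sym gadj_sym).
case: z => i j; apply: (@connect_trans _ _ (ord0, j)).
  by rewrite e; exact: row_mono.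
case: i => i; elim: i => [|i ih] iM.
  by rewrite (_ : Ordinal iM = ord0); [exact: connect0|exact: val_inj].
apply: connect_trans (ih (ltnW iM)) _; apply: connect1.
by rewrite gadjE /= cyc_close_refl andbT /close; lia.
Qed.

Definition first_row : {set V} := [set v | v.1 == ord0].

(** A cocycle that vanishes on the first row is integrated down the columns
    from that row; the triangle condition makes the result compatible with the
    edges inside a row, so the sum around a column closes up as well. *)
Lemma grid_simply_connected : simply_connected gadj first_row.
Proof.
move=> c csym tri base0.
pose H := fix H i j := if i is i'.+1 then H i' j (+) c (inord i', j) (inord i, j) else false.
have vert (i : nat) j : (i.+1 <= M)%N -> gadj (inord i, j) (inord i.+1, j).
  by move=> iM; rewrite gadjE /= cyc_close_refl andbT !inordK ?ltnS// 1?ltnW// /close; lia.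
have row i (j j' : 'I_M.+1) : (i <= M)%N -> cyc_close j j' ->
    c (inord i, j) (inord i, j') = H i j (+) H i j'.
  move=> iM jj; elim: i iM => [|i ih] iM.
    rewrite base0 ?inE//=; try by apply/eqP/val_inj; rewrite /= inordK.
    by rewrite gadjE /= close_refl.
  have ab : gadj (inord i, j) (inord i, j') by rewrite gadjE /= close_refl.
  have ab' : gadj (inord i, j) (inord i.+1, j').
    by rewrite gadjE /= jj andbT !inordK ?ltnS// 1?ltnW// /close; lia.
  have a'b' : gadj (inord i.+1, j) (inord i.+1, j') by rewrite gadjE /= close_refl.
  have aa' := vert i j iM; have bb' := vert i j' iM.
  have e1 := tri _ _ _ ab bb' ab'; have e2 := tri _ _ _ aa' a'b' ab'.
  rewrite /= -/(H i j) -/(H i j'); move: e1 e2; rewrite (ih (ltnW iM)).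
  move=> <-; case: (c _ _); case: (c _ _); case: (c _ _); by case: (H i j); case: (H i j').
exists (fun v : V => H v.1 v.2) => -[i j] [i' j'] /=.
have key (k k' : 'I_M.+1) l l' : (k <= k')%N -> gadj (k, l) (k', l') ->
    c (k, l) (k', l') = H k l (+) H k' l'.
  move=> kk; rewrite gadjE /= => /andP[/andP[_ k'k] ll].
  have [e|e] : k' = k :> nat \/ k' = k.+1 :> nat by lia.
    have -> : k' = k by exact: val_inj.
    by have := row k l l' (ltn_ord k) ll; rewrite inord_val.
  have k'E : k' = inord k.+1 by apply: val_inj; rewrite /= inordK -?e.
  have kM : (k.+1 <= M)%N by rewrite -e; exact: (ltn_ord k').
  have v := vert k l' kM; rewrite inord_val in v.
  have ab : gadj (k, l) (k, l') by rewrite gadjE /= close_refl.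
  have ab' : gadj (k, l) (inord k.+1, l').
    by rewrite gadjE /= ll andbT inordK// /close; lia.
  have := tri _ _ _ ab v ab'; have := row k l l' (ltn_ord k) ll; rewrite inord_val => ->.
  rewrite e k'E => <- /=; rewrite inord_val.
  by case: (H k l); case: (H k l'); case: (c _ _).
move=> adj; have [h|h] := leqP i i'; first exact: key.
rewrite csym addbC key// 1?ltnW//.
by rewrite [nadj _ _ _]gadj_sym.
Qed.

Lemma grid_deg v : size (grid_nbs v) = 9. Proof. by rewrite size_allpairs. Qed.

End Grid.

(** * Correctness and cost of programs *)

Section Hoare.
Context {R : realType}.
Variable f : S2 R -> R.
Local Notation state := (@state R).
Implicit Types (P Q : state -> Prop).

(** Total correctness with an upper bound on the cost. *)
Definition runs (c : com) (T : nat) P Q := forall st, P st ->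
  exists t st', [/\ exec f c st t st', (t <= T)%N & Q st'].

Lemma runs_weaken c T T' P P' Q Q' : runs c T P Q -> (T <= T')%N ->
  (forall st, P' st -> P st) -> (forall st, Q st -> Q' st) -> runs c T' P' Q'.
Proof.
move=> h TT PP QQ st /PP/h[t [st' [ex tT Qs]]]; exists t, st'; split => //.
  exact: leq_trans TT.
exact: QQ.
Qed.

Lemma runs_skip P : runs Skip 1 P P.
Proof. by move=> st Ps; exists 1%N, st; split => //; exact: ExecSkip. Qed.

Lemma runs_nset x i e P Q :
  (forall st, P st -> Q (set_nat st x (neval st i) (neval st e))) ->
  runs (NSet x i e) (ncost i + ncost e).+1 P Q.
Proof.
move=> h st Ps; exists (ncost i + ncost e).+1, (set_nat st x (neval st i) (neval st e)).
by split; [exact: ExecNSet|exact: leqnn|exact: h].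
Qed.

Lemma runs_rset x i e P Q :
  (forall st, P st -> Q (set_real st x (neval st i) (reval st e))) ->
  runs (RSet x i e) (ncost i + rcost e).+1 P Q.
Proof.
move=> h st Ps; exists (ncost i + rcost e).+1, (set_real st x (neval st i) (reval st e)).
by split; [exact: ExecRSet|exact: leqnn|exact: h].
Qed.

Lemma runs_query x i a b c P Q :
  (forall st, P st -> exists p : S2 R,
     \val p = vec3 (reval st a) (reval st b) (reval st c) /\
     Q (set_real st x (neval st i) (f p))) ->
  runs (Query x i a b c) (ncost i + rcost a + rcost b + rcost c).+1 P Q.
Proof.
move=> h st Ps; have [p [pE Qp]] := h st Ps.
exists (ncost i + rcost a + rcost b + rcost c).+1, (set_real st x (neval st i) (f p)).
by split; [exact: ExecQuery|exact: leqnn|].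
Qed.

Lemma runs_seq c1 c2 T1 T2 P Q S : runs c1 T1 P Q -> runs c2 T2 Q S ->
  runs (Seq c1 c2) (T1 + T2) P S.
Proof.
move=> h1 h2 st /h1[t1 [st1 [e1 l1 /h2[t2 [st2 [e2 l2 Ss]]]]]].
exists (t1 + t2)%N, st2; split => //; [exact: ExecSeq e1 e2|exact: leq_add].
Qed.

(** The bound adds up the costs of both branches, which saves a maximum. *)
Lemma runs_if b c1 c2 T1 T2 P Q :
  runs c1 T1 (fun st => P st /\ beval st b) Q ->
  runs c2 T2 (fun st => P st /\ ~~ beval st b) Q ->
  runs (If b c1 c2) (bcost b + (T1 + T2)) P Q.
Proof.
move=> h1 h2 st Ps; have [bt|bf] := boolP (beval st b).
  have [t [st' [e l Qs]]] := h1 st (conj Ps bt).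
  exists (bcost b + t)%N, st'; split => //; first exact: ExecIfTrue.
  by rewrite leq_add2l (leq_trans l)// leq_addr.
have [t [st' [e l Qs]]] := h2 st (conj Ps bf).
exists (bcost b + t)%N, st'; split => //; first exact: ExecIfFalse.
by rewrite leq_add2l (leq_trans l)// leq_addl.
Qed.

Definition For (x : nat) (n : nexp) (body : com) : com :=
  Seq (NSet x (NConst 0) (NConst 0))
    (While (BNLe (NAdd (NGet x (NConst 0)) (NConst 1)) n)
      (Seq body (NSet x (NConst 0) (NAdd (NGet x (NConst 0)) (NConst 1))))).

(** [I k] is the invariant before the pass with counter [k]. It refers to the
    state after the counter has been set, and the body must leave the counter
    alone. *)
Lemma runs_for x n body T (I : nat -> state -> Prop) m P :
  (forall st, P st -> I 0%N (set_nat st x 0 0)) ->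
  (forall k st, I k st -> neval st n = m) ->
  (forall k, (k < m)%N -> runs body T (fun st => I k st /\ nats st x 0 = k)
     (fun st => I k.+1 (set_nat st x 0 k.+1) /\ nats st x 0 = k)) ->
  runs (For x n body) (m * (T + ncost n + 11) + ncost n + 8) P (I m).
Proof.
move=> h0 hn hb; apply: (@runs_weaken _ (3 + (m * (T + ncost n + 11) + (ncost n + 5))) _ P P _ _ _ _ (fun _ h => h) (fun _ h => h)); last by lia.
apply: (@runs_seq _ _ _ _ _ (fun st => I 0%N st /\ nats st x 0 = 0%N)).
  by apply: runs_nset => st /h0 /= h; split => //; rewrite /upd !eqxx.
suff H r k : (k + r = m)%N ->
  runs (While (BNLe (NAdd (NGet x (NConst 0)) (NConst 1)) n)
      (Seq body (NSet x (NConst 0) (NAdd (NGet x (NConst 0)) (NConst 1)))))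
   (r * (T + ncost n + 11) + (ncost n + 5)) (fun st => I k st /\ nats st x 0 = k) (I m).
  exact: (H m 0%N).
elim: r k => [|r ih] k km st [Ik kE].
  rewrite addn0 in km; subst m.
  exists (bcost (BNLe (NAdd (NGet x (NConst 0)) (NConst 1)) n)), st; split => //.
  - by apply: ExecWhileFalse; rewrite /= (hn _ _ Ik) kE; lia.
  - by rewrite /=; lia.
have klt : (k < m)%N by lia.
have [t1 [st1 [e1 l1 [I1 k1]]]] := hb k klt st (conj Ik kE).
have km' : (k.+1 + r = m)%N by lia.
have pre : I k.+1 (set_nat st1 x 0 k.+1) /\ nats (set_nat st1 x 0 k.+1) x 0 = k.+1.
  by split => //; rewrite /= /upd !eqxx.
have [t2 [st2 [e2 l2 I2]]] := ih k.+1 km' _ pre.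
exists (bcost (BNLe (NAdd (NGet x (NConst 0)) (NConst 1)) n) + (t1 + 6) + t2)%N, st2.
split => //; last by rewrite /=; lia.
apply: ExecWhileTrue e2; first by rewrite /= (hn _ _ Ik) kE; lia.
apply: ExecSeq e1 _.
have -> : set_nat st1 x 0 k.+1 = set_nat st1 x (neval st1 (NConst 0))
   (neval st1 (NAdd (NGet x (NConst 0)) (NConst 1))) by rewrite /= k1 addn1.
exact: ExecNSet.
Qed.

(** Unrolled loop over a list that is part of the program text. *)
Definition seqs (A : Type) (body : A -> com) (l : seq A) : com :=
  foldr (fun a c => Seq (body a) c) Skip l.

Lemma runs_seqs (A : eqType) (body : A -> com) (l : seq A) T (I : seq A -> state -> Prop) :
  (forall l1 a, a \in l -> runs (body a) T (I l1) (I (rcons l1 a))) ->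
  runs (seqs body l) (size l * T + 1) (I [::]) (I l).
Proof.
move=> h; suff H l1 l2 : {subset l2 <= l} ->
    runs (seqs body l2) (size l2 * T + 1) (I l1) (I (l1 ++ l2)).
  exact: (H [::] l).
elim: l2 l1 => [|a l2 ih] l1 sub /=.
  by rewrite cats0 mul0n add0n; exact: runs_skip.
rewrite -cat_rcons mulSn -addnA; apply: runs_seq.
  by apply: h; apply: sub; rewrite in_cons eqxx.
by apply: ih => b bl; apply: sub; rewrite in_cons bl orbT.
Qed.

End Hoare.

(** * The median program *)

Section Wp.
Context {R : realType}.
Variable f : S2 R -> R.
Local Notation state := (@state R).

(** Weakest precondition; the value at a loop is a dummy, loops being dealt
    with by [runs_for]. *)
Fixpoint wp (c : com) (Q : state -> Prop) : state -> Prop :=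
  match c with
  | Skip => Q
  | NSet x i e => fun st => Q (set_nat st x (neval st i) (neval st e))
  | RSet x i e => fun st => Q (set_real st x (neval st i) (reval st e))
  | Query x i a b c => fun st => exists p : S2 R,
     \val p = vec3 (reval st a) (reval st b) (reval st c) /\
     Q (set_real st x (neval st i) (f p))
  | Seq c1 c2 => wp c1 (wp c2 Q)
  | If b c1 c2 => fun st => if beval st b then wp c1 Q st else wp c2 Q st
  | While _ _ => fun=> False
  end.

Fixpoint wcost (c : com) : nat :=
  match c with
  | Skip => 1
  | NSet x i e => (ncost i + ncost e).+1
  | RSet x i e => (ncost i + rcost e).+1
  | Query x i a b c => (ncost i + rcost a + rcost b + rcost c).+1
  | Seq c1 c2 => wcost c1 + wcost c2
  | If b c1 c2 => bcost b + (wcost c1 + wcost c2)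
  | While _ _ => 0
  end.

Lemma runs_wp c (P Q : state -> Prop) : (forall st, P st -> wp c Q st) ->
  runs f c (wcost c) P Q.
Proof.
elim: c P Q => [|x i e|x i e|x i a b c|c1 ih1 c2 ih2|b c1 ih1 c2 ih2|b c _] P Q h /=.
- by apply: runs_weaken (@runs_skip _ f P) _ _ _.
- exact: runs_nset.
- exact: runs_rset.
- exact: runs_query.
- apply: runs_seq (ih1 P (wp c2 Q) h) _; exact: ih2.
- apply: runs_if.
    by apply: ih1 => st [/h /=]; case: ifP.
  by apply: ih2 => st [/h /=]; case: ifP.
- by move=> st /h.
Qed.

End Wp.

Section Program.

(* Cell [(i, j)] has the code [i * N + j], and arrays of that length are
   indexed by codes. Naturals: 0 is N, 1 and 2 the row and column counters, 5
   and 6 the row and column of each cell, 7 its colour, 8 its visited mark, 9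
   and 10 the stack of edges to the same colour (targets and sources) with
   height in 11, 12, 13 and 14 the same for edges of changing colour, 15 the
   cells in visiting order, 16 their parents, 17 the number of visited cells,
   18, 19 and 20 the current cell, its parent and a neighbour, 21 and 24 loop
   counters, 22 a flag telling that an edge was popped, 23 the selected cell.
   Reals: 0 is the output, 1 the samples, 2 the scale, 3 the areas and later
   the subtree areas, 4 the total area. *)
Definition cell x := NGet x (NConst 0).
Definition cN := cell 0.
Definition incr x := NSet x (NConst 0) (NAdd (cell x) (NConst 1)).

(** The circle constant is not an embedded natural, but four times an
    arctangent. *)
Definition piE := RMul (ROfNat (NConst 4)) (RFun Atan (ROfNat (NConst 1))).
Definition angleE (k n : nexp) := RDiv (RMul (ROfNat k) piE) (ROfNat n).
Definition phiE := angleE (cell 1) (NSub cN (NConst 1)).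
Definition thetaE := angleE (NMul (NConst 2) (cell 2)) cN.

Definition sample_body : com :=
  Seq (NSet 5 (cell 24) (cell 1))
  (Seq (NSet 6 (cell 24) (cell 2))
  (Seq (Query 1 (cell 24) (RMul (RFun Sin phiE) (RFun Cos thetaE))
         (RMul (RFun Sin phiE) (RFun Sin thetaE)) (RFun Cos phiE))
  (Seq (RSet 3 (cell 24) (RSub (RFun Cos (angleE (cell 1) cN))
         (RFun Cos (angleE (NAdd (cell 1) (NConst 1)) cN))))
  (Seq (RSet 4 (NConst 0) (RAdd (RGet 4 (NConst 0)) (RGet 3 (cell 24))))
  (Seq (incr 2)
  (If (BNLe cN (cell 2)) (Seq (NSet 2 (NConst 0) (NConst 0)) (incr 1)) Skip)))))).

Definition sample : com := For 24 (NMul cN cN) sample_body.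

(** Code of the neighbour of [w] with offset [de], following [next_row] and
    [next_col]. *)
Definition nextE (w : nexp) (de : nat * nat) : nexp :=
  let a := NSub (NAdd (NGet 5 w) (NConst de.1)) (NConst 1) in
  let b := NAdd (NGet 6 w) (NConst de.2) in
  NAdd (NMul (NSub a (NSub a (NSub cN (NConst 1)))) cN)
    (NSub (NSub (NAdd b (NSub cN (NConst 1)))
      (NMul cN (NSub (NConst 1) (NSub (NConst 1) b))))
      (NMul cN (NSub (NConst 1) (NSub (NAdd cN (NConst 1)) b)))).

Definition offsets : seq (nat * nat) := [seq (d, e) | d <- iota 0 3, e <- iota 0 3].

Definition diffE := RSub (RGet 1 (cell 24)) (RGet 1 (cell 20)).
Definition scale_body (de : nat * nat) : com :=
  Seq (NSet 20 (NConst 0) (nextE (cell 24) de))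
    (If (BRLe (RGet 2 (NConst 0)) diffE) (RSet 2 (NConst 0) diffE) Skip).
Definition scale : com := For 24 (NMul cN cN) (seqs scale_body offsets).

Definition paint_body : com :=
  If (BRLe (ROfNat (NConst 0)) (RFun Sin (RDiv (RSub (RGet 1 (cell 24)) (RGet 1 (NConst 0)))
     (RGet 2 (NConst 0))))) (NSet 7 (cell 24) (NConst 1)) Skip.
Definition paint : com := For 24 (NMul cN cN) paint_body.

Definition pop (s : nat) : com :=
  Seq (NSet (s + 2) (NConst 0) (NSub (cell (s + 2)) (NConst 1)))
  (Seq (NSet 18 (NConst 0) (NGet s (cell (s + 2))))
  (Seq (NSet 19 (NConst 0) (NGet (s + 1) (cell (s + 2))))
       (NSet 22 (NConst 0) (NConst 1)))).
Definition pushc (s : nat) : com :=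
  Seq (NSet s (cell (s + 2)) (cell 20))
  (Seq (NSet (s + 1) (cell (s + 2)) (cell 18)) (incr (s + 2))).

Definition pop_edge : com :=
  Seq (NSet 22 (NConst 0) (NConst 0))
  (If (BNLe (NConst 1) (cell 11)) (pop 9)
  (If (BNLe (NConst 1) (cell 14)) (pop 12) Skip)).

Definition same_colour (a b : nexp) : bexp := BAnd (BNLe (NGet 7 a) (NGet 7 b)) (BNLe (NGet 7 b) (NGet 7 a)).

Definition push_body (de : nat * nat) : com :=
  Seq (NSet 20 (NConst 0) (nextE (cell 18) de))
    (If (same_colour (cell 20) (cell 18)) (pushc 9) (pushc 12)).

Definition mark : com :=
  Seq (NSet 8 (cell 18) (NConst 1))
  (Seq (NSet 16 (cell 18) (cell 19))
  (Seq (NSet 15 (cell 17) (cell 18)) (incr 17))).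

Definition search_body : com :=
  Seq pop_edge
   (If (BAnd (BNLe (NConst 1) (cell 22)) (BNLe (NGet 8 (cell 18)) (NConst 0)))
     (Seq mark (seqs push_body offsets)) Skip).

(** The number of search steps is fixed in advance: ten per cell, and one for
    the root. *)
Definition searchP : com :=
  Seq (NSet 14 (NConst 0) (NConst 1))
  (For 21 (NAdd (NMul (NConst 10) (NMul cN cN)) (NConst 1)) search_body).

Definition branch_sums_body : com :=
  Seq (NSet 18 (NConst 0) (NGet 15 (NSub (NSub (cell 17) (NConst 1)) (cell 24))))
   (RSet 3 (NGet 16 (cell 18)) (RAdd (RGet 3 (NGet 16 (cell 18))) (RGet 3 (cell 18)))).
Definition branch_sumsP : com := For 24 (NSub (cell 17) (NConst 1)) branch_sums_body.

Definition select_body : com :=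
  Seq (NSet 18 (NConst 0) (NGet 15 (cell 24)))
  (If (BAnd (BNot (same_colour (NGet 16 (cell 18)) (cell 18)))
        (BRLe (RGet 4 (NConst 0)) (RMul (ROfNat (NConst 2)) (RGet 3 (cell 18)))))
    (NSet 23 (NConst 0) (cell 18)) Skip).
Definition selectP : com := For 24 (cell 17) select_body.

Definition median_program : com :=
  Seq sample (Seq scale (Seq paint (Seq searchP (Seq branch_sumsP (Seq selectP
    (RSet 0 (NConst 0) (RGet 1 (cell 23)))))))).

End Program.

Section Correctness.
Context {R : realType}.
Variables (f : S2 R -> R) (M : nat).
Local Notation N := M.+1.
Local Notation V := ('I_M.+1 * 'I_M.+1)%type.
Local Notation state := (@state R).

Definition enc (v : V) : nat := (v.1 * N + v.2)%N.
Definition dec (w : nat) : V := (inord (w %/ N), inord (w %% N)).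

Lemma encK : cancel enc dec.
Proof.
by case=> i j; rewrite /enc /dec /= divnMDl// divn_small// addn0 modnMDl modn_small// !inord_val.
Qed.

Lemma decK w : (w < N * N)%N -> enc (dec w) = w.
Proof.
move=> wN; rewrite /enc /dec /= !inordK ?ltn_mod//; first by rewrite -divn_eq.
by rewrite ltn_divLR.
Qed.

Lemma enc_lt v : (enc v < N * N)%N.
Proof. by rewrite /enc; have := ltn_ord v.1; have := ltn_ord v.2; nia. Qed.

Lemma dec_row w : (w < N * N)%N -> (dec w).1 = (w %/ N)%N :> nat.
Proof. by move=> wN; rewrite /dec /= inordK// ltn_divLR. Qed.

Lemma dec_col w : (dec w).2 = (w %% N)%N :> nat.
Proof. by rewrite /dec /= inordK// ltn_mod. Qed.

Lemma enc0 : enc (ord0, ord0) = 0%N. Proof. by []. Qed.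

(** Colatitudes are multiples of [pi / M], so that the first and the last row
    sample a pole and are of one colour; the bands of the cells have width [pi
    / N]. *)
Definition sample_point (v : V) : S2 R :=
  sph (v.1%:R * pi / M%:R) ((2 * v.2)%:R * pi / N%:R).
Definition value v := f (sample_point v).
(** By Archimedes, the area of a cell divided by [2 * pi / N]. *)
Definition area (v : V) : R := cos (v.1%:R * pi / N%:R) - cos (v.1.+1%:R * pi / N%:R).
Definition total_area := \sum_v area v.

Lemma four_atan1 : 4%:R * atan 1%:R = pi :> R.
Proof. by rewrite atan1 mulrC divfK. Qed.

Lemma sum_dec (F : V -> R) : \sum_v F v = \sum_(0 <= w < N * N) F (dec w).
Proof.
rewrite big_mkord.
rewrite (reindex_onto (fun v : V => Ordinal (enc_lt v)) (fun w => dec w)) /=; last first.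
  by move=> w _; apply: val_inj; rewrite /= decK.
by apply: eq_big => [v|v _]; rewrite encK ?eqxx.
Qed.

Definition is_size (st : state) := nats st 0 0 = N.
Definition coords (st : state) (n : nat) := forall w, (w < n)%N ->
  nats st 5 w = (w %/ N)%N /\ nats st 6 w = (w %% N)%N.
Definition sampled (st : state) (n : nat) := forall w, (w < n)%N ->
  reals st 1 w = value (dec w) /\ reals st 3 w = area (dec w).
Definition blank (st : state) :=
  [/\ nats st 7 = (fun=> 0%N), nats st 8 = (fun=> 0%N), nats st 11 0 = 0%N,
      nats st 17 0 = 0%N & nats st 23 0 = 0%N].

Lemma divmod_succ k : ((k %% N).+1 < N)%N ->
  (k.+1 %/ N = k %/ N)%N /\ (k.+1 %% N = (k %% N).+1)%N.
Proof.
move=> h; have e : (k.+1 = k %/ N * N + (k %% N).+1)%N by rewrite addnS -divn_eq.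
by split; rewrite {1}e ?divnMDl ?modnMDl ?(divn_small h) ?(modn_small h) ?addn0.
Qed.

Lemma divmod_wrap k : (N <= (k %% N).+1)%N ->
  (k.+1 %/ N = (k %/ N).+1)%N /\ (k.+1 %% N = 0)%N.
Proof.
move=> h; have h' : (k %% N).+1 = N by apply/eqP; rewrite eqn_leq h ltn_mod.
have e : (k.+1 = (k %/ N).+1 * N)%N.
  rewrite mulSn; have := divn_eq k N; move: (k %/ N * N)%N h' => a; lia.
by split; rewrite {1}e ?mulnK ?modnMl.
Qed.

(** Absorbs the overhead of a loop into a multiple of the number of passes. *)
Lemma loop_cost m T n c : (0 < m)%N -> (T + n + 11 + n + 8 <= c)%N ->
  (m * (T + n + 11) + n + 8 <= c * m)%N.
Proof. by move=> m0 h; nia. Qed.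

Lemma sample_correct : runs f sample (200 * (N * N)) (fun st => st = init_state N)
  (fun st => [/\ is_size st, coords st (N * N), sampled st (N * N), blank st &
    [/\ nats st 12 = (fun=> 0%N), nats st 13 = (fun=> 0%N),
        reals st 2 0 = 0 & reals st 4 0 = total_area]]).
Proof.
pose I k (st : state) := [/\ is_size st, coords st k, sampled st k, blank st &
  [/\ nats st 1 0 = (k %/ N)%N, nats st 2 0 = (k %% N)%N,
      nats st 12 = (fun=> 0%N) /\ nats st 13 = (fun=> 0%N),
      reals st 2 0 = 0 & reals st 4 0 = \sum_(0 <= w < k) area (dec w)]].
have body : forall k, (k < N * N)%N -> runs f sample_body (wcost sample_body)
   (fun st => I k st /\ nats st 24 0 = k)
   (fun st => I k.+1 (set_nat st 24 0 k.+1) /\ nats st 24 0 = k).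
  move=> k kN; apply: runs_wp => -[nt rl] [[sz cd sm [b1 b2 b3 b4 b5] [iE jE [z1 z2] e0 tE]] kE].
  rewrite /is_size /= in sz iE jE kE e0 tE b1 b2 b3 b4 b5 z1 z2 *.
  exists (sample_point (dec k)); split.
    rewrite /upd /= four_atan1 iE jE sz subn1 /=.
    by have := dec_col k; have := dec_row kN; rewrite /dec /= => -> ->.
  have post : forall rl' : nat -> nat -> R, rl' 1%N k = value (dec k) ->
      rl' 3%N k = area (dec k) -> rl' 4%N 0%N = rl 4%N 0%N + area (dec k) ->
      rl' 2%N 0%N = 0 ->
      (forall w, w != k -> rl' 1%N w = rl 1%N w /\ rl' 3%N w = rl 3%N w) ->
    sampled (State nt rl') k.+1 /\
    rl' 4%N 0%N = \sum_(0 <= w < k.+1) area (dec w).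
    move=> rl' h1 h3 h4 h2 hw; split; last by rewrite h4 tE big_nat_recr.
    move=> w; rewrite ltnS leq_eqVlt => /predU1P[->|wk] /=; first by rewrite h1 h3.
    have wk' : w != k by rewrite ltn_eqF.
    by have [-> ->] := hw w wk'; exact: sm.
  have aE : area (dec k) = cos ((k %/ N)%:R * pi / N%:R) - cos ((k %/ N).+1%:R * pi / N%:R).
    by rewrite /area dec_row.
  have [|||||sp tp] := post (upd (upd (upd rl 1%N k (value (dec k))) 3%N k (area (dec k)))
    4%N 0%N (rl 4%N 0%N + area (dec k))); rewrite /upd //= ?eqxx //.
    by move=> w /negbTE ->.
  rewrite /upd /= ?iE ?jE ?kE ?sz /= ?four_atan1 ?addn1 ?eqxx -?aE.
  have cd' w : (w < k.+1)%N -> (if w == k then (k %/ N)%N else nt 5%N w) = (w %/ N)%N /\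
      (if w == k then (k %% N)%N else nt 6%N w) = (w %% N)%N.
    rewrite ltnS leq_eqVlt /= => /predU1P[->|wk]; first by rewrite eqxx.
    by rewrite ltn_eqF//; exact: cd.
  by case: ltnP => h; [have [dE mE] := divmod_wrap h | have [dE mE] := divmod_succ h];
    do !split => //; rewrite /= /upd /= ?dE ?mE //; case: (cd' w).
apply: (runs_weaken (runs_for (I := I) (m := (N * N)%N) (P := fun st => st = init_state N)
  _ _ body)) => //.
- move=> st ->; rewrite /I /=; do !split => //; rewrite /= /upd /= ?div0n ?mod0n//.
  by rewrite big_geq.
- by move=> k st [sz] _ _ _ _; rewrite /= (sz : nats st 0 0 = N).
- by apply: loop_cost.
- move=> st [sz cd sm b [_ _ [z1 z2] e0 tE]]; do !split => //; try by case: b.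
  all: try by case: (cd w).
  all: try by case: (sm w).
  by rewrite tE /total_area sum_dec.
Qed.

End Correctness.

(** * Scale and colours *)

Section Scale.
Context {R : realType}.
Variables (f : S2 R -> R) (M : nat).
Local Notation N := M.+1.
Local Notation V := ('I_M.+1 * 'I_M.+1)%type.
Local Notation state := (@state R).
Local Notation value := (@value R f M).
Local Notation root := (ord0, ord0 : 'I_M.+1).

Definition neighbour (v : V) (de : nat * nat) : V :=
  (inord (next_row M v.1 de.1), inord (next_col M v.2 de.2)).

Lemma grid_nbsE (v : V) : grid_nbs v = map (neighbour v) offsets.
Proof. by []. Qed.

Lemma offset_lt de : de \in offsets -> (de.1 < 3)%N /\ (de.2 < 3)%N.
Proof. by move=> /allpairsP[[d e] []]; rewrite !mem_iota => d3 e3 ->. Qed.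

Lemma coords_enc (st : state) (v : V) : coords M st (N * N) ->
  nats st 5 (enc v) = v.1 /\ nats st 6 (enc v) = v.2.
Proof.
move=> /(_ _ (enc_lt v))[-> ->].
have := @dec_row M _ (enc_lt v); have := dec_col M (enc v).
by rewrite encK => -> ->.
Qed.

Lemma sampled_enc (st : state) (v : V) : sampled f M st (N * N) ->
  reals st 1 (enc v) = value v /\ reals st 3 (enc v) = area v.
Proof. by move=> /(_ _ (enc_lt v))[-> ->]; rewrite encK. Qed.

Lemma nextE_eval (st : state) w (v : V) de : is_size M st -> coords M st (N * N) ->
  neval st w = enc v -> de \in offsets ->
  neval st (nextE w de) = enc (neighbour v de).
Proof.
move=> sz cd wv de3; have [d3 e3] := offset_lt de3.
have [r c] := coords_enc v cd.
rewrite /= (sz : nats st 0 0 = N) wv r c /enc /neighbour /=.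
have [a _] := next_rowE (ltn_ord v.1 : v.1 <= M)%N d3.
have [b _] := next_colE (ltn_ord v.2 : v.2 <= M)%N e3.
by rewrite !inordK// /next_row /next_col !subn1 /= addn1.
Qed.

Definition is_scale (e : R) := [/\ 0 <= e,
  forall v x, x \in @grid_nbs M v -> value v - value x <= e &
  e = 0 \/ exists v x, x \in @grid_nbs M v /\ e = value v - value x].

Definition ready (st : state) := [/\ is_size M st, coords M st (N * N),
  sampled f M st (N * N), blank st & [/\ nats st 12 = (fun=> 0%N),
  nats st 13 = (fun=> 0%N) & reals st 4 0 = total_area M]].

Lemma scale_correct : runs f scale (1000 * (N * N))
  (fun st => ready st /\ reals st 2 0 = 0)
  (fun st => ready st /\ is_scale (reals st 2 0)).
Proof.
pose part (k : nat) (e : R) := [/\ 0 <= e,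
  forall w x, (w < k)%N -> x \in grid_nbs (dec M w) -> value (dec M w) - value x <= e &
  e = 0 \/ exists v x, x \in @grid_nbs M v /\ e = value v - value x].
pose I (k : nat) (st : state) := ready st /\ part k (reals st 2 0).
pose J (k : nat) (l : seq (nat * nat)) (st : state) := [/\ ready st, nats st 24 0 = k, part k (reals st 2 0) &
  forall de, de \in l -> value (dec M k) - value (neighbour (dec M k) de) <= reals st 2 0].
have inner k : (k < N * N)%N -> runs f (seqs scale_body offsets) (9 * 85 + 1)
    (J k [::]) (J k offsets).
  move=> kN; apply: (@runs_seqs R f _ scale_body offsets 85 (J k)) => l de del.
  apply: (runs_wp (c := scale_body de)) => st [rd kE [p0 pw pa] pl].
  have [sz cd sm b z] := rd.
  have ev := @nextE_eval st (cell 24) (dec M k) de sz cd _ del.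
  rewrite /scale_body; cbn [wp]; rewrite {}ev; last by rewrite /= kE decK.
  rewrite /=.
  have [v1 _] := sampled_enc (dec M k) sm.
  have [x1 _] := sampled_enc (neighbour (dec M k) de) sm.
  rewrite decK// in v1; rewrite /upd /= kE v1 x1.
  have xin : neighbour (dec M k) de \in grid_nbs (dec M k).
    by rewrite grid_nbsE; exact: map_f.
  case: leP => [le|lt].
    split => //.
      split; [exact: le_trans le| |by right; exists (dec M k), (neighbour (dec M k) de)].
      by move=> w x wk xw; apply: le_trans le; exact: pw.
    move=> de'; rewrite mem_rcons in_cons => /predU1P[->//|del'].
    by apply: le_trans le; exact: pl.
  split => //.
  move=> de'; rewrite mem_rcons in_cons => /predU1P[->//|del']; first exact: ltW.
  exact: pl.
apply: (runs_weaken (runs_for (I := I) (m := (N * N)%N) (T := 9 * 85 + 1)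
   (P := fun st => ready st /\ reals st 2 0 = 0) _ _ _)) => //.
- move=> st [[sz cd sm b z] e0]; split; first by split; [exact: sz|exact: cd|exact: sm|exact: b|exact: z].
  by rewrite /= e0; split => //; left.
- by move=> k st [[sz _ _ _ _] _]; rewrite /= (sz : nats st 0 0 = N).
- move=> k kN; apply: (runs_weaken (inner k kN)) => //.
    by move=> st [[rd pt] kE].
  move=> st [[sz cd sm b z] kE [p0 pw pa] pl]; split => //; split; first by split; [exact: sz|exact: cd|exact: sm|exact: b|exact: z].
  split => // w x; rewrite ltnS leq_eqVlt => /predU1P[->|wk]; last exact: pw.
  by rewrite grid_nbsE => /mapP[de del ->]; exact: pl.
- by apply: loop_cost.
- move=> st [rd [p0 pw pa]]; split=> //; split => // v x xv.
  by have := pw (enc v) x (enc_lt v); rewrite encK; apply.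
Qed.

(** For [e = 0] the quotient is 0, and all cells get the same colour. *)
Definition colour (e : R) (v : V) : bool := 0 <= sin ((value v - value root) / e).

Definition painted (e : R) (st : state) := [/\ is_size M st, coords M st (N * N),
  sampled f M st (N * N), (forall v : V, nats st 7 (enc v) = colour e v) &
  [/\ nats st 8 = (fun=> 0%N), nats st 11 0 = 0%N,
      nats st 17 0 = 0%N /\ nats st 23 0 = 0%N,
      nats st 12 = (fun=> 0%N) /\ nats st 13 = (fun=> 0%N) & reals st 4 0 = total_area M]].

Lemma paint_correct : runs f paint (50 * (N * N))
  (fun st => ready st /\ is_scale (reals st 2 0))
  (fun st => exists2 e, is_scale e & painted e st).
Proof.
pose I (k : nat) (st : state) := [/\ [/\ is_size M st, coords M st (N * N),
  sampled f M st (N * N), is_scale (reals st 2 0) &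
  forall w, nats st 7 w = (w < k)%N && colour (reals st 2 0) (dec M w)] &
  [/\ nats st 8 = (fun=> 0%N), nats st 11 0 = 0%N,
      nats st 17 0 = 0%N /\ nats st 23 0 = 0%N,
      nats st 12 = (fun=> 0%N) /\ nats st 13 = (fun=> 0%N) & reals st 4 0 = total_area M]].
apply: (runs_weaken (runs_for (I := I) (m := (N * N)%N) (T := wcost paint_body)
   (P := fun st => ready st /\ is_scale (reals st 2 0)) _ _ _)) => //.
- move=> st [[sz cd sm [b7 b8 b11 b17 b23] [z12 z13 tE]] sc].
  by do 2!split => //; move=> w; rewrite /= /upd /= b7.
- by move=> k st [[sz _ _ _ _] _]; rewrite /= (sz : nats st 0 0 = N).
- move=> k kN; apply: runs_wp => st [[[sz cd sm sc c7] rest] kE].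
  rewrite /= /upd /= kE.
  have [v1 _] := sampled_enc (dec M k) sm; rewrite decK// in v1.
  have [v0 _] := sampled_enc root sm; rewrite enc0 in v0.
  rewrite v1 v0 -/(colour (reals st 2 0) (dec M k)).
  case: ifP => ck; do 2!split => //.
    split => // w /=; rewrite /upd /=; case: eqP => [->|/eqP wk]; first by rewrite ltnSn ck.
    by rewrite c7 [(w < k.+1)%N]ltnS [(w <= k)%N]leq_eqVlt (negbTE wk).
  split => // w; rewrite /= /upd /= c7 [(w < k.+1)%N]ltnS [(w <= k)%N]leq_eqVlt; case: eqP => [->|//].
  by rewrite ck andbF.
- by apply: loop_cost.
- move=> st [[sz cd sm sc c7] [b8 b11 b17 z tE]].
  exists (reals st 2 0) => //; split => // v.
  by rewrite c7 enc_lt encK.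
Qed.

End Scale.

(** * The search as a program *)

Section SearchProgram.
Context {R : realType}.
Variables (f : S2 R -> R) (M : nat).
Local Notation N := M.+1.
Local Notation V := ('I_M.+1 * 'I_M.+1)%type.
Local Notation state := (@state R).
Local Notation root := ((ord0, ord0) : V).
Variable col : V -> bool.
Local Notation nbs := (@grid_nbs M).
Local Notation srch := (search V).

(** The bottom of the stack has index 0. *)
Fixpoint stacked (a b : nat -> nat) (s : seq (V * V)) : Prop :=
  if s is e :: s' then
    [/\ a (size s') = enc e.1, b (size s') = enc e.2 & stacked a b s']
  else True.

Lemma stacked_ext a b a' b' s : (forall i, (i < size s)%N -> a i = a' i /\ b i = b' i) ->
  stacked a b s -> stacked a' b' s.
Proof.
elim: s => //= e s ih h [<- <- st]; have [-> ->] := h _ (ltnSn _).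
by split => //; apply: ih st => i is_; apply: h; exact: ltnW.
Qed.

Fixpoint listed (a : nat -> nat) (s : seq (V * V)) : Prop :=
  if s is e :: s' then a (size s') = enc e.1 /\ listed a s' else True.

Lemma listed_ext a a' s : (forall i, (i < size s)%N -> a i = a' i) ->
  listed a s -> listed a' s.
Proof.
elim: s => //= e s ih h [<- st]; rewrite h//.
by split => //; apply: ih st => i is_; apply: h; exact: ltnW.
Qed.

Lemma enc_inj (u v : V) : (enc u == enc v) = (u == v).
Proof. exact: (inj_eq (can_inj (@encK M))). Qed.

(** What the search leaves unchanged; [tick] is the counter of the loop around
    it. *)
Definition setting (tick : nat) (st : state) := [/\ is_size M st, coords M st (N * N),
  sampled f M st (N * N), (forall v : V, nats st 7 (enc v) = col v) &
  [/\ nats st 23 0 = 0%N, reals st 4 0 = total_area M & nats st 21 0 = tick]].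

Definition tree_stored (st : state) (o : seq (V * V)) := [/\ nats st 17 0 = size o,
  listed (nats st 15) o, forall v : V, nats st 8 (enc v) = (v \in unzip1 o) &
  forall v : V, v \in unzip1 o -> nats st 16 (enc v) = enc (parent root o v)].

Definition stored (st : state) (s : srch) :=
  [/\ nats st 11 0 = size (sfront s), stacked (nats st 9) (nats st 10) (sfront s),
      nats st 14 0 = size (sback s), stacked (nats st 12) (nats st 13) (sback s) &
      tree_stored st (sord s)].

Lemma pushes_correct k (w : V) (s : srch) : runs f (seqs push_body offsets) (9 * 112 + 1)
  (fun st => [/\ setting k st, nats st 18 0 = enc w & stored st s])
  (fun st => setting k st /\ stored st (foldl (push col w) s (nbs w))).
Proof.
pose J l (st : state) := [/\ setting k st, nats st 18 0 = enc w &
  stored st (foldl (push col w) s (map (neighbour w) l))].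
apply: (runs_weaken (T := 9 * 112 + 1) (P := J [::]) (Q := J offsets)) => //; last first.
  by move=> st [].
apply: (@runs_seqs R f _ push_body offsets 112 J) => l de del.
apply: (runs_wp (c := push_body de)) => st [[sz cd sm c7 b] wE].
rewrite /J map_rcons foldl_rcons; set s0 := foldl _ _ _ => -[n11 st9 n14 st12 [n17 l15 v8 p16]].
have ev := @nextE_eval R M st (cell 18) w de sz cd wE del.
rewrite /push_body; cbn [wp]; rewrite {}ev.
set x := neighbour w de; rewrite /= /upd /= !wE !c7.
have -> : (col x <= col w)%N && (col w <= col x)%N = (col x == col w).
  by case: (col x); case: (col w).
have [cx|/negbTE cx] := boolP (col x == col w); rewrite /push cx /= /upd /=.
  split => //; split => //=; rewrite /upd /= ?n11 ?addn1 ?eqxx//.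
  split => //; apply: stacked_ext st9 => i is_; by rewrite ltn_eqF.
split => //; split => //=; rewrite /upd /= ?n14 ?addn1 ?eqxx//.
split => //; apply: stacked_ext st12 => i is_; by rewrite ltn_eqF.
Qed.

Lemma search_body_correct k (s : srch) : runs f search_body 1200
  (fun st => setting k st /\ stored st s)
  (fun st => setting k st /\ stored st (search_step col nbs s)).
Proof.
pose mid (st : state) := setting k st /\
  ((exists e s', [/\ nats st 22 0 = 1%N, nats st 18 0 = enc e.1, nats st 19 0 = enc e.2,
     stored st s' & search_step col nbs s = visit col nbs e s'])
   \/ [/\ nats st 22 0 = 0%N, stored st s & search_step col nbs s = s]).
have popE : runs f pop_edge (wcost pop_edge) (fun st => setting k st /\ stored st s) mid.
  apply: runs_wp => st [[sz cd sm c7 b] [n11 st9 n14 st12 tr]].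
  rewrite /pop_edge /= /upd /= n11 n14.
  case E : (sfront s) st9 n11 => [|e l] /= st9 n11.
    case E' : (sback s) st12 n14 => [|e l] /= st12 n14.
      split => //; right; split => //; rewrite ?/search_step ?E ?E'//.
      by split; rewrite ?E ?E'.
    split => //; left; exists e, (Search [::] l (sord s)); rewrite /= /upd /= ?n14 ?subn1 /=.
    have [a b' st12'] := st12; split => //; last by rewrite /search_step E E'.
  split => //; left; exists e, (Search l (sback s) (sord s)); rewrite /= /upd /= ?n11 ?subn1 /=.
  by have [a b' st9'] := st9; split => //; rewrite /search_step E.
have visitE : runs f (If (BAnd (BNLe (NConst 1) (cell 22)) (BNLe (NGet 8 (cell 18)) (NConst 0)))
     (Seq mark (seqs push_body offsets)) Skip) (10 + (wcost mark + (9 * 112 + 1) + 1))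
   mid (fun st => setting k st /\ stored st (search_step col nbs s)).
  apply: runs_if; last first.
    apply: (runs_weaken (@runs_skip R f (fun st => setting k st /\ stored st (search_step col nbs s)))) => //.
    move=> st [[set0 [|[n22 sto ->//]]]].
    move=> [e [s' [n22 n18 n19 sto ->]]] /=; have [_ _ _ _ [_ _ v8 _]] := sto.
    rewrite n22 n18 v8 /= => vis; split => //.
    rewrite /visit; case: ifP => // vis'; move: vis; by rewrite vis'.
  move=> st [[set0 [|[n22 sto _]]]]; last by rewrite /= n22.
  move=> [e [s' [n22 n18 n19 sto ->]]] /=; have [n11 st9 n14 st12 [n17 l15 v8 p16]] := sto.
  rewrite n22 n18 v8 /= /visit; case: ifP => // vis _.
  pose s1 := Search (sfront s') (sback s') (e :: sord s').
  suff : runs f (Seq mark (seqs push_body offsets)) (wcost mark + (9 * 112 + 1)) (fun st' => st' = st)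
    (fun st => setting k st /\ stored st (foldl (push col e.1) s1 (nbs e.1))) by apply.
  apply: (runs_seq _ (@pushes_correct k e.1 s1)).
  apply: runs_wp => _ ->; have [sz cd sm c7 b] := set0.
  rewrite /= /upd /= n18 n19 n17 addn1; split => //; split => //=; split; rewrite /upd //=.
  - rewrite /upd /= eqxx; split => //; apply: listed_ext l15 => i is_; by rewrite ltn_eqF.
  - move=> v; rewrite /upd /= enc_inj in_cons; case: eqP => //= _; exact: v8.
  - move=> v; case: e n18 n19 vis {s1} => w p /= _ _ vis; rewrite /upd /= enc_inj in_cons.
    by case: eqP => //= _; exact: p16.
by apply: (runs_weaken (runs_seq popE visitE)).
Qed.

Lemma searchP_correct : exists o, [/\ search_tree col nbs root o,
   forall v, v \in unzip1 o &
   runs f searchP (200 * 100 * (N * N))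
     (fun st => setting (nats st 21 0) st /\ [/\ nats st 8 = (fun=> 0%N), nats st 11 0 = 0%N,
        nats st 17 0 = 0%N, nats st 12 = (fun=> 0%N) & nats st 13 = (fun=> 0%N)])
     (fun st => setting (nats st 21 0) st /\ tree_stored st o)].
Proof.
pose n := (10 * (N * N) + 1)%N.
pose s0 := search_init root.
have deg v : (size (nbs v) <= 9)%N by rewrite grid_deg.
have nb : (10 * #|{: V}| + 1 <= n)%N by rewrite card_prod card_ord.
have [t a] := @search_complete _ col nbs root 9 deg (@gadj_conn M) n nb.
exists (sord (iter n (search_step col nbs) s0)); split => //.
pose I k (st : state) := setting (nats st 21 0) st /\ stored st (iter k (search_step col nbs) s0).
have loop : runs f (For 21 (NAdd (NMul (NConst 10) (NMul cN cN)) (NConst 1)) search_body)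
   (n * (1200 + 9 + 11) + 9 + 8) (I 0%N) (I n).
  apply: (@runs_for R f 21 _ _ 1200 I).
  - by move=> st [[sz cd sm c7 [b t' _]] h]; split.
  - by move=> k st [[sz _ _ _ _] _]; rewrite /= (sz : nats st 0 0 = N).
  - move=> k kn; apply: (runs_weaken (@search_body_correct k (iter k (search_step col nbs) s0))) => //.
      by move=> st [[[sz cd sm c7 [b t' _]] h] kE]; split.
    by move=> st [[sz cd sm c7 [b t' kE]] h]; split.
have start st : setting (nats st 21 0) st /\ [/\ nats st 8 = (fun=> 0%N), nats st 11 0 = 0%N,
        nats st 17 0 = 0%N, nats st 12 = (fun=> 0%N) & nats st 13 = (fun=> 0%N)] ->
    I 0%N (set_nat st 14 0 1).
  move=> [[sz cd sm c7 [b t' _]] [b8 b11 b17 b12 b13]]; split => //.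
  split => //=; rewrite /upd /=; first by rewrite b12 b13 enc0.
  by split => //= v; rewrite /upd /= b8.
have first : runs f (NSet 14 (NConst 0) (NConst 1)) 3 _ (I 0%N) := @runs_nset R f 14 (NConst 0) (NConst 1) _ _ start.
have run := runs_seq first loop.
apply: (runs_weaken run) => //.
- have : (0 < N * N)%N by []. 
  rewrite /n; move: (N * N)%N => q; lia.
- by move=> st [set0 [_ _ _ _ tr]].
Qed.

End SearchProgram.

(** * Selection and the whole program *)

Section SelectProgram.
Context {R : realType}.
Variables (f : S2 R -> R) (M : nat).
Local Notation N := M.+1.
Local Notation V := ('I_M.+1 * 'I_M.+1)%type.
Local Notation state := (@state R).
Local Notation root := ((ord0, ord0) : V).
Variable col : V -> bool.
Local Notation nbs := (@grid_nbs M).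
Variable o : seq (V * V).
Hypothesis tree_o : search_tree col nbs root o.

Lemma parent_mem (l : seq (V * V)) w p : uniq (unzip1 l) -> (w, p) \in l ->
  parent root l w = p.
Proof.
elim: l => //= -[w' p'] l ih /= /andP[w'l ul]; rewrite in_cons => /predU1P[[-> ->]|wl].
  by rewrite eqxx.
case: eqP => [e|_]; last exact: ih.
by move: w'l; rewrite -e => /negP; case; apply/mapP; exists (w, p).
Qed.

Lemma listed_drop a (l : seq (V * V)) k e l' : listed a l -> drop k l = e :: l' ->
  a (size l') = enc e.1 /\ (size l = k + (size l').+1)%N.
Proof.
elim: l k => [|x l ih] [|k] //= [h1 h2]; first by move=> [<- <-]; rewrite add0n.
by move=> /(ih _ h2)[-> ->]; rewrite addSn.
Qed.

Lemma size_tree : (0 < size o <= N * N)%N.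
Proof.
have [le _] := search_tree_size tree_o.
rewrite card_prod card_ord in le; rewrite le andbT.
by case: (o) tree_o.
Qed.

Definition searched (st : state) := [/\ forall v : V, reals st 1 (enc v) = value f v,
  forall v : V, nats st 7 (enc v) = col v, reals st 4 0 = total_area M &
  tree_stored st o].

Let weight : V -> R := branch_sums o (@area R M).

Lemma branch_sumsP_correct : runs f branch_sumsP (100 * (N * N))
  (fun st => [/\ searched st, nats st 23 0 = 0%N & forall v : V, reals st 3 (enc v) = area v])
  (fun st => [/\ searched st, nats st 23 0 = 0%N & forall v : V, reals st 3 (enc v) = weight v]).
Proof.
have /andP[sz0 szN] := size_tree; have [_ uo] := search_tree_size tree_o.
pose I k (st : state) := [/\ searched st, nats st 23 0 = 0%N & exists S : V -> R,
  (forall v, reals st 3 (enc v) = S v) /\ branch_sums (drop k o) S = weight].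
have loop : runs f branch_sumsP ((size o - 1) * (wcost branch_sums_body + 4 + 11) + 4 + 8)
    (fun st => [/\ searched st, nats st 23 0 = 0%N & forall v : V, reals st 3 (enc v) = area v])
    (I (size o - 1)%N).
  apply: (@runs_for R f 24 _ _ (wcost branch_sums_body) I).
  - move=> st [[v c t tr] b s]; split => //.
    by exists (@area R M); rewrite drop0.
  - by move=> k st [[_ _ _ [n17 _ _ _]] _ _]; rewrite /= n17.
  move=> k kn; apply: runs_wp => st [[[v c t [n17 l15 v8 p16]] b [S [s3 sE]]] kE].
  case E : (drop k o) sE => [|[w p] o'] sE.
    by have := size_drop k o; rewrite E /=; lia.
  have [a so] := listed_drop l15 E; rewrite /= in a.
  have wpo : (w, p) \in o.
    by rewrite -(cat_take_drop k o) mem_cat E in_cons eqxx orbT.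
  have wino : w \in unzip1 o by apply/mapP; exists (w, p).
  have pE : nats st 16 (enc w) = enc p by rewrite p16// (parent_mem uo wpo).
  have on0 : o' != [::] by apply: contraTneq kn => e; rewrite so e /=; lia.
  have iE : (size o - 1 - k = size o')%N by rewrite so; lia.
  rewrite /= /upd /= n17 kE iE a pE !s3; split; last by [].
  split => //; exists (fun v => if v == p then S p + S w else S v); split => [u|].
    by rewrite /= /upd /= enc_inj; case: eqP.
  have -> : drop k.+1 o = o' by rewrite -(add1n k) -drop_drop E /= drop0.
  by rewrite -branch_sums_cons.
apply: (runs_weaken loop) => //.
  rewrite [wcost _]/=; move: szN sz0; move: (size o) (N * N)%N => a q; lia.
move=> st [h b [S [s3 sE]]]; split => // v; rewrite s3 -sE.
case E : (drop _ o) => [|[w p] [|e l]] //.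
by have := size_drop (size o - 1) o; rewrite E /=; lia.
Qed.

Lemma selectP_correct : runs f selectP (100 * (N * N))
  (fun st => [/\ searched st, nats st 23 0 = 0%N & forall v : V, reals st 3 (enc v) = weight v])
  (fun st => searched st /\ nats st 23 0 = enc (select col root o weight (total_area M))).
Proof.
have /andP[sz0 szN] := size_tree; have [_ uo] := search_tree_size tree_o.
pose I k (st : state) := [/\ searched st, forall v : V, reals st 3 (enc v) = weight v &
  nats st 23 0 = enc (select col root (drop (size o - k) o) weight (total_area M))].
have loop : runs f selectP (size o * (wcost select_body + 2 + 11) + 2 + 8)
    (fun st => [/\ searched st, nats st 23 0 = 0%N & forall v : V, reals st 3 (enc v) = weight v])
    (I (size o)).
  apply: (@runs_for R f 24 _ _ (wcost select_body) I).
  - move=> st [[v c t tr] b s]; split => //.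
    by rewrite subn0 drop_size /= /upd /= b.
  - by move=> k st [[_ _ _ [n17 _ _ _]] _ _]; rewrite /= n17.
  move=> k kn; apply: runs_wp => st [[[v c t [n17 l15 v8 p16]] s3 b] kE].
  have E : drop (size o - k.+1) o =
      nth (root, root) o (size o - k.+1) :: drop (size o - k) o.
    rewrite (drop_nth (root, root)); last by lia.
    by congr (_ :: drop _ o); lia.
  rewrite /I E; case: (nth _ _ _) E => w p E.
  have [a so] := listed_drop l15 E; rewrite /= size_drop in a.
  have kE' : (size o - (size o - k) = k)%N by lia.
  rewrite kE' in a.
  have wpo : (w, p) \in o.
    by rewrite -(cat_take_drop (size o - k.+1) o) mem_cat E in_cons eqxx orbT.
  have wino : w \in unzip1 o by apply/mapP; exists (w, p).
  have pE : nats st 16 (enc w) = enc p by rewrite p16// (parent_mem uo wpo).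
  rewrite /= /upd /= kE a pE !c t s3.
  have -> : ~~ ((col p <= col w)%N && (col w <= col p)%N) = (col p != col w).
    by case: (col p); case: (col w).
  by case: ifP => g; split => //; split; rewrite // g.
apply: (runs_weaken loop) => //.
  rewrite [wcost _]/=; move: szN sz0; move: (size o) (N * N)%N => a q; lia.
by move=> st [h _ ->]; rewrite subnn drop0.
Qed.

End SelectProgram.

Section MedianProgram.
Context {R : realType}.
Variables (f : S2 R -> R) (M : nat).
Local Notation N := M.+1.
Local Notation V := ('I_M.+1 * 'I_M.+1)%type.
Local Notation root := ((ord0, ord0) : V).
Local Notation nbs := (@grid_nbs M).

Theorem median_program_correct : exists t e (o : seq (V * V)), let col := colour f e : V -> bool in
  let h := select col root o (branch_sums o (@area R M)) (\sum_(v : V) area v) in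
  [/\ computes median_program f N t (value f h), (t <= 250 * 100 * (N * N))%N,
      is_scale f M e, search_tree col nbs root o & forall v, v \in unzip1 o].
Proof.
have [t1 [st1 [x1 c1 [sz1 cd1 sm1 b1 [z12 z13 e1 T1]]]]] :=
  @sample_correct R f M (init_state N) erefl.
have rd1 : ready f M st1 /\ reals st1 2 0 = 0 by [].
have [t2 [st2 [x2 c2 q2]]] := scale_correct rd1.
have [t3 [st3 [x3 c3 [e sc [sz3 cd3 sm3 c73 [z8 z11 [z17 z23] [y12 y13] T3]]]]]] :=
  paint_correct q2.
have [od [tr all srch]] := searchP_correct f (colour f e : V -> bool).
have pre4 : setting f (colour f e : V -> bool) (nats st3 21 0) st3 /\ [/\ nats st3 8 = (fun=> 0%N),
    nats st3 11 0 = 0%N, nats st3 17 0 = 0%N, nats st3 12 = (fun=> 0%N) &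
    nats st3 13 = (fun=> 0%N)].
  by split; split.
have [t4 [st4 [x4 c4 [[sz4 cd4 sm4 c74 [z4 T4 _]] ts4]]]] := srch _ pre4.
have pre5 : [/\ searched f (colour f e : V -> bool) od st4, nats st4 23 0 = 0%N &
    forall v : V, reals st4 3 (enc v) = area v].
  by split => // [|v]; [split => // v; have [] := sampled_enc v sm4|have [] := sampled_enc v sm4].
have [t5 [st5 [x5 c5 q5]]] := branch_sumsP_correct tr pre5.
have [t6 [st6 [x6 c6 [[v6 _ _ _] h6]]]] := selectP_correct tr q5.
set h := select _ _ _ _ _ in h6.
have out : computes median_program f N (t1 + (t2 + (t3 + (t4 + (t5 + (t6 + 5))))))%N (value f h).
  exists (set_real st6 0 0 (value f h)); last by [].
  do 6!(apply: ExecSeq; first by eassumption).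
  have -> : value f h = reval st6 (RGet 1 (cell 23)) by rewrite /= h6 v6.
  exact: ExecRSet.
exists (t1 + (t2 + (t3 + (t4 + (t5 + (t6 + 5))))))%N, e, od; split.
- exact: out.
- have : (0 < N * N)%N by [].
  move: c1 c2 c3 c4 c5 c6; move: (N * N)%N => q; clear; lia.
- exact: sc.
- exact: tr.
- exact: all.
Qed.

End MedianProgram.

Local Open Scope classical_set_scope.
Local Open Scope ring_scope.

(** * Coordinates and distances on the sphere *)

Section SphereBasics.
Context {R : realType}.
Implicit Types (x y : S2 R).

Definition coord (k : 'I_3) (x : S2 R) : R := \val x 0 k.

Lemma sum3 (F : 'I_3 -> R) : \sum_k F k = F 0 + F 1 + F 2.
Proof.
rewrite !big_ord_recl big_ord0 addr0 addrA.
by congr (F _ + F _ + F _); exact: val_inj.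
Qed.

Lemma ord3P (k : 'I_3) : [\/ k = 0, k = 1 | k = 2].
Proof.
by case: k => [[|[|[|//]]]] ?; [constructor 1|constructor 2|constructor 3]; exact: val_inj.
Qed.

Lemma coord_S2_continuous k : continuous (coord k).
Proof.
move=> x; apply: (@continuous_comp _ _ _ (set_val : S2 R -> 'rV[R]_3) (fun v => v 0 k)).
  exact: initial_continuous.
exact: coord_continuous.
Qed.

Lemma coord_inj x y : (forall k, coord k x = coord k y) -> x = y.
Proof. by move=> h; apply: val_inj; apply/rowP => k; exact: h. Qed.

Lemma continuous_to_S2 (T : topologicalType) (f : T -> S2 R) :
  (forall k, continuous (coord k \o f)) -> continuous f.
Proof.
move=> fc; apply: continuous_comp_initial => t; apply/cvg_ballP => e e0.
have h k : \forall s \near t, ball (coord k (f t)) e (coord k (f s)).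
  by have /cvg_ballP := fc k t; apply.
near=> s; split => // i j; rewrite (ord1 i).
have [->|->|->] := ord3P j; near: s; exact: h.
Unshelve. all: by end_near. Qed.

Lemma sum_sqr_coord x : \sum_k coord k x ^+ 2 = 1.
Proof. exact: (set_mem (valP x)). Qed.

Lemma coord_sph (p t : R) :
  [/\ coord 0 (sph p t) = sin p * cos t, coord 1 (sph p t) = sin p * sin t &
      coord 2 (sph p t) = cos p].
Proof. by split; rewrite /coord /= /vec3 mxE. Qed.

Lemma eq_sph (p t p' t' : R) : sin p * cos t = sin p' * cos t' ->
  sin p * sin t = sin p' * sin t' -> cos p = cos p' -> sph p t = sph p' t'.
Proof.
move=> h0 h1 h2; apply: coord_inj => k.
have [a b c] := coord_sph p t; have [a' b' c'] := coord_sph p' t'.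
by have [->|->|->] := ord3P k; rewrite ?(a, b, c) ?(a', b', c').
Qed.

Lemma sph_continuous2 : continuous (fun z : R * R => sph z.1 z.2).
Proof.
have c1 : continuous (fun z : R * R => sin z.1).
  by move=> z; apply: (@continuous_comp _ _ _ fst sin); [exact: cvg_fst|exact: continuous_sin].
have c2 : continuous (fun z : R * R => cos z.1).
  by move=> z; apply: (@continuous_comp _ _ _ fst cos); [exact: cvg_fst|exact: continuous_cos].
have c3 : continuous (fun z : R * R => sin z.2).
  by move=> z; apply: (@continuous_comp _ _ _ snd sin); [exact: cvg_snd|exact: continuous_sin].
have c4 : continuous (fun z : R * R => cos z.2).
  by move=> z; apply: (@continuous_comp _ _ _ snd cos); [exact: cvg_snd|exact: continuous_cos].
apply: continuous_to_S2 => k z.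
have [->|->|->] := ord3P k.
- rewrite (_ : coord 0 \o _ = fun z => sin z.1 * cos z.2); first exact: cvgM (c1 z) (c4 z).
  by apply/funext => w /=; have [] := coord_sph w.1 w.2.
- rewrite (_ : coord 1 \o _ = fun z => sin z.1 * sin z.2); first exact: cvgM (c1 z) (c3 z).
  by apply/funext => w /=; have [] := coord_sph w.1 w.2.
- rewrite (_ : coord 2 \o _ = fun z => cos z.1); first exact: c2.
  by apply/funext => w /=; have [] := coord_sph w.1 w.2.
Qed.

Lemma sin_leid (x : R) : 0 <= x -> sin x <= x.
Proof.
rewrite le_eqVlt => /predU1P[<-|x0]; first by rewrite sin0.
have d (z : R) : z \in `]0, x[%R -> is_derive z 1 (@sin R) (cos z) by move=> _; exact: is_derive_sin.
have sc : {within `[0, x], continuous (@sin R)}.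
  by apply: continuous_subspaceT => z; exact: continuous_sin.
have [c _] := MVT x0 d sc.
by rewrite sin0 !subr0 => ->; rewrite ler_piMl ?(ltW x0)// cos_le1.
Qed.

Lemma norm_sin_le (x : R) : `|sin x| <= `|x|.
Proof.
wlog x0 : x / 0 <= x.
  move=> h; have [/h//|/ltW x0] := leP 0 x.
  by rewrite -(normrN x) -(normrN (sin x)) -sinN h// oppr_ge0.
rewrite (ger0_norm x0) ler_norml sin_leid// andbT.
have [x1|x1] := leP 1 x.
  by rewrite (le_trans _ (sin_geN1 x))// lerNl opprK.
rewrite (@le_trans _ _ 0) ?oppr_le0//; apply: sin_ge0_pi.
by rewrite x0 (le_trans (ltW x1))// (le_trans _ (pi_ge2 R))// ler1n.
Qed.

Lemma S2dist_sqr x y : S2dist x y ^+ 2 = \sum_k (coord k x - coord k y) ^+ 2.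
Proof. by rewrite /S2dist /edist sqr_sqrtr// sumr_ge0// => i _; exact: sqr_ge0. Qed.

Lemma S2dist_ge0 x y : 0 <= S2dist x y.
Proof. exact: sqrtr_ge0. Qed.

(** The chord of an arc [a] is [2 * sin (a / 2)]. *)
Lemma S2dist_meridian (p p' t : R) : S2dist (sph p t) (sph p' t) <= `|p - p'|.
Proof.
rewrite -(ler_pXn2r (n := 2)) ?nnegrE ?S2dist_ge0// S2dist_sqr sum3.
have [-> -> ->] := coord_sph p t; have [-> -> ->] := coord_sph p' t.
have -> : (sin p * cos t - sin p' * cos t) ^+ 2 + (sin p * sin t - sin p' * sin t) ^+ 2
   + (cos p - cos p') ^+ 2 = (2 * sin ((p - p') / 2)) ^+ 2.
  set a := (p - p') / 2; pose b := (p + p') / 2.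
  have -> : p = b + a by rewrite /a /b; field.
  have -> : p' = b - a by rewrite /a /b; field.
  rewrite sinD sinB cosD cosB.
  have ht := cos2Dsin2 t; have hb := cos2Dsin2 b.
  transitivity ((2 * sin a) ^+ 2 * (cos b ^+ 2 * (cos t ^+ 2 + sin t ^+ 2) + sin b ^+ 2)).
    by ring.
  by rewrite ht mulr1 hb mulr1.
rewrite -(real_normK (num_real (_ * _))) ler_pXn2r ?nnegrE// normrM (ger0_norm (ler0n _ 2)).
rewrite (le_trans (ler_wpM2l _ (norm_sin_le _)))//.
by rewrite normrM (ger0_norm (_ : 0 <= 2^-1)) ?invr_ge0// mulrCA mulfV ?mulr1.
Qed.

Lemma S2dist_parallel (p t t' : R) : S2dist (sph p t) (sph p t') <= `|t - t'|.
Proof.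
rewrite -(ler_pXn2r (n := 2)) ?nnegrE ?S2dist_ge0// S2dist_sqr sum3.
have [-> -> ->] := coord_sph p t; have [-> -> ->] := coord_sph p t'.
have -> : (sin p * cos t - sin p * cos t') ^+ 2 + (sin p * sin t - sin p * sin t') ^+ 2
   + (cos p - cos p) ^+ 2 = (sin p * (2 * sin ((t - t') / 2))) ^+ 2.
  set a := (t - t') / 2; pose b := (t + t') / 2.
  have -> : t = b + a by rewrite /a /b; field.
  have -> : t' = b - a by rewrite /a /b; field.
  rewrite sinD sinB cosD cosB.
  have hb := cos2Dsin2 b.
  transitivity ((sin p * (2 * sin a)) ^+ 2 * (cos b ^+ 2 + sin b ^+ 2)).
    by ring.
  by rewrite hb mulr1.
rewrite -(real_normK (num_real (_ * _))) ler_pXn2r ?nnegrE// normrM.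
rewrite (le_trans (ler_wpM2r _ (sin_max _)))// mul1r normrM (ger0_norm (ler0n _ 2)).
rewrite (le_trans (ler_wpM2l _ (norm_sin_le _)))//.
by rewrite normrM (ger0_norm (_ : 0 <= 2^-1)) ?invr_ge0// mulrCA mulfV ?mulr1.
Qed.

Lemma polar_angle (a b : R) : a ^+ 2 + b ^+ 2 = 1 ->
  exists2 t, 0 <= t <= 2 * pi & a = cos t /\ b = sin t.
Proof.
move=> ab.
have a1 : -1 <= a <= 1.
  rewrite -ler_norml -(ler_pXn2r (n := 2)) ?nnegrE// real_normK ?num_real// expr1n -ab lerDl.
  exact: sqr_ge0.
have ain : a \in `[-1, 1] by rewrite in_itv.
have bE : `|b| = sin (acos a).
  by rewrite sin_acos// -ab addrC addKr sqrtr_sqr.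
have p0 := acos_ge0 a1; have p1 := acos_lepi a1.
have [b0|b0] := leP 0 b.
  exists (acos a); first by rewrite p0 (le_trans p1)// ler_peMl ?pi_ge0// ler1n.
  by rewrite acosK// -bE ger0_norm.
exists (2 * pi - acos a); first by lra.
have -> : 2 * pi - acos a = - acos a + pi *+ 2 by rewrite mulr2n; ring.
by rewrite (cosD2pi _) (sinD2pi _) cosN sinN acosK// -bE ltr0_norm// opprK.
Qed.

Lemma sph_surj x : exists p t, [/\ 0 <= p <= pi, 0 <= t <= 2 * pi & x = sph p t].
Proof.
have := sum_sqr_coord x; rewrite sum3.
set a := coord 0 x; set b := coord 1 x; set c := coord 2 x => abc.
have c1 : -1 <= c <= 1.
  rewrite -ler_norml -(ler_pXn2r (n := 2)) ?nnegrE// real_normK ?num_real// expr1n -abc lerDr.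
  by rewrite addr_ge0// sqr_ge0.
have cin : c \in `[-1, 1] by rewrite in_itv.
have sE : sin (acos c) ^+ 2 = a ^+ 2 + b ^+ 2.
  by rewrite sin2cos2 acosK// -abc; ring.
have p01 : 0 <= acos c <= pi by rewrite acos_ge0// acos_lepi.
have fin t : a = sin (acos c) * cos t -> b = sin (acos c) * sin t -> x = sph (acos c) t.
  move=> ha hb; have [h0 h1 h2] := coord_sph (acos c) t.
  by apply: coord_inj => k; have [->|->|->] := ord3P k;
    rewrite ?h0 ?h1 ?h2 -?ha -?hb ?acosK.
have [s0|s0] := eqVneq (sin (acos c)) 0.
  exists (acos c), 0; split => //; first by rewrite lexx mulr_ge0 ?pi_ge0.
  move: sE; rewrite s0 expr0n/= => /esym/eqP.
  rewrite paddr_eq0 ?sqr_ge0// !sqrf_eq0 => /andP[/eqP a0 /eqP b0].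
  by apply: fin; rewrite s0 mul0r.
have [|t t2 [ca sb]] := @polar_angle (a / sin (acos c)) (b / sin (acos c)).
  by rewrite !expr_div_n -mulrDl -sE divff// expf_neq0.
exists (acos c), t; split => //; apply: fin.
  by rewrite -ca mulrC divfK.
by rewrite -sb mulrC divfK.
Qed.

End SphereBasics.

(** * Rational functions of two variables are smooth *)

Section RationalExpressions.
Context {R : realType}.

(** Expressions are differentiated formally, so smoothness and the algebraic
    nature of all derivatives come from the syntax. *)
Inductive rexpr :=
| EConst of R
| EVar of 'I_2
| EAdd of rexpr & rexpr
| EMul of rexpr & rexpr
| EInv of rexpr.

Fixpoint evalE (e : rexpr) (u : 'rV[R]_2) : R :=
  match e with
  | EConst c => c
  | EVar i => u 0 i
  | EAdd a b => evalE a u + evalE b u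
  | EMul a b => evalE a u * evalE b u
  | EInv a => (evalE a u)^-1
  end.

(** No denominator vanishes anywhere. *)
Fixpoint regular (e : rexpr) : Prop :=
  match e with
  | EConst _ | EVar _ => True
  | EAdd a b | EMul a b => regular a /\ regular b
  | EInv a => regular a /\ forall u, evalE a u != 0
  end.

Fixpoint derE (i : 'I_2) (e : rexpr) : rexpr :=
  match e with
  | EConst _ => EConst 0
  | EVar j => EConst (j == i)%:R
  | EAdd a b => EAdd (derE i a) (derE i b)
  | EMul a b => EAdd (EMul a (derE i b)) (EMul b (derE i a))
  | EInv a => EMul (EConst (-1)) (EMul (derE i a) (EMul (EInv a) (EInv a)))
  end.

Lemma regular_derE i e : regular e -> regular (derE i e).
Proof.
elim: e => [c|j|a iha b ihb|a iha b ihb|a iha] //=.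
- by move=> [/iha ? /ihb ?].
- by move=> [ra rb]; split; split => //; [exact: ihb | exact: iha].
- by move=> [ra a0]; do !split => //; exact: iha.
Qed.

Lemma continuous_evalE e : regular e -> continuous (evalE e).
Proof.
elim: e => [c _|i _|a iha b ihb [ra rb]|a iha b ihb [ra rb]|a iha [ra a0]] u /=.
- exact: cst_continuous.
- exact: coord_continuous.
- exact: (cvgD (iha ra u) (ihb rb u)).
- exact: (cvgM (iha ra u) (ihb rb u)).
- exact: (cvgV (a0 u) (iha ra u)).
Qed.

Lemma is_derive_evalE e (i : 'I_2) u : regular e ->
  is_derive u (delta_mx 0 i : 'rV[R]_2) (evalE e : 'rV[R]_2 -> R^o) (evalE (derE i e) u).
Proof.
elim: e => [c _|j _|a iha b ihb [ra rb]|a iha b ihb [ra rb]|a iha [ra a0]] /=.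
- exact: is_derive_cst.
- have d : differentiable (fun M : 'rV[R]_2 => M 0 j : R^o) u.
    exact: differentiable_coord.
  apply: DeriveDef; first exact: diff_derivable.
  rewrite deriveE//.
  have lf : linear (fun M : 'rV[R]_2 => M 0 j : R^o).
    by move=> k M N; rewrite !mxE.
  pose F : {linear 'rV[R]_2 -> R^o} :=
    HB.pack (fun M : 'rV[R]_2 => M 0 j : R^o)
     (GRing.isLinear.Build _ _ _ _ (fun M : 'rV[R]_2 => M 0 j : R^o) lf).
  have cF : continuous F by move=> M; exact: coord_continuous.
  by rewrite (@diff_lin _ _ _ F)//= mxE eqxx.
- by have := iha ra; have := ihb rb => hb ha; exact: is_deriveD.
- have := iha ra; have := ihb rb => hb ha.
  exact: (@is_deriveM _ _ (evalE a) (evalE b) u _ _ _ ha hb).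
- have := iha ra => ha.
  have da : derivable (evalE a : 'rV[R]_2 -> R) u (delta_mx 0 i).
    exact: (@ex_derive _ _ _ _ _ _ _ ha).
  apply: DeriveDef; first exact: (derivableV (a0 u) da).
  rewrite (deriveV (a0 u) da) (@derive_val _ _ _ _ _ _ _ ha).
  rewrite /GRing.scale/= mulN1r mulNr; congr (- _).
  by rewrite mulrC -exprVn expr2.
Qed.

Lemma smooth_evalE e : regular e -> smooth (evalE e).
Proof.
move=> re l.
have [e' re' ->] : exists2 e', regular e' & iter_partial l (evalE e) = evalE e'.
  elim: l => [|i l [e' re' ih]] /=; first by exists e.
  exists (derE i e'); first exact: regular_derE.
  apply/funext => u; rewrite /partial ih.
  by have := is_derive_evalE i u re' => d; exact: derive_val.
split; first exact: continuous_evalE.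
by move=> u i; have := is_derive_evalE i u re' => d; exact: ex_derive.
Qed.

Lemma partial_evalE e i : regular e -> partial i (evalE e) = evalE (derE i e).
Proof.
move=> re; apply/funext => u.
by have := is_derive_evalE i u re => d; exact: derive_val.
Qed.

End RationalExpressions.

(** * Algebraic dependence on a double cover of the plane *)

Section AlgebraicDependence.
Context {R : realType}.
Implicit Types (p q r : {poly {poly R}}) (u : 'rV[R]_2).

Definition eval2 p u : R := p.[(u 0 1)%:P].[u 0 0].

Definition bounded2 n p := (size p <= n)%N /\ forall i, (size (p`_i)%R <= n)%N.

Lemma eval2D p q u : eval2 (p + q) u = eval2 p u + eval2 q u.
Proof. by rewrite /eval2 !hornerD. Qed.

Lemma eval2M p q u : eval2 (p * q) u = eval2 p u * eval2 q u.
Proof. by rewrite /eval2 !hornerM. Qed.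

Lemma eval21 u : eval2 1 u = 1.
Proof. by rewrite /eval2 !hornerC. Qed.

Lemma eval2_sum (I : finType) (F : I -> {poly {poly R}}) u :
  eval2 (\sum_i F i) u = \sum_i eval2 (F i) u.
Proof. by rewrite /eval2 !horner_sum. Qed.

Lemma eval2_prod (I : Type) (s : seq I) (P : pred I) (F : I -> {poly {poly R}}) u :
  eval2 (\prod_(i <- s | P i) F i) u = \prod_(i <- s | P i) eval2 (F i) u.
Proof. by rewrite /eval2 !horner_prod. Qed.

Lemma eval2Z c p u : eval2 (c%:P%:P * p) u = c * eval2 p u.
Proof. by rewrite eval2M /eval2 !hornerC. Qed.

Lemma bounded2_exists p : exists n, bounded2 n p.
Proof.
exists (maxn (size p) (\max_(i < size p) size (p`_i)%R)); split; first exact: leq_maxl.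
move=> i; have [ip|pi] := ltnP i (size p); last by rewrite nth_default// size_poly0.
rewrite leq_max; apply/orP; right.
exact: (leq_bigmax (Ordinal ip) (F := fun i : 'I_(size p) => size (p`_i)%R)).
Qed.

Lemma bounded2W m n p : (m <= n)%N -> bounded2 m p -> bounded2 n p.
Proof.
by move=> mn [a b]; split => [|i]; [exact: leq_trans mn | exact: leq_trans mn].
Qed.

Lemma bounded2D n p q : bounded2 n p -> bounded2 n q -> bounded2 n (p + q).
Proof.
move=> [a b] [c d]; split => [|i].
  by rewrite (leq_trans (size_polyD _ _))// geq_max a c.
by rewrite coefD (leq_trans (size_polyD _ _))// geq_max b d.
Qed.

Lemma bounded2M m n p q : bounded2 m p -> bounded2 n q -> bounded2 (m + n) (p * q).
Proof.
move=> [a b] [c d]; split => [|i].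
  rewrite (leq_trans (size_polyMleq _ _))// (leq_trans (leq_pred _))//.
  exact: leq_add.
rewrite coefM; apply: (leq_trans (size_sum _ _ _)).
apply/bigmax_leqP => j _.
rewrite (leq_trans (size_polyMleq _ _))// (leq_trans (leq_pred _))//.
exact: leq_add.
Qed.

Lemma bounded21 : bounded2 1 1.
Proof.
split; first by rewrite size_poly1.
by case=> [|i]; rewrite coef1 ?size_poly1// size_poly0.
Qed.

Lemma bounded20 n : bounded2 n 0.
Proof. by split=> [|i]; rewrite ?coef0 size_poly0. Qed.

(** Quotients of polynomials without poles. *)
Definition rational2 (F : 'rV[R]_2 -> R) := exists p d,
  (forall u, eval2 d u != 0) /\ forall u, F u = eval2 p u / eval2 d u.

Lemma rational2C c : rational2 (fun=> c).
Proof.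
exists c%:P%:P, 1; split=> u; rewrite eval21 ?oner_neq0//.
by rewrite /eval2 !hornerC divr1.
Qed.

Lemma rational2D F G : rational2 F -> rational2 G -> rational2 (fun u => F u + G u).
Proof.
move=> [p [d [d0 Fe]]] [q [e [e0 Ge]]]; exists (p * e + q * d), (d * e); split=> u.
  by rewrite eval2M mulf_neq0.
by rewrite Fe Ge !(eval2D, eval2M); field; rewrite d0 e0.
Qed.

Lemma rational2M F G : rational2 F -> rational2 G -> rational2 (fun u => F u * G u).
Proof.
move=> [p [d [d0 Fe]]] [q [e [e0 Ge]]]; exists (p * q), (d * e); split=> u.
  by rewrite eval2M mulf_neq0.
by rewrite Fe Ge !(eval2D, eval2M); field; rewrite d0 e0.
Qed.

Lemma rational2N F : rational2 F -> rational2 (fun u => - F u).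
Proof.
move=> /(rational2M (rational2C (-1))); congr rational2.
by apply/funext => u; rewrite mulN1r.
Qed.

Lemma rational2B F G : rational2 F -> rational2 G -> rational2 (fun u => F u - G u).
Proof. by move=> hF /rational2N; exact: rational2D. Qed.

Lemma rational2_sum n (F : 'I_n -> 'rV[R]_2 -> R) : (forall i, rational2 (F i)) ->
  rational2 (fun u => \sum_i F i u).
Proof.
move=> hF; suff : forall s : seq 'I_n, rational2 (fun u => \sum_(i <- s) F i u) by exact.
elim=> [|i s ih].
  by rewrite (_ : (fun u => _) = fun=> 0); [exact: rational2C |
    apply/funext => u; rewrite big_nil].
rewrite (_ : (fun u => _) = fun u => F i u + \sum_(j <- s) F j u).
  exact: rational2D.
by apply/funext => u; rewrite big_cons.
Qed.

Lemma rational2_evalE e : regular e -> rational2 (evalE e).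
Proof.
elim: e => [c _|i _|a iha b ihb [ra rb]|a iha b ihb [ra rb]|a iha [ra a0]] /=.
- exact: rational2C.
- have [->|->] : i = 0 \/ i = 1.
  + by case: i => [[|[|]]]// ?; [left|right]; exact: val_inj.
  + exists ('X%:P), 1; split=> u; rewrite eval21 ?oner_neq0//.
    by rewrite /eval2 hornerC hornerX divr1.
  + exists 'X, 1; split=> u; rewrite eval21 ?oner_neq0//.
    by rewrite /eval2 hornerX hornerC divr1.
- exact: rational2D (iha ra) (ihb rb).
- exact: rational2M (iha ra) (ihb rb).
- have [p [d [d0 Fe]]] := iha ra.
  exists d, p; split=> u; last by rewrite Fe invf_div.
  by apply: contraNneq (a0 u); rewrite Fe => ->; rewrite mul0r.
Qed.

Lemma common_denominator (I : finType) (F : I -> 'rV[R]_2 -> R) :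
  (forall i, rational2 (F i)) ->
  exists d (p : I -> {poly {poly R}}),
  (forall u, eval2 d u != 0) /\ forall i u, eval2 d u * F i u = eval2 (p i) u.
Proof.
move=> /choice[p /choice[d pd]].
exists (\prod_i d i), (fun i => p i * \prod_(j | j != i) d j); split => [u|i u].
  by rewrite eval2_prod; apply/prodf_neq0 => i _; have [] := pd i.
have [di Fi] := pd i.
by rewrite (bigD1 i)//= !eval2M Fi; field; exact: di.
Qed.

(** More vectors than coordinates. *)
Lemma linear_dependence (I J : finType) (M : I -> J -> R) : (#|J| < #|I|)%N ->
  exists c : I -> R, (exists i, c i != 0) /\ forall j, \sum_i c i * M i j = 0.
Proof.
move=> JI; pose A := \matrix_(i < #|I|, j < #|J|) M (enum_val i) (enum_val j).
have /rowV0Pn[v /sub_kermxP vA v0] : kermx A != 0.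
  rewrite -mxrank_eq0 mxrank_ker -lt0n subn_gt0.
  exact: leq_ltn_trans (rank_leq_col A) JI.
exists (fun i => v 0 (enum_rank i)); split.
  have /existsP[i vi] : [exists i, v 0 i != 0].
    apply: contra_neqT v0; rewrite negb_exists => /forallP v0.
    by apply/rowP => i; rewrite mxE; apply/eqP; rewrite -[_ == _]negbK.
  by exists (enum_val i); rewrite enum_valK.
move=> j; have /rowP/(_ (enum_rank j)) := vA.
rewrite !mxE => vA0; rewrite -[RHS]vA0 (reindex_onto enum_val enum_rank) /=; last first.
  by move=> i _; exact: enum_rankK.
apply: eq_big => [i|i _]; first by rewrite enum_valK eqxx.
by rewrite enum_valK mxE enum_rankK.
Qed.

Definition eval3 (H : {poly {poly {poly R}}}) (a : 'I_3 -> R) : R :=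
  H.[(a 2)%:P%:P].[(a 1)%:P].[a 0].

Lemma eval3M G H a : eval3 (G * H) a = eval3 G a * eval3 H a.
Proof. by rewrite /eval3 !hornerM. Qed.

Lemma eval3_poly d (c : nat -> nat -> nat -> R) a :
  eval3 (\poly_(i < d) \poly_(j < d) \poly_(k < d) c i j k) a =
  \sum_(i < d) \sum_(j < d) \sum_(k < d) c i j k * a 0 ^+ k * a 1 ^+ j * a 2 ^+ i.
Proof.
rewrite /eval3 horner_poly !horner_sum; apply: eq_bigr => i _.
rewrite !hornerM horner_poly -!(rmorphXn polyC) !hornerC !horner_sum mulr_suml.
apply: eq_bigr => j _.
rewrite !hornerM horner_poly -!(rmorphXn polyC) !hornerC !mulr_suml.
by apply: eq_bigr => k _.
Qed.

Section DoubleCover.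
Variables (t dl : 'rV[R]_2 -> R).
Variables (d T D : {poly {poly R}}) (e : nat).
Hypotheses (d0 : forall u, eval2 d u != 0) (Te : bounded2 e T) (De : bounded2 e D).
Hypotheses (Tt : forall u, eval2 T u = eval2 d u * t u)
           (Dd : forall u, eval2 D u = eval2 d u ^+ 2 * dl u).

(** Functions on the double cover [tau ^+ 2 = t u * tau + dl u] of the plane,
    brought into the basis 1, [d * tau] with polynomial coefficients of
    bounded degree; [d] clears denominators. *)
Definition reduced n (F : 'rV[R]_2 -> R -> R) := exists r0 r1,
  [/\ bounded2 n r0, bounded2 n r1 & forall u tau, tau ^+ 2 = t u * tau + dl u ->
      F u tau = eval2 r0 u + eval2 r1 u * (eval2 d u * tau)].

Lemma reducedM m n F G : reduced m F -> reduced n G ->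
  reduced (m + n + e) (fun u tau => F u tau * G u tau).
Proof.
move=> [r0 [r1 [b0 b1 Fe]]] [q0 [q1 [c0 c1 Ge]]].
exists (r0 * q0 + r1 * q1 * D), (r0 * q1 + r1 * q0 + r1 * q1 * T); split.
- apply: bounded2D; last by apply: bounded2M => //; exact: bounded2M.
  by apply: bounded2W (bounded2M b0 c0); rewrite leq_addr.
- apply: bounded2D; last by apply: bounded2M => //; exact: bounded2M.
  by apply: bounded2W (leq_addr _ _) _; apply: bounded2D; apply: bounded2M.
- move=> u tau Z; rewrite Fe// Ge// !(eval2D, eval2M) Tt Dd.
  have -> : dl u = tau ^+ 2 - t u * tau by rewrite Z; ring.
  by ring.
Qed.

Lemma reducedX m F n : reduced m F ->
  reduced (n * (m + e) + 1) (fun u tau => F u tau ^+ n).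
Proof.
move=> rF; elim: n => [|n ih].
  exists 1, 0; split; [exact: bounded21|exact: bounded20|].
  by move=> u tau _; rewrite expr0 eval21 /eval2 !horner0 mul0r addr0.
have [r0 [r1 [b0 b1 Fe]]] := reducedM rF ih.
exists r0, r1; split; last by move=> u tau Z; rewrite exprS Fe.
  by apply: bounded2W b0; rewrite mulSn; lia.
by apply: bounded2W b1; rewrite mulSn; lia.
Qed.

Lemma reducedW m n F : (m <= n)%N -> reduced m F -> reduced n F.
Proof.
move=> mn [r0 [r1 [b0 b1 Fe]]].
by exists r0, r1; split => //; [exact: bounded2W b0|exact: bounded2W b1].
Qed.

End DoubleCover.

Lemma sum_eval2_eq0 n (I : finType) (c : I -> R) (r : I -> {poly {poly R}}) u :
  (forall i, bounded2 n (r i)) ->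
  (forall j k : 'I_n, \sum_i c i * (r i)`_j`_k = 0) ->
  \sum_i c i * eval2 (r i) u = 0.
Proof.
move=> rn c0; under eq_bigr do rewrite -eval2Z.
rewrite -eval2_sum; set p := \sum_i _.
suff -> : p = 0 by rewrite /eval2 !horner0.
apply/polyP => j; apply/polyP => k; rewrite coef0 coef0 /p.
rewrite coef_sum coef_sum.
under eq_bigr do rewrite !coefCM.
have [jn|nj] := ltnP j n; last first.
  apply: big1 => i _; rewrite [(r i)`_j]nth_default ?coef0 ?mulr0//.
  by rewrite (leq_trans _ nj)//; have [] := rn i.
have [kn|nk] := ltnP k n; last first.
  apply: big1 => i _; rewrite [(r i)`_j`_k]nth_default ?mulr0//.
  by rewrite (leq_trans _ nk)//; have [_ ->] := rn i.
exact: (c0 (Ordinal jn) (Ordinal kn)).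
Qed.

(** Three functions on a surface are algebraically dependent. There are [m ^
    3] monomials of degree less than [m] in each function; cleared of
    denominators and reduced, each of them is given by [2 * n ^ 2]
    coefficients with [n] linear in [m]. For large [m] there are more
    monomials than coefficients, hence a linear relation. *)
Lemma algebraic_dependence (t dl : 'rV[R]_2 -> R) (P Q : 'I_3 -> 'rV[R]_2 -> R) :
  rational2 t -> rational2 dl ->
  (forall k, rational2 (P k)) -> (forall k, rational2 (Q k)) ->
  exists2 H : {poly {poly {poly R}}}, H != 0 &
    forall u tau, tau ^+ 2 = t u * tau + dl u ->
      eval3 H (fun k => P k u + Q k u * tau) = 0.
Proof.
move=> rt rdl rP rQ.
pose F (x : option 'I_3 * bool) : 'rV[R]_2 -> R :=
  match x with
  | (None, false) => t | (None, true) => dl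
  | (Some k, false) => P k | (Some k, true) => Q k end.
have [|d [p [d0 dF]]] := @common_denominator _ F.
  by case=> [[k|] [|]] /=.
pose T := p (None, false); pose D := d * p (None, true).
have Tt u : eval2 T u = eval2 d u * t u by rewrite /T -dF.
have Dd u : eval2 D u = eval2 d u ^+ 2 * dl u.
  by rewrite /D eval2M -dF /= expr2 mulrA.
have [e1 Te1] := bounded2_exists T; have [e2 De2] := bounded2_exists D.
pose e := maxn e1 e2.
have Te : bounded2 e T by apply: bounded2W Te1; exact: leq_maxl.
have De : bounded2 e D by apply: bounded2W De2; exact: leq_maxr.
pose red := reduced t dl d.
pose A k (u : 'rV[R]_2) tau := P k u + Q k u * tau.
have [c rA rd] : exists2 c, (forall k, red c (fun u tau => eval2 d u ^+ 2 * A k u tau))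
    & red c (fun u _ => eval2 d u ^+ 2).
  have [c0 cP] := bounded2_exists (d * d).
  have /choice[c1 cA] : forall k, exists n, red n (fun u tau => eval2 d u ^+ 2 * A k u tau).
    move=> k; have [n1 h1] := bounded2_exists (d * p (Some k, false)).
    have [n2 h2] := bounded2_exists (p (Some k, true)).
    exists (maxn n1 n2), (d * p (Some k, false)), (p (Some k, true)); split.
    - by apply: bounded2W h1; exact: leq_maxl.
    - by apply: bounded2W h2; exact: leq_maxr.
    - by move=> u tau _; rewrite eval2M -!dF /A /=; ring.
  exists (maxn c0 (\max_k c1 k)) => [k|].
    apply: reducedW (cA k); rewrite leq_max; apply/orP; right.
    exact: leq_bigmax.
  exists (d * d), 0; split.
  - by apply: bounded2W cP; exact: leq_maxl.
  - exact: bounded20.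
  - by move=> u tau _; rewrite eval2M /eval2 !horner0 mul0r addr0 expr2.
(* chosen to have n <= m * kappa and 2 * n ^ 2 < m ^ 3 below *)
pose kappa := (6 * (c + e) + 6 + 5 * e)%N.
pose m := (2 * kappa ^ 2).+1.
pose n := (6 * (m * (c + e) + 1) + 5 * e)%N.
have nm : (n <= m * kappa)%N by rewrite /n /kappa /m; nia.
have card_lt : (#|{: bool * 'I_n * 'I_n}| < #|{: 'I_m * 'I_m * 'I_m}|)%N.
  rewrite !card_prod !card_ord card_bool.
  have : (2 * kappa ^ 2 < m)%N by [].
  move: nm; move: (m) (n) => m' n' nm km.
  have -> : (2 * n' * n' = 2 * (n' * n'))%N by rewrite mulnA.
  have h : (n' * n' <= m' * kappa * (m' * kappa))%N by exact: leq_mul.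
  have m0 : (0 < m' * m')%N by rewrite muln_gt0; lia.
  apply: (@leq_ltn_trans (m' * m' * (2 * kappa ^ 2))%N).
    by rewrite -mulnn; nia.
  by rewrite ltn_pmul2l.
have redpow k (j : 'I_m) :
    red (m * (c + e) + 1)%N (fun u tau => (eval2 d u ^+ 2 * A k u tau) ^+ j) /\
    red (m * (c + e) + 1)%N (fun u tau => (eval2 d u ^+ 2) ^+ (m - j)).
  split.
    apply: reducedW (reducedX Te De Tt Dd j (rA k)).
    by rewrite leq_add2r leq_mul2r (ltnW (ltn_ord j)) orbT.
  apply: reducedW (reducedX Te De Tt Dd (m - j) rd).
  by rewrite leq_add2r leq_mul2r leq_subr orbT.
pose mon (a : 'I_m * 'I_m * 'I_m) (u : 'rV[R]_2) tau :=
  (eval2 d u ^+ 2) ^+ (3 * m) *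
  (A 0 u tau ^+ a.2 * A 1 u tau ^+ a.1.2 * A 2 u tau ^+ a.1.1).
have /choice[r0 /choice[r1 rmon]] a : red n (mon a).
  have [h0 h0'] := redpow 0 a.2; have [h1 h1'] := redpow 1 a.1.2.
  have [h2 h2'] := redpow 2 a.1.1.
  have := reducedM Te De Tt Dd (reducedM Te De Tt Dd h2 h2')
    (reducedM Te De Tt Dd (reducedM Te De Tt Dd h0 h0') (reducedM Te De Tt Dd h1 h1')).
  move=> /(@reducedW _ _ _ _ n) h.
  have {h} [|s0 [s1 [b0 b1 E]]] := h; first by rewrite /n; lia.
  exists s0, s1; split => // u tau Z; rewrite -E// /mon.
  have -> : (3 * m = a.2 + (m - a.2) + (a.1.2 + (m - a.1.2)) + (a.1.1 + (m - a.1.1)))%N.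
    by rewrite !subnKC ?(ltnW (ltn_ord _))//; lia.
  by rewrite !exprD !exprMn; ring.
have [h [[a0 ha0] hM]] := linear_dependence (fun a (x : bool * 'I_n * 'I_n) =>
  (if x.1.1 then r0 a else r1 a)`_x.1.2`_x.2) card_lt.
pose cf i j k := match insub i, insub j, insub k with
  | Some i, Some j, Some k => h (i, j, k) | _, _, _ => 0 end.
have cfE (i j k : 'I_m) : cf i j k = h (i, j, k) by rewrite /cf !valK.
exists (\poly_(i < m) \poly_(j < m) \poly_(k < m) cf i j k).
  apply: contra_neq ha0 => H0; case: a0 => [[i j] k].
  move: H0 => /polyP/(_ i)/polyP/(_ j)/polyP/(_ k).
  by rewrite !coef0 !(coef_poly, ltn_ord) cfE.
move=> u tau Z; rewrite eval3_poly.
have d3 : (eval2 d u ^+ 2) ^+ (3 * m) != 0 by rewrite !expf_neq0.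
apply: (mulfI d3); rewrite mulr0.
rewrite pair_big pair_big /= mulr_sumr.
transitivity (\sum_a h a * mon a u tau).
  apply: eq_bigr => -[[i j] k] _ /=.
  by rewrite cfE /mon /= /A; ring.
transitivity (\sum_a h a * eval2 (r0 a) u +
    (\sum_a h a * eval2 (r1 a) u) * (eval2 d u * tau)).
  rewrite mulr_suml -big_split /=; apply: eq_bigr => a _.
  by have [_ _ ->//] := rmon a; rewrite mulrDr mulrA.
rewrite (@sum_eval2_eq0 n) ?(@sum_eval2_eq0 n) ?mul0r ?addr0//.
- by move=> a; have [] := rmon a.
- by move=> j k; exact: (hM (false, j, k)).
- by move=> a; have [] := rmon a.
- by move=> j k; exact: (hM (true, j, k)).
Qed.

Lemma nonroot_small (D : idomainType) (p : {poly D}) (x : nat -> D) :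
  injective x -> p != 0 -> exists n, p.[x n] != 0.
Proof.
move=> xi p0; apply: contrapT => /forallNP h.
have roots : all (root p) (map x (iota 0 (size p))).
  apply/allP => _ /mapP[n _ ->]; apply/rootP/eqP.
  by have /negP := h n; rewrite negbK.
have := max_poly_roots p0 roots.
by rewrite map_inj_uniq// iota_uniq size_map size_iota ltnn => /(_ isT).
Qed.

(** A nonzero polynomial does not vanish on a grid with infinitely many values
    in each coordinate; here these values are [r / n.+1]. *)
Lemma eval3_neq0 (H : {poly {poly {poly R}}}) (r : R) : H != 0 -> 0 < r ->
  exists a : 'I_3 -> R, (forall k, `|a k| <= r) /\ eval3 H a != 0.
Proof.
move=> H0 r0; pose x n : R := r / n.+1%:R.
have xr n : `|x n| <= r.
  rewrite /x ger0_norm ?(divr_ge0, ler0n, ltW r0)// ler_pdivrMr ?ltr0Sn//.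
  by rewrite ler_peMr ?ler1n ?(ltW r0).
have xi : injective x.
  move=> m n /(mulfI (lt0r_neq0 r0))/invr_inj/eqP.
  by rewrite eqr_nat eqSS => /eqP.
have [n2 h2] := @nonroot_small _ H (fun n => (x n)%:P%:P)
  (fun m n e => xi _ _ (polyC_inj (polyC_inj e))) H0.
have [n1 h1] := @nonroot_small _ _ (fun n => (x n)%:P)
  (fun m n e => xi _ _ (polyC_inj e)) h2.
have [n0 h0] := @nonroot_small _ _ x xi h1.
exists (fun k => nth 0 [:: x n0; x n1; x n2] k); split => [k|].
  by case: k => [[|[|[|//]]]] ? /=; exact: xr.
exact: h0.
Qed.

End AlgebraicDependence.

(** * Perturbing a rational function into a Morse function *)

Section MorsePerturbation.
Context {R : realType}.
Implicit Types (u : 'rV[R]_2) (x : S2 R).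

Definition stereoE_den : rexpr (R := R) :=
  EInv (EAdd (EConst 1) (EAdd (EMul (EVar 0) (EVar 0)) (EMul (EVar 1) (EVar 1)))).

(** The coordinate functions of the sphere in the stereographic charts. *)
Definition stereoE (s : bool) (k : 'I_3) : rexpr :=
  EMul (nth (EConst 0) [:: EMul (EConst 2) (EVar 0); EMul (EConst 2) (EVar 1);
    EMul (EConst ((-1) ^+ s))
     (EAdd (EAdd (EMul (EVar 0) (EVar 0)) (EMul (EVar 1) (EVar 1))) (EConst (-1)))] k)
   stereoE_den.

Lemma stereo_den_neq0 u : 1 + (u 0 0 * u 0 0 + u 0 1 * u 0 1) != 0.
Proof. by rewrite gt_eqF// ltr_wpDr// addr_ge0// -expr2 sqr_ge0. Qed.

Lemma regular_stereoE s k : regular (stereoE s k).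
Proof.
split; last by split=> [//|u]; exact: stereo_den_neq0.
by case: k => [[|[|[|//]]]].
Qed.

Lemma evalE_stereoE s k u : evalE (stereoE s k) u = coord k (stereo s u).
Proof.
rewrite /coord /= /stereo_vec /vec3 mxE !expr2.
by case: k => [[|[|[|//]]]] ? /=; rewrite ?mulrA.
Qed.

Definition dcoord s k i u : R := evalE (derE i (stereoE s k)) u.
Definition ddcoord s k i j u : R := evalE (derE i (derE j (stereoE s k))) u.

Definition den u : R := 1 + (u 0 0 * u 0 0 + u 0 1 * u 0 1).

Lemma sum2 (F : 'I_2 -> R) : \sum_k F k = F 0 + F 1.
Proof. by rewrite !big_ord_recl big_ord0 addr0; congr (F _ + F _); exact: val_inj. Qed.

Lemma ord2P (k : 'I_2) : k = 0 \/ k = 1.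
Proof. by case: k => [[|[|//]]] ?; [left|right]; exact: val_inj. Qed.

(** Decomposition of [a] in the orthogonal frame formed by the point of the
    sphere and the two coordinate vectors of a chart, whose squared length is
    [4 / den u ^+ 2]. *)
Lemma tangent_frame s u (a : 'I_3 -> R) k :
  a k = coord k (stereo s u) * (\sum_l a l * coord l (stereo s u)) +
   den u ^+ 2 / 4 * \sum_i (\sum_l a l * dcoord s l i u) * dcoord s k i u.
Proof.
have := stereo_den_neq0 u.
rewrite sum2 !sum3 -!evalE_stereoE /dcoord /den.
have [->|->|->] := ord3P k; case: s; rewrite /= ?expr0 ?expr1;
  move: (u 0 0) (u 0 1) (a 0) (a 1) (a 2) => x y a0 a1 a2 n0; field; exact: n0.
Qed.

(** Differentiate the orthogonality of the point and the coordinate vectors: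
    the second derivatives have the normal component given by minus the first
    fundamental form, which is conformal. *)
Lemma conformal_hessian s u i j :
  \sum_k coord k (stereo s u) * ddcoord s k i j u = - 4 / den u ^+ 2 * (i == j)%:R.
Proof.
have := stereo_den_neq0 u.
rewrite sum3 -!evalE_stereoE /ddcoord /den.
have [->|->] := ord2P i; have [->|->] := ord2P j; case: s; rewrite /= ?expr0 ?expr1;
  move: (u 0 0) (u 0 1) => x y n0; field; exact: n0.
Qed.

Lemma det2 (M : 'M[R]_2) : \det M = M 0 0 * M 1 1 - M 0 1 * M 1 0.
Proof.
rewrite (expand_det_row _ 0) sum2 /cofactor !det_mx11 !mxE.
rewrite expr0 expr1 mul1r mulN1r mulrN.
by congr (_ * M _ _ - _ * M _ _); exact: val_inj.
Qed.

(** At a critical point [u] of [e + a . x] the tangential part of [a] is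
    determined by [u], so [a = P u + tau * x u] with one free parameter [tau].
    By [conformal_hessian] the parameter shifts the Hessian by a multiple of
    the identity matrix, so degeneracy is a quadratic equation for [tau] with
    coefficients depending on [u]: the bad [a] come from a double cover of the
    plane. *)
Lemma degenerate_slopes_algebraic (s : bool) (e : rexpr (R := R)) : regular e ->
  exists2 H : {poly {poly {poly R}}}, H != 0 & forall u (a : 'I_3 -> R),
    (forall i, evalE (derE i e) u + \sum_k a k * dcoord s k i u = 0) ->
    \det (\matrix_(i, j) (evalE (derE i (derE j e)) u +
      \sum_k a k * ddcoord s k i j u)) = 0 ->
    eval3 H a = 0.
Proof.
move=> re.
pose P k u := - (den u ^+ 2 / 4 * \sum_i evalE (derE i e) u * dcoord s k i u).
pose Q k u := coord k (stereo s u).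
pose M i j u := evalE (derE i (derE j e)) u + \sum_k P k u * ddcoord s k i j u.
pose t u := den u ^+ 2 / 4 * (M 0 0 u + M 1 1 u).
pose dl u := - (den u ^+ 2 / 4 * (den u ^+ 2 / 4) * (M 0 0 u * M 1 1 u - M 0 1 u * M 1 0 u)).
have rden : rational2 (fun u => den u ^+ 2 / 4).
  apply: (@rational2M _ (fun u => den u ^+ 2)); last exact: rational2C.
  pose E : rexpr (R := R) :=
    EAdd (EConst 1) (EAdd (EMul (EVar 0) (EVar 0)) (EMul (EVar 1) (EVar 1))).
  have rE : rational2 (evalE E) by apply: rational2_evalE; rewrite /=.
  rewrite (_ : (fun u => _) = fun u => evalE E u * evalE E u); first exact: rational2M.
  by apply/funext => u; rewrite expr2.
have rd k i : rational2 (dcoord s k i).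
  by apply: rational2_evalE; apply: regular_derE; exact: regular_stereoE.
have rdd k i j : rational2 (ddcoord s k i j).
  by apply: rational2_evalE; do 2!apply: regular_derE; exact: regular_stereoE.
have rP k : rational2 (P k).
  apply: rational2N; apply: rational2M => //.
  apply: rational2_sum => i; apply: rational2M => //.
  by apply: rational2_evalE; exact: regular_derE.
have rQ k : rational2 (Q k).
  rewrite (_ : Q k = evalE (stereoE s k)); first exact/rational2_evalE/regular_stereoE.
  by apply/funext => u; rewrite evalE_stereoE.
have rM i j : rational2 (M i j).
  apply: rational2D; first by apply: rational2_evalE; do 2!apply: regular_derE.
  by apply: rational2_sum => k; exact: rational2M.
have rt : rational2 t by apply: rational2M => //; exact: rational2D.
have rdl : rational2 dl.
  apply: rational2N; apply: rational2M; first exact: rational2M.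
  by apply: rational2B; exact: rational2M.
have [H H0 HZ] := algebraic_dependence rt rdl rP rQ.
exists H => // u a crit degen.
pose tau := \sum_l a l * coord l (stereo s u).
have aE k : a k = P k u + Q k u * tau.
  rewrite {1}(tangent_frame s u a) addrC; congr (_ + _).
  rewrite /P -mulrN -sumrN; congr (_ * _); apply: eq_bigr => i _.
  by rewrite -mulNr; congr (_ * _); apply/eqP; rewrite -addr_eq0 addrC crit.
have hessE i j : evalE (derE i (derE j e)) u + \sum_k a k * ddcoord s k i j u =
    M i j u - 4 / den u ^+ 2 * (i == j)%:R * tau.
  rewrite /M -!addrA; congr (_ + _).
  rewrite -mulNr -mulNr -mulNr -(conformal_hessian s) mulr_suml -big_split /=.
  by apply: eq_bigr => k _; rewrite aE mulrDl; congr (_ + _); rewrite /Q; ring.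
have d0 : den u != 0 by exact: stereo_den_neq0.
suff Z : tau ^+ 2 = t u * tau + dl u.
  by rewrite -[RHS](HZ _ _ Z); congr eval3; apply/funext.
move: degen; rewrite det2 !mxE !hessE /= !mulr1 !mulr0 !mul0r !subr0.
rewrite /t /dl; move: (M 0 0 u) (M 1 1 u) (M 0 1 u) (M 1 0 u) => m00 m11 m01 m10 degen.
apply/eqP; rewrite -subr_eq0; apply/eqP.
transitivity ((den u ^+ 2 / 4) ^+ 2 *
   ((m00 - 4 / den u ^+ 2 * tau) * (m11 - 4 / den u ^+ 2 * tau) - m01 * m10)).
  by field; exact: d0.
by rewrite degen mulr0.
Qed.

(** Away from the zero sets of the polynomials of the two charts, there are
    arbitrarily small slopes. *)
Lemma morse_perturbation (g : S2 R -> R) (r : R) : 0 < r ->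
  (forall s, exists2 e, regular e & g \o stereo s = evalE e) ->
  exists a : 'I_3 -> R, (forall k, `|a k| <= r) /\
    morse (fun x => g x + \sum_k a k * coord k x).
Proof.
move=> r0 gE.
have /choice[e /all_and2[re ge]] : forall s, exists e, regular e /\ g \o stereo s = evalE e.
  by move=> s; have [e] := gE s; exists e.
have [H0 nz0 Z0] := degenerate_slopes_algebraic false (re false).
have [H1 nz1 Z1] := degenerate_slopes_algebraic true (re true).
have [a [ar]] := eval3_neq0 (mulf_neq0 nz0 nz1) r0.
rewrite eval3M mulf_eq0 negb_or => /andP[ha0 ha1].
exists a; split => // s.
pose E := EAdd (e s) (EAdd (EAdd (EMul (EConst (a 0)) (stereoE s 0))
  (EMul (EConst (a 1)) (stereoE s 1))) (EMul (EConst (a 2)) (stereoE s 2))).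
have rE : regular E.
  by do !split => //; solve [exact: re | exact: stereo_den_neq0].
have -> : (fun x => g x + \sum_k a k * coord k x) \o stereo s = evalE E.
  apply/funext => u; rewrite /= sum3 -!evalE_stereoE.
  by have /(congr1 (@^~ u)) /= -> := ge s.
split; first exact: smooth_evalE.
move=> u crit; apply/eqP => degen.
suff : eval3 (if s then H1 else H0) a = 0.
  by move: ha0 ha1; case: (s) => + + h; rewrite h eqxx.
have cr i : evalE (derE i (e s)) u + \sum_k a k * dcoord s k i u = 0.
  rewrite -[RHS](crit i) (partial_evalE i rE) sum3 /dcoord /E.
  by move: (stereoE s) => S /=; ring.
have dg : \det (\matrix_(i, j) (evalE (derE i (derE j (e s))) u +
      \sum_k a k * ddcoord s k i j u)) = 0.
  rewrite -[RHS]degen; congr (\det _); apply/matrixP => i j; rewrite !mxE.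
  rewrite (partial_evalE j rE) (partial_evalE i (regular_derE j rE)) sum3.
  rewrite /ddcoord /E; move: (stereoE s) => S /=; ring.
by move: cr dg; case: (s) => cr dg; [exact: Z1 cr dg | exact: Z0 cr dg].
Qed.

End MorsePerturbation.

(** * Density of Morse functions *)

Section MorseDensity.
Context {R : realType}.
Implicit Types (x y : S2 R) (s : seq (S2 R)).

(** A substitute for the triangle inequality that stays with squares. *)
Lemma S2dist_detour x y z :
  S2dist x z ^+ 2 <= 2 * S2dist x y ^+ 2 + 2 * S2dist y z ^+ 2.
Proof.
rewrite !S2dist_sqr !mulr_sumr -big_split /=; apply: ler_sum => k _.
rewrite -subr_ge0.
have -> : forall a b c : R, 2 * (a - b) ^+ 2 + 2 * (b - c) ^+ 2 - (a - c) ^+ 2 =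
  (a - b - (b - c)) ^+ 2 by move=> a b c; ring.
exact: sqr_ge0.
Qed.

Lemma finite_net (r : R) : 0 < r ->
  exists s, forall x, exists2 y, y \in s & S2dist x y <= r.
Proof.
move=> r0; pose h := r / 2; have h0 : 0 < h by rewrite divr_gt0.
pose n := (Num.truncn (2 * pi / h)).+1.
exists [seq sph (i%:R * h) (j%:R * h) | i <- iota 0 n, j <- iota 0 n] => x.
have near (t : R) : 0 <= t <= 2 * pi -> exists2 i, (i < n)%N & `|t - i%:R * h| <= h.
  move=> /andP[t0 t2]; exists (Num.truncn (t / h)).
    by rewrite ltnS; apply: le_truncn; rewrite ler_pM2r ?invr_gt0.
  have /andP[a b] := truncn_itv (divr_ge0 t0 (ltW h0)).
  rewrite ler_pdivlMr// in a; rewrite ltr_pdivrMr// -natr1 mulrDl mul1r in b.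
  by rewrite ger0_norm ?subr_ge0// lerBlDl ltW.
have [p [t [/andP[p0 p1] t01 ->]]] := sph_surj x.
have [|i ilt ip] := near p.
  by rewrite p0 (le_trans p1)// ler_peMl ?pi_ge0// ler1n.
have [j jlt jt] := near t t01.
exists (sph (i%:R * h) (j%:R * h)).
  by apply/allpairsP; exists (i, j); split; rewrite ?mem_iota.
rewrite -(ler_pXn2r (n := 2)) ?nnegrE ?S2dist_ge0 ?(ltW r0)//.
apply: (le_trans (S2dist_detour _ (sph (i%:R * h) t) _)).
have l1 := le_trans (S2dist_meridian p (i%:R * h) t) ip.
have l2 := le_trans (S2dist_parallel (i%:R * h) t (j%:R * h)) jt.
rewrite -(ler_pXn2r (n := 2)) ?nnegrE ?S2dist_ge0 ?(ltW h0)// in l1.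
rewrite -(ler_pXn2r (n := 2)) ?nnegrE ?S2dist_ge0 ?(ltW h0)// in l2.
have -> : r ^+ 2 = 2 * h ^+ 2 + 2 * h ^+ 2 by rewrite /h; field.
by apply: lerD; rewrite ler_pM2l.
Qed.

(** A polynomial weight that is largest at [x = y]: its powers concentrate
    there. *)
Definition kappa x y : R := 1 + \sum_k coord k x * coord k y.

Lemma kappaE x y : kappa x y = 2 - S2dist x y ^+ 2 / 2.
Proof.
rewrite S2dist_sqr /kappa; have := sum_sqr_coord x; have := sum_sqr_coord y.
rewrite !sum3 => hy hx.
transitivity (1 + (coord 0 x ^+ 2 + coord 1 x ^+ 2 + coord 2 x ^+ 2) / 2
  + (coord 0 y ^+ 2 + coord 1 y ^+ 2 + coord 2 y ^+ 2) / 2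
  - ((coord 0 x - coord 0 y) ^+ 2 + (coord 1 x - coord 1 y) ^+ 2 +
     (coord 2 x - coord 2 y) ^+ 2) / 2); first by field.
by rewrite hx hy; field.
Qed.

Lemma kappa_ge0 x y : 0 <= kappa x y.
Proof.
rewrite /kappa -[1]divr1; have := sum_sqr_coord x; have := sum_sqr_coord y.
rewrite !sum3 => hy hx.
suff -> : 1 / 1 + (coord 0 x * coord 0 y + coord 1 x * coord 1 y + coord 2 x * coord 2 y) =
  ((coord 0 x + coord 0 y) ^+ 2 + (coord 1 x + coord 1 y) ^+ 2 +
     (coord 2 x + coord 2 y) ^+ 2) / 2.
  by rewrite divr_ge0// !addr_ge0// sqr_ge0.
transitivity ((coord 0 x ^+ 2 + coord 1 x ^+ 2 + coord 2 x ^+ 2) / 2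
  + (coord 0 y ^+ 2 + coord 1 y ^+ 2 + coord 2 y ^+ 2) / 2
  + (coord 0 x * coord 0 y + coord 1 x * coord 1 y + coord 2 x * coord 2 y)).
  by rewrite hx hy; field.
by field.
Qed.

Lemma S2dist_le2 x y : S2dist x y <= 2.
Proof.
have := kappa_ge0 x y; rewrite kappaE subr_ge0 ler_pdivrMr// => h.
by rewrite -(ler_pXn2r (n := 2)) ?nnegrE ?S2dist_ge0// (le_trans h)// expr2.
Qed.

Section Shepard.
Variables (f : S2 R -> R) (k : nat) (s : seq (S2 R)).

(** A weighted mean of the values of [f] on the net [s]; for large [k] only
    the nearby points count. *)
Definition shepard x := (\sum_(y <- s) f y * kappa x y ^+ k) / \sum_(y <- s) kappa x y ^+ k.

Hypothesis dense : forall x, 0 < \sum_(y <- s) kappa x y ^+ k.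

Lemma kappa_continuous y : continuous (kappa^~ y).
Proof.
rewrite (_ : kappa^~ y = fun x => 1 + (coord 0 x * coord 0 y + coord 1 x * coord 1 y + coord 2 x * coord 2 y)).
  move=> x; have c j := @coord_S2_continuous R j x.
  have cc r : continuous_at x (fun _ : S2 R => r : R) by exact: cst_continuous.
  exact: (cvgD (cc 1) (cvgD (cvgD (cvgM (c 0) (cc _)) (cvgM (c 1) (cc _)))
    (cvgM (c 2) (cc _)))).
by apply/funext => x; rewrite /kappa sum3.
Qed.

Lemma continuous_sum (I : Type) (r : seq I) (F : I -> S2 R -> R) :
  (forall i, continuous (F i)) -> continuous (fun x => \sum_(i <- r) F i x).
Proof.
move=> cF; elim: r => [|i r ih] x.
  by rewrite (_ : (fun _ => _) = cst 0); [exact: cst_continuous | apply/funext => z; rewrite big_nil].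
rewrite (_ : (fun _ => _) = fun x => F i x + \sum_(j <- r) F j x).
  exact: (cvgD (cF i x) (ih x)).
by apply/funext => z; rewrite big_cons.
Qed.

Lemma continuous_pow (F : S2 R -> R) n : continuous F -> continuous (fun x => F x ^+ n).
Proof.
move=> cF; elim: n => [|n ih] x.
  by rewrite (_ : (fun _ => _) = cst 1); [exact: cst_continuous | apply/funext => z; rewrite expr0].
rewrite (_ : (fun _ => _) = fun x => F x * F x ^+ n).
  exact: (cvgM (cF x) (ih x)).
by apply/funext => z; rewrite exprS.
Qed.

Lemma continuous_shepard : continuous shepard.
Proof.
have c y : continuous (fun x => kappa x y ^+ k).
  by apply: continuous_pow; exact: kappa_continuous.
have cn : continuous (fun x => \sum_(y <- s) f y * kappa x y ^+ k).
  apply: (@continuous_sum _ s (fun y x => f y * kappa x y ^+ k)) => y z.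
  exact: (cvgM (@cst_continuous _ _ (f y) z) (c y z)).
have cd := @continuous_sum _ s (fun y x => kappa x y ^+ k) c.
move=> x; have d0 : \sum_(y <- s) kappa x y ^+ k != 0 by rewrite gt_eqF.
exact: (cvgM (cn x) (cvgV d0 (cd x))).
Qed.

Definition kappaE_chart b y : rexpr (R := R) :=
  EAdd (EConst 1) (EAdd (EAdd (EMul (stereoE b 0) (EConst (coord 0 y)))
    (EMul (stereoE b 1) (EConst (coord 1 y)))) (EMul (stereoE b 2) (EConst (coord 2 y)))).

Definition powE n (e : rexpr) : rexpr (R := R) := iter n (EMul e) (EConst 1).

Definition sumE (r : seq (rexpr (R := R))) := foldr EAdd (EConst 0) r.

Lemma evalE_powE n e u : evalE (powE n e) u = evalE e u ^+ n.
Proof. by elim: n => [|n ih] /=; rewrite ?expr0// exprS ih. Qed.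

Lemma evalE_sumE (F : S2 R -> rexpr) r u :
  evalE (sumE (map F r)) u = \sum_(y <- r) evalE (F y) u.
Proof. by elim: r => [|y r ih] /=; rewrite ?big_nil// big_cons ih. Qed.

Lemma regular_powE n e : regular e -> regular (powE n e).
Proof. by move=> re; elim: n. Qed.

Lemma regular_sumE (F : S2 R -> rexpr) r : (forall y, regular (F y)) ->
  regular (sumE (map F r)).
Proof. by move=> rF; elim: r. Qed.

Lemma shepard_chart b : exists2 e, regular e & shepard \o stereo b = evalE e.
Proof.
have rK y : regular (powE k (kappaE_chart b y)).
  by apply: regular_powE; do !split => //; exact: stereo_den_neq0.
have KE y u : evalE (powE k (kappaE_chart b y)) u = kappa (stereo b u) y ^+ k.
  by rewrite evalE_powE /kappa sum3 -!evalE_stereoE.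
exists (EMul (sumE [seq EMul (EConst (f y)) (powE k (kappaE_chart b y)) | y <- s])
   (EInv (sumE [seq powE k (kappaE_chart b y) | y <- s]))).
  split; first by apply: regular_sumE => y; split.
  split; first exact: regular_sumE.
  move=> u; rewrite evalE_sumE; under eq_bigr do rewrite KE.
  by rewrite gt_eqF.
apply/funext => u /=; rewrite !evalE_sumE /shepard.
by congr (_ / _); apply: eq_bigr => y _; rewrite /= KE.
Qed.

End Shepard.

(** Points of the net within [r] contribute at most [L * r]. The others have
    weight at most [A ^+ k], which is negligible compared with the weight [B
    ^+ k] of a point of the net at distance at most [r / 2]. *)
Lemma shepard_approx (f : S2 R -> R) (L eta : R) : 0 <= L -> 0 < eta ->
  (forall x y, `|f x - f y| <= L * S2dist x y) ->
  exists k s, (forall x, 0 < \sum_(y <- s) kappa x y ^+ k) /\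
    forall x, `|f x - shepard f k s x| <= eta.
Proof.
move=> L0 eta0 lip.
pose r := eta / (2 * L + 2 + eta).
have den0 : 0 < 2 * L + 2 + eta by lra.
have r0 : 0 < r by rewrite divr_gt0.
have r1 : r <= 1 by rewrite ler_pdivrMr// mul1r; lra.
have Lr : L * r <= eta / 2.
  rewrite /r mulrA ler_pdivrMr//.
  have -> : eta / 2 * (2 * L + 2 + eta) = L * eta + eta + eta * eta / 2 by field.
  by have := mulr_gt0 eta0 eta0; lra.
have [s net] := finite_net (divr_gt0 r0 (ltr0Sn R 1)).
pose A : R := 2 - r ^+ 2 / 2; pose B : R := 2 - (r / 2) ^+ 2 / 2.
have A0 : 0 < A by rewrite /A; nra.
have AB : A < B by rewrite /A /B; nra.
have B0 : 0 < B by exact: lt_trans AB.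
(* the values of f differ by at most 2 * L, the diameter being 2 *)
pose M : R := (size s)%:R * (2 * L) + 1.
have M0 : 0 < M by rewrite ltr_wpDl// !mulr_ge0.
have [k hk] : exists k, M * (A / B) ^+ k <= eta / 2.
  have q1 : `|A / B| < 1 by rewrite ger0_norm ?divr_ge0 ?ltW// ltr_pdivrMr// mul1r.
  have /cvgrPdist_le /(_ (eta / 2 / M)) := cvg_expr q1.
  rewrite !divr_gt0// => /(_ isT) [k _ /(_ k (leqnn k))] /=.
  rewrite sub0r normrN ger0_norm ?exprn_ge0 ?divr_ge0 ?(ltW A0) ?(ltW B0)// => h.
  by exists k; rewrite mulrC -ler_pdivlMr.
have lower x : B ^+ k <= \sum_(y <- s) kappa x y ^+ k.
  have [y ys yr] := net x.
  rewrite (big_rem y ys) /= -[leLHS]addr0 lerD ?sumr_ge0//; last first.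
    by move=> z _; rewrite exprn_ge0// kappa_ge0.
  rewrite lerXn2r ?nnegrE ?kappa_ge0 ?(ltW B0)// kappaE lerB// ler_pM2r// lerXn2r//.
    by rewrite nnegrE S2dist_ge0.
  by rewrite nnegrE divr_ge0// ltW.
have pos x : 0 < \sum_(y <- s) kappa x y ^+ k.
  by rewrite (lt_le_trans _ (lower x))// exprn_gt0.
exists k, s; split => // x.
have -> : f x - shepard f k s x =
   (\sum_(y <- s) (f x - f y) * kappa x y ^+ k) / \sum_(y <- s) kappa x y ^+ k.
  under eq_bigr do rewrite mulrBl.
  rewrite big_split /= sumrN -mulr_sumr mulrDl mulNr mulfK//.
  by rewrite gt_eqF.
rewrite normrM normfV (gtr0_norm (pos x)) ler_pdivrMr//.
rewrite (le_trans (ler_norm_sum _ _ _))//.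
apply: (@le_trans _ _ (\sum_(y <- s) (eta / 2 * kappa x y ^+ k + 2 * L * A ^+ k))).
  apply: ler_sum => y _; rewrite normrM (ger0_norm (exprn_ge0 _ (kappa_ge0 _ _))).
  have [near|far] := leP (S2dist x y) r.
    rewrite -[leLHS]addr0 lerD//; last by rewrite !mulr_ge0// exprn_ge0// ltW.
    rewrite ler_wpM2r ?exprn_ge0 ?kappa_ge0// (le_trans (lip _ _))//.
    by rewrite (le_trans _ Lr)// ler_wpM2l.
  rewrite -[leLHS]add0r lerD//; first by rewrite !mulr_ge0 ?exprn_ge0 ?kappa_ge0 ?ltW// divr_gt0.
  apply: ler_pM => //; first by rewrite exprn_ge0// kappa_ge0.
    by rewrite (le_trans (lip _ _))// mulrC ler_wpM2r// S2dist_le2.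
  rewrite lerXn2r ?nnegrE ?kappa_ge0 ?(ltW A0)// kappaE lerB// ler_pM2r//.
  by rewrite lerXn2r ?nnegrE ?S2dist_ge0 ?(ltW r0) ?(ltW far).
rewrite big_split /= -mulr_sumr big_const_seq count_predT iter_addr_0.
have : M * A ^+ k <= eta / 2 * B ^+ k.
  move: hk; rewrite expr_div_n mulrA ler_pdivrMr ?exprn_gt0//.
have := lower x.
set S := \sum_(y <- s) _; move=> lowS hM.
have hS : eta / 2 * B ^+ k <= eta / 2 * S by rewrite ler_pM2l// divr_gt0.
have : (2 * L * A ^+ k) *+ size s <= M * A ^+ k.
  rewrite -mulr_natr [leLHS]mulrC mulrA ler_pM2r ?exprn_gt0// /M.
  by rewrite lerDl.
have -> : eta * S = eta / 2 * S + eta / 2 * S by field.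
by move=> h; rewrite lerD2l (le_trans h)// (le_trans hM).
Qed.

Lemma coord_le1 j x : `|coord j x| <= 1.
Proof.
rewrite -(ler_pXn2r (n := 2)) ?nnegrE// real_normK ?num_real// expr1n.
rewrite -(sum_sqr_coord x) (bigD1 j)//= lerDl sumr_ge0// => i _; exact: sqr_ge0.
Qed.

Lemma morse_dense (f : S2 R -> R) (L eta : R) : 0 <= L -> 0 < eta ->
  (forall x y, `|f x - f y| <= L * S2dist x y) ->
  exists g, [/\ continuous g, morse g & forall x, `|f x - g x| <= eta].
Proof.
move=> L0 eta0 lip.
have eta2 : 0 < eta / 2 by rewrite divr_gt0.
have [k [s [pos fg]]] := shepard_approx L0 eta2 lip.
have [//|a [ar mg]] := @morse_perturbation R (shepard f k s) (eta / 6) _ (shepard_chart f pos).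
  by rewrite divr_gt0.
exists (fun x => shepard f k s x + \sum_j a j * coord j x); split => //.
  have ca : continuous (fun x => \sum_j a j * coord j x).
    apply: (@continuous_sum _ _ (fun j x => a j * coord j x)) => j y.
    exact: (cvgM (@cst_continuous _ _ (a j) y) (@coord_S2_continuous R j y)).
  by move=> x; exact: (cvgD (@continuous_shepard f k s pos x) (ca x)).
move=> x; rewrite opprD addrA (le_trans (ler_normB _ _))//.
have -> : eta = eta / 2 + eta / 2 by field.
rewrite lerD// (le_trans (ler_norm_sum _ _ _))// sum3.
have b j : `|a j * coord j x| <= eta / 6.
  rewrite normrM -[leRHS]mulr1; apply: ler_pM => //; exact: coord_le1.
have := b 0; have := b 1; have := b 2; lra.
Qed.

End MorseDensity.

(** * The normalised area as a plane integral *)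

Section NuMeasure.
Context {R : realType}.
Local Notation mu := (@lebesgue_measure R).
Local Notation RR := (measurableTypeR R * measurableTypeR R)%type.
Implicit Types (A B : set (S2 R)).

Definition sphz (z : R * R) : S2 R := sph z.1 z.2.

(** Measurability is tested in spherical coordinates, since [nu] is an
    integral there. *)
Definition Smeasurable A := measurable (sphz @^-1` A : set RR).

(** An open set is a countable union of boxes with rational corners. *)
Lemma open_measurable2 (O : set (R * R)) : open O -> measurable (O : set RR).
Proof.
move=> oO.
pose box (q : (rat * rat) * (rat * rat)) : set RR :=
  `]ratr q.1.1, ratr q.1.2[%classic `*` `]ratr q.2.1, ratr q.2.2[%classic.
pose F q : set RR := if `[< box q `<=` O >] then box q else set0.
have -> : O = \bigcup_q F q.
  apply/seteqP; split => [[x y] Oxy|z [q _]]; last first.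
    by rewrite /F; case: asboolP => // h /h.
  move: oO; rewrite openE => /(_ _ Oxy); rewrite /interior.
  move=> [[A B] /= [/nbhs_ballP[e1 /= e10 h1] /nbhs_ballP[e2 /= e20 h2]] AB].
  have rat_between (a b : R) : a < b -> exists q : rat, a < ratr q < b.
    by move=> /rat_in_itvoo[q]; rewrite in_itv /=; exists q.
  have [a1 /andP[a1x a1x']] : exists q : rat, x - e1 < ratr q < x.
    by apply: rat_between; rewrite ltrBlDr ltrDl.
  have [b1 /andP[b1x b1x']] : exists q : rat, x < ratr q < x + e1.
    by apply: rat_between; rewrite ltrDl.
  have [a2 /andP[a2y a2y']] : exists q : rat, y - e2 < ratr q < y.
    by apply: rat_between; rewrite ltrBlDr ltrDl.
  have [b2 /andP[b2y b2y']] : exists q : rat, y < ratr q < y + e2.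
    by apply: rat_between; rewrite ltrDl.
  exists ((a1, b1), (a2, b2)) => //; rewrite /F asboolT.
    by split; rewrite /= in_itv /=; apply/andP.
  move=> [u v] [/=]; rewrite !in_itv /= => /andP[u1 u2] /andP[v1 v2]; apply: AB; split => /=.
    by apply: h1; rewrite /ball /= ltr_norml; apply/andP; split; lra.
  by apply: h2; rewrite /ball /= ltr_norml; apply/andP; split; lra.
apply: countable_bigcupT_measurable => [|q]; first exact: countableP.
rewrite /F; case: ifP => // _.
by apply: measurableX; exact: measurable_itv.
Qed.

Lemma open_Smeasurable A : open A -> Smeasurable A.
Proof.
move=> oA; apply: open_measurable2; apply: open_comp => //.
by move=> z _; exact: sph_continuous2.
Qed.

Lemma SmeasurableC A : Smeasurable A -> Smeasurable (~` A).
Proof. by move=> mA; rewrite /Smeasurable preimage_setC; exact: measurableC. Qed.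

Lemma SmeasurableI A B : Smeasurable A -> Smeasurable B -> Smeasurable (A `&` B).
Proof. by move=> mA mB; rewrite /Smeasurable preimage_setI; exact: measurableI. Qed.

Lemma SmeasurableU A B : Smeasurable A -> Smeasurable B -> Smeasurable (A `|` B).
Proof. by move=> mA mB; rewrite /Smeasurable preimage_setU; exact: measurableU. Qed.

(** The density lives on the open rectangle, on which spherical coordinates
    are injective; the boundary has measure zero. *)
Definition polar_density (z : R * R) : R :=
  sin z.1 * \1_(`]0, pi[ : set R) z.1 * \1_(`]0, (2 * pi)[ : set R) z.2.

Lemma polar_density_ge0 z : 0 <= polar_density z.
Proof.
rewrite /polar_density !indicE; case: (boolP (z.1 \in _)) => [|_]; last by rewrite mulr0 mul0r.
rewrite inE /= in_itv /= => h; rewrite mulr1 mulr_ge0//.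
by rewrite ltW// sin_gt0_pi.
Qed.

Lemma measurable_polar_density : measurable_fun (setT : set RR) (fun z : RR => polar_density z).
Proof.
have ms : measurable_fun setT (@sin R).
  by apply: continuous_measurable_fun; exact: continuous_sin.
apply: measurable_funM; first apply: measurable_funM.
- exact: (measurableT_comp ms measurable_fst).
- have mi : measurable_fun setT (\1_(`]0, pi[ : set (measurableTypeR R)) : _ -> R).
    by apply: measurable_indic; exact: measurable_itv.
  exact: (measurableT_comp mi measurable_fst).
- have mi : measurable_fun setT (\1_(`]0, (2 * pi)[ : set (measurableTypeR R)) : _ -> R).
    by apply: measurable_indic; exact: measurable_itv.
  exact: (measurableT_comp mi measurable_snd).
Qed.

Definition mass A : \bar R := (\int[mu \x mu]_z (polar_density z * \1_A (sphz z))%:E)%E.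


Lemma mass_integrand_ge0 A z : (0 <= (polar_density z * \1_A (sphz z))%:E)%E.
Proof. by rewrite lee_fin mulr_ge0 ?polar_density_ge0// indicE. Qed.

Lemma measurable_mass_integrand A : Smeasurable A ->
  measurable_fun (setT : set RR) (fun z : RR => (polar_density z * \1_A (sphz z))%:E).
Proof.
move=> mA; apply/measurable_EFinP; apply: measurable_funM; first exact: measurable_polar_density.
rewrite (_ : (fun z => _) = \1_(sphz @^-1` A)); first exact: measurable_indic.
by apply/funext => z; rewrite !indicE; congr (_%:R); apply/idP/idP; rewrite !inE.
Qed.

Lemma nu_mass A : Smeasurable A -> nu A = (((4 * pi)^-1)%:E * mass A)%E.
Proof.
move=> mA; rewrite /nu /mass; congr (_ * _)%E.
pose f (z : RR) : \bar R := (polar_density z * \1_A (sphz z))%:E.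
have mf : measurable_fun setT f := measurable_mass_integrand mA.
have f0 z : (0 <= f z)%E by exact: mass_integrand_ge0.
rewrite (fubini_tonelli1 _ mf f0).
pose G (x : R) := (\int[mu]_(y in `[0%R, (2 * pi)%R]) (sin x * \1_A (sph x y))%:E)%E.
have secf (x : R) : measurable_fun setT (fun y : R => \1_A (sph x y) : R).
  rewrite (_ : (fun y => _) = (\1_(sphz @^-1` A) : RR -> R) \o pair x).
    apply: measurableT_comp; first exact: measurable_indic.
    exact: pair1_measurable.
  by apply/funext => y; rewrite /= !indicE; congr (_%:R); apply/idP/idP; rewrite !inE.
have GF (x : R) : x \in `]0, pi[ -> G x = fubini_F mu f x.
  move=> xin; rewrite /G integral_itv_bndoo; last first.
    apply/measurable_EFinP; apply: measurable_funM; first exact: measurable_cst.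
    apply: measurable_funTS; exact: secf.
  rewrite integral_mkcond; apply: eq_integral => y _.
  have xin' : x \in (`]0, pi[%classic : set R) by rewrite inE.
  rewrite /f /polar_density /patch /= !indicE xin'.
  case: ifPn => yin; first by rewrite !mulr1.
  by rewrite mulr0 mul0r.
have mG : measurable_fun `]0, pi[ G.
  apply: (eq_measurable_fun (fubini_F mu f)) => [x|].
    by rewrite inE => xin; rewrite GF.
  apply: measurable_funTS; exact: (measurable_fun_fubini_tonelli_F _ mf f0).
transitivity (\int[mu]_(x in `]0%R, (pi : R)[) G x)%E; first exact: integral_itv_bndoo.
rewrite integral_mkcond; apply: eq_integral => x _.
rewrite /patch; case: ifPn => xin; first by rewrite inE in xin; exact: GF.
rewrite /fubini_F integral0_eq// => y _.
by rewrite /f /polar_density !indicE (negbTE xin) mulr0 !mul0r.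
Qed.

Lemma mass_ge0 A : (0 <= mass A)%E.
Proof. by apply: integral_ge0 => z _; exact: mass_integrand_ge0. Qed.

Lemma mass_le A B : Smeasurable A -> Smeasurable B -> A `<=` B -> (mass A <= mass B)%E.
Proof.
move=> mA mB AB; apply: ge0_le_integral => //.
- by move=> z _; exact: mass_integrand_ge0.
- exact: measurable_mass_integrand.
- exact: measurable_mass_integrand.
move=> z _; rewrite lee_fin ler_wpM2l ?polar_density_ge0// !indicE ler_nat.
by case: (boolP (_ \in A)) => //; rewrite inE => /AB h; rewrite mem_set.
Qed.

Lemma massU A B : Smeasurable A -> Smeasurable B -> A `&` B = set0 ->
  mass (A `|` B) = (mass A + mass B)%E.
Proof.
move=> mA mB AB; rewrite /mass -ge0_integralD//; first last.
- exact: measurable_mass_integrand.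
- by move=> z _; exact: mass_integrand_ge0.
- exact: measurable_mass_integrand.
- by move=> z _; exact: mass_integrand_ge0.
apply: eq_integral => z _; rewrite -EFinD -mulrDr; congr (_ * _)%:E.
rewrite !indicE in_setU; case: (boolP (_ \in A)) => zA; case: (boolP (_ \in B)) => zB;
  rewrite /= ?addr0 ?add0r//.
by have : (A `&` B) (sphz z) ; [by split; apply/set_mem|rewrite AB].
Qed.

(** Continuity from below, by monotone convergence. *)
Lemma mass_bigcup_le (U : nat -> set (S2 R)) c : (forall n, Smeasurable (U n)) ->
  (forall m n, (m <= n)%N -> U m `<=` U n) ->
  (forall n, mass (U n) <= c)%E -> (mass (\bigcup_n U n) <= c)%E.
Proof.
move=> mU ndU Uc.
pose g n (z : RR) : \bar R := (polar_density z * \1_(U n) (sphz z))%:E.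
have -> : mass (\bigcup_n U n) = (\int[mu \x mu]_z limn (g ^~ z))%E.
  apply: eq_integral => z _; apply/esym/cvg_lim => //.
  have [[n _ Un]|nU] := pselect ((\bigcup_n U n) (sphz z)).
    apply: cvg_near_cst; exists n => // k /= nk.
    by rewrite /g !indicE !mem_set//; [exists n|exact: ndU nk _ Un].
  apply: cvg_near_cst; exists 0%N => // k _.
  rewrite /g !indicE !memNset// => Uk; apply: nU; by exists k.
rewrite monotone_convergence//.
- apply: lime_le.
    apply: ereal_nondecreasing_is_cvgn => m n mn; exact: mass_le (ndU _ _ mn).
  by apply: nearW => n; exact: Uc.
- by move=> n; exact: measurable_mass_integrand.
- by move=> n z _; exact: mass_integrand_ge0.
- move=> z _ m n mn; rewrite lee_fin ler_wpM2l ?polar_density_ge0// !indicE ler_nat.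
  by case: (boolP (_ \in U m)) => //; rewrite inE => /(ndU _ _ mn) h; rewrite mem_set.
Qed.

(** The polar density on a closed rectangle of coordinates. *)
Definition rect_dens (a b c d : R) (z : R * R) : R :=
  sin z.1 * \1_(`[a, b] : set R) z.1 * \1_(`[c, d] : set R) z.2.

Lemma measurable_rect_dens a b c d : measurable_fun (setT : set RR) (fun z : RR => rect_dens a b c d z).
Proof.
have ms : measurable_fun setT (@sin R).
  by apply: continuous_measurable_fun; exact: continuous_sin.
have mi x y : measurable_fun setT (\1_(`[x, y] : set (measurableTypeR R)) : _ -> R).
  by apply: measurable_indic; exact: measurable_itv.
apply: measurable_funM; first apply: measurable_funM.
- exact: (measurableT_comp ms measurable_fst).
- exact: (measurableT_comp (mi a b) measurable_fst).
- exact: (measurableT_comp (mi c d) measurable_snd).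
Qed.

Lemma sin_ge0_in a b (x : R) : 0 <= a -> b <= pi -> x \in `[a, b] -> 0 <= sin x.
Proof.
rewrite in_itv /= => a0 bp /andP[ax xb].
by apply: sin_ge0_pi; rewrite (le_trans a0 ax) (le_trans xb bp).
Qed.

Lemma rect_dens_ge0 a b c d z : 0 <= a -> b <= pi -> 0 <= rect_dens a b c d z.
Proof.
move=> a0 bp; rewrite /rect_dens !indicE mulr_ge0//.
case: (boolP (z.1 \in _)) => [|_]; last by rewrite mulr0.
by rewrite inE => /(sin_ge0_in a0 bp) h; rewrite mulr1.
Qed.

Lemma integral_sin a b : a < b ->
  (\int[mu]_(x in `[a, b]) (sin x)%:E)%E = (cos a - cos b)%:E.
Proof.
move=> ab; have d (x : R) : is_derive x 1 (fun y => - cos y : R) (sin x).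
  by have := is_deriveN (is_derive_cos x); rewrite opprK.
rewrite (@continuous_FTC2 _ (@sin R) (fun y => - cos y))//.
- by rewrite -EFinB opprK addrC.
- by apply: continuous_subspaceT => x; exact: continuous_sin.
- split => /=.
  + by move=> x _; exact: (@ex_derive _ _ _ _ _ _ _ (d x)).
  + by apply: cvg_at_right_filter; apply: cvgN; exact: continuous_cos.
  + by apply: cvg_at_left_filter; apply: cvgN; exact: continuous_cos.
- by move=> x _; rewrite derive1E; exact: (@derive_val _ _ _ _ _ _ _ (d x)).
Qed.

Lemma integral_rect_dens a b c d : 0 <= a -> a < b -> b <= pi -> c < d ->
  (\int[mu \x mu]_z (rect_dens a b c d z)%:E)%E = ((d - c) * (cos a - cos b))%:E.
Proof.
move=> a0 ab bp cd.
have mf : measurable_fun setT (fun z : RR => (rect_dens a b c d z)%:E).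
  by apply/measurable_EFinP; exact: measurable_rect_dens.
rewrite (fubini_tonelli1 _ mf); last by move=> z; rewrite lee_fin rect_dens_ge0.
transitivity (\int[mu]_(x in `[a, b]) ((d - c)%:E * (sin x)%:E))%E.
  rewrite [RHS]integral_mkcond; apply: eq_integral => x _; rewrite /fubini_F /patch.
  case: ifPn => xin; last first.
    rewrite integral0_eq// => y _.
    by rewrite /rect_dens !indicE (negbTE xin) mulr0 mul0r.
  transitivity (\int[mu]_(y in `[c, d]) (sin x)%:E)%E.
    rewrite [RHS]integral_mkcond; apply: eq_integral => y _; rewrite /rect_dens /patch !indicE xin /= mulr1.
    by case: ifPn => _; rewrite ?mulr1 ?mulr0.
  rewrite integral_cst//= lebesgue_measure_itv /= lte_fin cd -EFinB.
  by rewrite muleC.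
rewrite ge0_integralZl//.
- by rewrite integral_sin// EFinM.
- apply/measurable_EFinP; apply: measurable_funTS.
  by apply: continuous_measurable_fun; exact: continuous_sin.
- by move=> x /(sin_ge0_in a0 bp); rewrite lee_fin.
- by rewrite lee_fin subr_ge0 ltW.
Qed.

End NuMeasure.

(** * Topology of the sphere and of the closed cells *)

Lemma near_continuous {R : realType} (T : topologicalType) (h : T -> R) (x : T) (e : R) :
  continuous h -> 0 < e -> \forall y \near x, `|h x - h y| < e.
Proof. by move=> hc e0; have /cvgrPdist_lt := hc x; apply. Qed.

Lemma continuous_near {R : realType} (T : topologicalType) (h : T -> R) :
  (forall x e, 0 < e -> \forall y \near x, `|h x - h y| < e) -> continuous h.
Proof. by move=> hc x; apply/cvgrPdist_lt => e e0; exact: hc. Qed.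

Section SphereTopology.
Context {R : realType}.
Implicit Types (x y : S2 R).

Lemma S2_hausdorff : hausdorff_space (S2 R).
Proof.
rewrite open_hausdorff => x y xy.
have [k kxy] : exists k, coord k x != coord k y.
  apply: contrapT => /forallNP h; move/eqP: xy; apply; apply: coord_inj => k.
  by have /negP := h k; rewrite negbK => /eqP.
wlog lt : x y xy kxy / coord k x < coord k y.
  move=> h; have [lt|gt|e] := ltgtP (coord k x) (coord k y); last by rewrite e eqxx in kxy.
    exact: h.
  have [||[A B] [xA yB] [oA oB AB]] := h y x _ _ gt; rewrite 1?eq_sym//.
  by exists (B, A) => //; split => //; rewrite setIC.
pose m := (coord k x + coord k y) / 2.
exists (coord k @^-1` [set t | t < m], coord k @^-1` [set t | m < t]) => /=.
  by split; apply/mem_set; rewrite /= /m; lra.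
split.
- by apply: open_comp; [move=> z _; exact: coord_S2_continuous|exact: open_lt].
- by apply: open_comp; [move=> z _; exact: coord_S2_continuous|exact: open_gt].
- apply/eqP/seteqP; split => // z [/= a b]; lra.
Qed.

Lemma sph_rect_compact (a b c d : R) :
  compact [set sphz z | z in `[a, b]%classic `*` `[c, d]%classic].
Proof.
apply: continuous_compact; last by apply: compact_setX; exact: segment_compact.
by apply: continuous_subspaceT; exact: sph_continuous2.
Qed.

Lemma S2_compact : compact [set: S2 R].
Proof.
have -> : [set: S2 R] = [set sphz z | z in `[0, pi]%classic `*` `[0, 2 * pi]%classic].
  apply/seteqP; split => // x _; have [p [t [hp ht ->]]] := sph_surj x.
  by exists (p, t) => //; split; rewrite /= in_itv.
exact: sph_rect_compact.
Qed.

Lemma nbhs_S2dist x (U : set (S2 R)) : nbhs x U ->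
  exists2 d : R, 0 < d & forall y, S2dist x y < d -> U y.
Proof.
move=> [_ [[W oW <-] Wx WU]]; move: oW; rewrite openE => /(_ _ Wx).
rewrite /interior => /nbhs_ballP[e /= e0 eW]; exists e => // y xy.
apply: WU; apply: eW; split => // i k; rewrite (ord1 i) /ball /=.
apply: le_lt_trans xy.
rewrite -(ler_pXn2r (n := 2)) ?nnegrE ?S2dist_ge0// real_normK ?num_real// S2dist_sqr.
by rewrite (bigD1 k)//= lerDl sumr_ge0// => j _; exact: sqr_ge0.
Qed.

Lemma S2dist_nbhs x (d : R) : 0 < d -> nbhs x [set y | S2dist x y < d].
Proof.
move=> d0; pose e := d / 2; have e0 : 0 < e by rewrite divr_gt0.
have h k : \forall y \near x, `|coord k x - coord k y| < e.
  by apply: near_continuous => //; exact: coord_S2_continuous.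
near=> y; rewrite /= -(ltr_pXn2r (n := 2)) ?nnegrE ?S2dist_ge0 ?(ltW d0)// S2dist_sqr sum3.
have sq k : `|coord k x - coord k y| < e -> (coord k x - coord k y) ^+ 2 <= e ^+ 2.
  by move=> /ltW le; rewrite -(real_normK (num_real (_ - _))) lerXn2r// nnegrE ltW.
have s0 : (coord 0 x - coord 0 y) ^+ 2 <= e ^+ 2 by apply: sq; near: y; exact: h.
have s1 : (coord 1 x - coord 1 y) ^+ 2 <= e ^+ 2 by apply: sq; near: y; exact: h.
have s2 : (coord 2 x - coord 2 y) ^+ 2 <= e ^+ 2 by apply: sq; near: y; exact: h.
have e4 : d ^+ 2 = 4 * e ^+ 2 by rewrite /e; field.
have ep : 0 < e ^+ 2 by rewrite exprn_gt0.
by rewrite e4; lra.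
Unshelve. all: by end_near. Qed.

Lemma lipschitz_continuous (f : S2 R -> R) (L : R) : 0 <= L ->
  (forall x y, `|f x - f y| <= L * S2dist x y) -> continuous f.
Proof.
move=> L0 lip; apply: continuous_near => x e e0.
have d0 : 0 < e / (L + 1) by rewrite divr_gt0// ltr_wpDl.
near=> y; apply: le_lt_trans (lip x y) _.
have : S2dist x y < e / (L + 1) by near: y; exact: S2dist_nbhs.
rewrite ltr_pdivlMr ?ltr_wpDl// => h; apply: le_lt_trans h.
by rewrite mulrDr mulr1 mulrC lerDl S2dist_ge0.
Unshelve. all: by end_near. Qed.

End SphereTopology.

Section Cells.
Context {R : realType}.
Variable M : nat.
Local Notation N := M.+1.
Local Notation V := ('I_M.+1 * 'I_M.+1)%type.
Local Notation gadj := (nadj (@grid_nbs M)).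

Definition mesh (i : nat) : R := i%:R * pi / N%:R.

Lemma mesh0 : mesh 0 = 0. Proof. by rewrite /mesh !mul0r. Qed.
Lemma meshN : mesh N = pi. Proof. by rewrite /mesh mulrAC divff ?mul1r. Qed.
Lemma mesh_lt i j : (mesh i < mesh j) = (i < j)%N.
Proof. by rewrite /mesh -!mulrA ltr_pM2r ?divr_gt0 ?pi_gt0// ltr_nat. Qed.
Lemma mesh_le i j : (mesh i <= mesh j) = (i <= j)%N.
Proof. by rewrite leNgt mesh_lt -leqNgt. Qed.
Lemma meshS i : mesh i.+1 = mesh i + pi / N%:R.
Proof. by rewrite /mesh -(@natr1 R i) mulrDl mul1r mulrDl. Qed.
Lemma mesh_ge0 i : 0 <= mesh i. Proof. by rewrite -mesh0 mesh_le. Qed.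
Lemma mesh_lepi i : (i <= N)%N -> mesh i <= pi. Proof. by rewrite -meshN mesh_le. Qed.

Definition in_cell (v : V) (z : R * R) : Prop :=
  mesh v.1 <= z.1 <= mesh v.1.+1 /\ 2 * mesh v.2 <= z.2 <= 2 * mesh v.2.+1.

Definition cell_set (v : V) : set (S2 R) := [set sphz z | z in in_cell v].

Lemma mesh_index (t : R) : 0 <= t <= pi -> exists i : 'I_N, mesh i <= t <= mesh i.+1.
Proof.
move=> /andP[t0 tp]; have [tlt|tge] := ltP t pi; last first.
  by exists ord_max; rewrite /= meshN tp (le_trans _ tge)// mesh_lepi.
pose q := t / (pi / N%:R).
have pn : 0 < pi / N%:R :> R by rewrite divr_gt0 ?pi_gt0.
have q0 : 0 <= q by rewrite divr_ge0// ltW.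
have /andP[a b] := truncn_itv q0.
have qN : (Num.truncn q < N)%N.
  rewrite -(ltr_nat R) (le_lt_trans a)// ltr_pdivrMr//.
  by rewrite mulrCA divff ?mulr1.
exists (Ordinal qN) => /=; rewrite /mesh -!mulrA.
by rewrite -ler_pdivlMr// a -ler_pdivrMr// ltW.
Qed.

Lemma cell_cover x : exists v, cell_set v x.
Proof.
have [p [t [hp /andP[t0 t2] ->]]] := sph_surj x.
have [i hi] := mesh_index hp.
have [|j hj] := @mesh_index (t / 2).
  by rewrite divr_ge0//= ler_pdivrMr// mulrC.
exists (i, j), (p, t) => //; split => //=.
by move: hj; rewrite ler_pdivlMr// ler_pdivrMr// ![_ * 2]mulrC.
Qed.

Lemma cell_setE v : cell_set v =
  [set sphz z | z in `[mesh v.1, mesh v.1.+1]%classic `*` `[2 * mesh v.2, 2 * mesh v.2.+1]%classic].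
Proof.
by congr image; apply/seteqP; split => -[a b] [/= h1 h2]; split; rewrite /= ?in_itv//;
  move: h1 h2; rewrite !in_itv.
Qed.

Lemma cell_closed v : closed (cell_set v).
Proof. rewrite cell_setE; apply: compact_closed; [exact: S2_hausdorff|exact: sph_rect_compact]. Qed.

(** The cell is the union of its meridians, each taken together with the top
    edge so that they all share a point. *)
Lemma cell_connected v : connected (cell_set v).
Proof.
have c1 (t : R) : continuous (fun p : R => sph p t).
  move=> p; apply: (@continuous_comp _ _ _ (fun p => (p, t)) sphz); last exact: sph_continuous2.
  exact: (cvg_pair (f := fun q : R => q) (g := fun=> t) (@cvg_id _ (nbhs p)) (@cst_continuous R R t p)).
have c2 (p : R) : continuous (fun t : R => sph p t).
  move=> t; apply: (@continuous_comp _ _ _ (fun t => (p, t)) sphz); last exact: sph_continuous2.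
  exact: (cvg_pair (f := fun=> p) (g := fun q : R => q) (@cst_continuous R R p t) (@cvg_id _ (nbhs t))).
set a := mesh v.1; set b := mesh v.1.+1; set c := 2 * mesh v.2; set d := 2 * mesh v.2.+1.
have ab : a <= b by rewrite mesh_le.
have cd : c <= d by rewrite ler_pM2l// mesh_le.
pose T (t : R) := [set sph a s | s in `[c, d]] `|` [set sph p t | p in `[a, b]].
have -> : cell_set v = \bigcup_(t in `[c, d]) T t.
  apply/seteqP; split => [_ [[p t] [/= hp ht] <-]|_ [t /= ht [[s hs <-]|[p hp <-]]]].
  - by exists t; rewrite /= ?in_itv//; right; exists p => //=; rewrite in_itv.
  - exists (a, s) => //; split => /=; first by rewrite lexx ab.
    by move: hs; rewrite /= in_itv.
  - by exists (p, t).
apply: bigcup_connected.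
  exists (sph a c) => t ht; left; exists c => //=; by rewrite in_itv /= lexx cd.
move=> t ht; apply: connectedU.
- exists (sph a t); split; first by exists t.
  by exists a => //=; rewrite in_itv /= lexx ab.
- apply: connected_continuous_connected; first exact: segment_connected.
  exact: continuous_subspaceT.
- apply: connected_continuous_connected; first exact: segment_connected.
  exact: continuous_subspaceT.
Qed.

Lemma sph_periodic (p : R) : sph p (2 * pi) = sph p 0.
Proof.
have e : 2 * pi = 0 + pi *+ 2 :> R by rewrite add0r mulr2n; ring.
by apply: eq_sph => //; rewrite e ?(cosD2pi 0) ?(sinD2pi 0).
Qed.

Lemma adj_cells_meet (v w : V) : gadj v w -> cell_set v `&` cell_set w !=set0.
Proof.
rewrite gadjE => /andP[/andP[c1 c2] cc].
have [p [hp1 hp2]] : exists p, mesh v.1 <= p <= mesh v.1.+1 /\ mesh w.1 <= p <= mesh w.1.+1.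
  exists (mesh (maxn v.1 w.1)); rewrite !mesh_le !geq_max !leqnSn leq_maxl leq_maxr.
  by rewrite c1 c2.
case/or3P: cc => [/andP[d1 d2]|/andP[/eqP v0 /eqP wM]|/andP[/eqP vM /eqP w0]].
- have mid (u : 'I_N) : (u <= maxn v.2 w.2 <= u.+1)%N ->
      2 * mesh u <= 2 * mesh (maxn v.2 w.2) <= 2 * mesh u.+1.
    by rewrite !ler_pM2l// !mesh_le.
  exists (sph p (2 * mesh (maxn v.2 w.2))); split.
    by exists (p, 2 * mesh (maxn v.2 w.2)) => //; split => //=; apply: mid; rewrite leq_maxl geq_max leqnSn d2.
  by exists (p, 2 * mesh (maxn v.2 w.2)) => //; split => //=; apply: mid; rewrite leq_maxr geq_max leqnSn d1.
- exists (sph p 0); split.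
    by exists (p, 0) => //; split => //=; rewrite v0 mesh0 mulr0 lexx/= mulr_ge0// mesh_ge0.
  rewrite -sph_periodic; exists (p, 2 * pi) => //; split => //=.
  by rewrite wM meshN lexx andbT ler_pM2l// mesh_lepi.
- exists (sph p 0); split; last first.
    by exists (p, 0) => //; split => //=; rewrite w0 mesh0 mulr0 lexx/= mulr_ge0// mesh_ge0.
  rewrite -sph_periodic; exists (p, 2 * pi) => //; split => //=.
  by rewrite vM meshN lexx andbT ler_pM2l// mesh_lepi.
Qed.

Lemma in_cell_range v z : in_cell v z -> 0 <= z.1 <= pi /\ 0 <= z.2 <= 2 * pi.
Proof.
move=> [/andP[a b] /andP[c d]]; split; apply/andP; split.
- exact: le_trans (mesh_ge0 _) a.
- by apply: (le_trans b); apply: mesh_lepi.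
- by apply: le_trans c; rewrite mulr_ge0// mesh_ge0.
- by apply: (le_trans d); rewrite ler_pM2l// mesh_lepi.
Qed.

Lemma angle_eq (s t : R) : 0 <= s <= 2 * pi -> 0 <= t <= 2 * pi ->
  cos s = cos t -> sin s = sin t -> s = t \/ (s = 0 /\ t = 2 * pi) \/ (s = 2 * pi /\ t = 0).
Proof.
move=> hs ht ct st.
have c1 : cos (s - t) = 1 by rewrite cosB ct st -!expr2 cos2Dsin2.
wlog le : s t hs ht ct st c1 / t <= s.
  move=> h; have [le|/ltW le] := leP t s; first exact: h.
  have [|e|[[-> ->]|[-> ->]]] := h t s ht hs (esym ct) (esym st) _ le.
  - by rewrite -cosN opprB.
  - by left.
  - by right; right.
  - by right; left.
set u := s - t in c1; have u0 : 0 <= u by rewrite subr_ge0.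
have [up|up] := leP u pi.
  left; apply/eqP; rewrite -subr_eq0 -/u; apply/eqP.
  by apply: (@cos_inj R); rewrite ?in_itv /= ?u0 ?up ?lexx ?pi_ge0// c1 cos0.
right; right; have u2 : u <= 2 * pi by rewrite /u; lra.
have : u = 2 * pi.
  apply/eqP; rewrite -subr_eq0 -oppr_eq0 opprB; apply/eqP.
  apply: (@cos_inj R).
  - by rewrite in_itv /=; lra.
  - by rewrite in_itv /= lexx pi_ge0.
  rewrite cos0; have -> : 2 * pi - u = - u + pi *+ 2 by rewrite mulr2n; ring.
  by rewrite (cosD2pi (- u)) cosN.
by rewrite /u; lra.
Qed.

Lemma mesh_close (i j : nat) (t : R) : mesh i <= t <= mesh i.+1 -> mesh j <= t <= mesh j.+1 ->
  close i j.
Proof.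
move=> /andP[a b] /andP[c d]; apply/andP; split.
  by rewrite -mesh_le (le_trans a).
by rewrite -mesh_le (le_trans c).
Qed.

(** Away from the poles spherical coordinates are injective up to a full turn,
    which the cyclic adjacency of columns accounts for; a pole belongs to all
    cells of its row. *)
Lemma meet_cells_adj (v w : V) : cell_set v `&` cell_set w !=set0 ->
  [\/ gadj v w, v.1 = ord0 /\ w.1 = ord0 | v.1 = ord_max /\ w.1 = ord_max].
Proof.
move=> [_ [[[p t] hz <-] [[q s] hz']]] e.
have [/= rp rt] := in_cell_range hz; have [/= rq rs] := in_cell_range hz'.
have [h0 h1 h2] := coord_sph p t; have [k0 k1 k2] := coord_sph q s.
rewrite /sphz /= in e; rewrite -e in h0 h1 h2; rewrite k0 k1 k2 in h0 h1 h2 => {k0 k1 k2 e}.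
have pq : q = p by apply: (@cos_inj R) => //; rewrite in_itv.
subst q; case: hz hz' => [/= vp vt] [/= wp ws].
have row := mesh_close vp wp.
have [sp|sp] := eqVneq (sin p) 0.
  have [p0|p0] := eqVneq p 0.
    constructor 2; subst p.
    have z (u : 'I_N) : mesh u <= 0 -> u = ord0.
      by rewrite -mesh0 mesh_le leqn0 => /eqP u0; exact: val_inj.
    by split; apply: z; [case/andP: vp|case/andP: wp].
  have pp : p = pi.
    apply/eqP; apply: contraTT isT => ppi.
    have : 0 < sin p.
      by apply: sin_gt0_pi; case/andP: rp => a b; rewrite !lt_neqAle a b eq_sym p0 ppi.
    by rewrite sp ltxx.
  constructor 3; subst p.
  have z (u : 'I_N) : pi <= mesh u.+1 -> u = ord_max.
    rewrite -meshN mesh_le ltnS => le; apply: val_inj; apply/eqP.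
    by rewrite eqn_leq le -ltnS ltn_ord.
  by split; apply: z; [case/andP: vp|case/andP: wp].
constructor 1; rewrite gadjE row /=.
have [] := @angle_eq s t rs rt (mulfI sp h0) (mulfI sp h1).
  move=> st; subst s; apply/orP; left.
  apply: (@mesh_close _ _ (t / 2)).
    by rewrite ler_pdivlMr// ler_pdivrMr// ![_ * 2]mulrC.
  by rewrite ler_pdivlMr// ler_pdivrMr// ![_ * 2]mulrC.
have zero (u : 'I_N) : 2 * mesh u <= 0 -> u = 0%N :> nat.
  by rewrite -[X in _ <= X](mulr0 2) ler_pM2l// -mesh0 mesh_le leqn0 => /eqP.
have top (u : 'I_N) : 2 * pi <= 2 * mesh u.+1 -> u = M :> nat.
  rewrite ler_pM2l// -meshN mesh_le ltnS => le; apply/eqP.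
  by rewrite eqn_leq le -ltnS ltn_ord.
case=> [[s0 t2]|[s2 t0]]; subst s t; case/andP: vt => vt1 vt2; case/andP: ws => ws1 ws2.
  by rewrite /cyc_close (top v.2 vt2) (zero w.2 ws1) !eqxx !orbT.
by rewrite /cyc_close (zero v.2 vt1) (top w.2 ws2) !eqxx !orbT.
Qed.

End Cells.

(** * Values of a function on cells and at samples *)

Section Samples.
Context {R : realType}.
Variable M : nat.
Hypothesis M0 : (0 < M)%N.
Local Notation N := M.+1.
Local Notation V := ('I_M.+1 * 'I_M.+1)%type.
Local Notation gadj := (nadj (@grid_nbs M)).
Local Notation root := ((ord0, ord0) : V).

Let piN0 : 0 <= pi / N%:R :> R. Proof. by rewrite divr_ge0 ?pi_ge0. Qed.

Lemma sample_in_cell (v : V) : cell_set v (sample_point v : S2 R).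
Proof.
exists (v.1%:R * pi / M%:R, (2 * v.2)%:R * pi / N%:R) => //; split => /=.
  have h (a b c d : nat) : (0 < b)%N -> (0 < d)%N -> (a * d <= c * b)%N ->
      a%:R * pi / b%:R <= c%:R * pi / d%:R :> R.
    move=> b0 d0 le; rewrite ler_pdivrMr ?ltr0n// mulrAC ler_pdivlMr ?ltr0n//.
    rewrite ![_ * pi * _]mulrAC ler_pM2r ?pi_gt0// -!natrM ler_nat.
    by rewrite [X in (_ <= X)%N]mulnC [X in (_ <= X)%N]mulnC.
  have := ltn_ord v.1; rewrite ltnS => vM.
  by rewrite !h// ?ltnS; nia.
have -> : (2 * v.2)%:R * pi / N%:R = 2 * mesh M v.2 :> R by rewrite natrM /mesh; ring.
by rewrite lexx ler_pM2l// mesh_le leqnSn.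
Qed.

Lemma cell_angles (v : V) (z w : R * R) : in_cell v z -> in_cell v w ->
  `|z.1 - w.1| <= pi / N%:R /\ `|z.2 - w.2| <= 2 * (pi / N%:R).
Proof.
move=> [/andP[a b] /andP[c d]] [/andP[a' b'] /andP[c' d']].
rewrite !meshS in b d b' d'; move: (pi / N%:R : R) (mesh M v.1 : R) (mesh M v.2 : R) a b c d a' b' c' d' => q m n *.
split; rewrite ler_norml; apply/andP; split; lra.
Qed.

(** The constant 4 exceeds the square root of 10 that [S2dist_detour] yields.
    *)
Lemma cell_small (v : V) (x y : S2 R) : cell_set v x -> cell_set v y ->
  S2dist x y <= 4 * (pi / N%:R).
Proof.
move=> [[p t] hz <-] [[q s] hw <-]; have [/= h1 h2] := cell_angles hz hw.
have l1 := le_trans (S2dist_meridian p q t) h1.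
have l2 := le_trans (S2dist_parallel q t s) h2.
rewrite -(ler_pXn2r (n := 2)) ?nnegrE ?S2dist_ge0 ?mulr_ge0 ?pi_ge0//.
apply: (le_trans (S2dist_detour _ (sph q t) _)).
rewrite -(ler_pXn2r (n := 2)) ?nnegrE ?S2dist_ge0// in l1.
rewrite -(ler_pXn2r (n := 2)) ?nnegrE ?S2dist_ge0 ?mulr_ge0 ?pi_ge0// in l2.
rewrite exprMn in l2; rewrite exprMn; have A0 := sqr_ge0 (pi / N%:R : R).
move: (S2dist (sphz (p, t)) _ ^+ 2) (S2dist (sph q t) _ ^+ 2) l1 l2 => B C.
move: (_ ^+ 2) A0 => A; rewrite -!natrX => A0 l1 l2.
lra.
Qed.

Section Lipschitz.
Variables (f : S2 R -> R) (L : R).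
Hypotheses (L0 : 0 <= L) (lip : forall x y, `|f x - f y| <= L * S2dist x y).

Lemma lip_angles (p t q s a b : R) : `|p - q| <= a -> `|t - s| <= b ->
  `|f (sph p t) - f (sph q s)| <= L * (a + b).
Proof.
move=> pa tb; have -> : f (sph p t) - f (sph q s) =
  (f (sph p t) - f (sph q t)) + (f (sph q t) - f (sph q s)) by ring.
apply: (le_trans (ler_normD _ _)); rewrite mulrDr; apply: lerD.
  by rewrite (le_trans (lip _ _))// ler_wpM2l// (le_trans (S2dist_meridian _ _ _)).
by rewrite (le_trans (lip _ _))// ler_wpM2l// (le_trans (S2dist_parallel _ _ _)).
Qed.

Lemma lip_cell (v : V) x y : cell_set v x -> cell_set v y ->
  `|f x - f y| <= L * (3 * (pi / N%:R)).
Proof.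
move=> [[p t] hz <-] [[q s] hw <-]; have [h1 h2] := cell_angles hz hw.
have -> : 3 * (pi / N%:R) = pi / N%:R + 2 * (pi / N%:R) :> R by ring.
exact: lip_angles.
Qed.

(** Samples of neighbours differ by at most [pi / M] in colatitude and [2 * pi
    / N] in longitude, in the latter up to a full turn. *)
Lemma lip_sample (v w : V) : gadj v w ->
  `|value f v - value f w| <= L * (pi / M%:R + 2 * (pi / N%:R)).
Proof.
rewrite gadjE => /andP[/andP[c1 c2] cc]; rewrite /value /sample_point.
have near (a b : nat) (c : R) : 0 <= c -> (a <= b.+1)%N -> (b <= a.+1)%N ->
    `|a%:R * c - b%:R * c| <= c.
  move=> c0 ab ba; rewrite -mulrBl normrM (ger0_norm c0) -[leRHS]mul1r ler_wpM2r//.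
  have ab' : a%:R <= b%:R + 1 :> R by rewrite natr1 ler_nat.
  have ba' : b%:R <= a%:R + 1 :> R by rewrite natr1 ler_nat.
  by rewrite ler_norml; apply/andP; split; lra.
have piM0 : 0 <= pi / M%:R :> R by rewrite divr_ge0 ?pi_ge0.
have rows : `|v.1%:R * pi / M%:R - w.1%:R * pi / M%:R| <= pi / M%:R :> R.
  by rewrite -!mulrA near.
have wrap (p : R) : sph p ((2 * 0)%:R * pi / N%:R) = sph p (N%:R * (2 * (pi / N%:R))).
  rewrite muln0 !mul0r -sph_periodic; congr sph.
  by field; rewrite nat1r pnatr_eq0.
have double (k : nat) : (2 * k)%:R * pi / N%:R = k%:R * (2 * (pi / N%:R)) :> R.
  by rewrite natrM; ring.
have d0 : 0 <= 2 * (pi / N%:R) :> R by rewrite mulr_ge0.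
case/or3P: cc => [/andP[d1 d2]|/andP[/eqP v0 /eqP wM]|/andP[/eqP vM /eqP w0]].
- by apply: lip_angles => //; rewrite !double; exact: near.
- by rewrite v0 wM wrap double; apply: lip_angles; [exact: rows|exact: (near N M _ d0 (leqnn _) (leqW (leqnSn _)))].
- by rewrite vM w0 wrap double; apply: lip_angles; [exact: rows|exact: (near M N _ d0 (leqW (leqnSn _)) (leqnn _))].
Qed.

End Lipschitz.

Lemma value_first_row (f : S2 R -> R) j j' : value f ((ord0, j) : V) = value f ((ord0, j') : V).
Proof.
by rewrite /value /sample_point /= !mul0r; congr f; apply: eq_sph => //; rewrite sin0 !mul0r.
Qed.

Lemma value_last_row (f : S2 R -> R) j j' :
  value f ((ord_max, j) : V) = value f ((ord_max, j') : V).
Proof.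
rewrite /value /sample_point /= mulrAC divff ?mul1r ?pnatr_eq0 -?lt0n//.
by congr f; apply: eq_sph => //; rewrite sinpi !mul0r.
Qed.

Lemma area_ge0 (v : V) : 0 <= area v :> R.
Proof.
rewrite /area subr_ge0 -!/(mesh _ _).
have vN := ltn_ord v.1.
by rewrite leNgt ltr_cos ?in_itv /= ?mesh_ge0 ?mesh_lepi ?mesh_lt -?leNgt// ?ltnNge ?leqnSn// ltnW.
Qed.

Lemma total_areaE : \sum_(v : V) area v = 2 * N%:R :> R.
Proof.
rewrite -(pair_bigA _ (fun i j => area ((i, j) : V))) /=.
transitivity (\sum_(i < N) (cos (i%:R * pi / N%:R) - cos (i.+1%:R * pi / N%:R)) * N%:R : R).
  by apply: eq_bigr => i _; rewrite /area /= sumr_const card_ord [RHS]mulr_natr.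
rewrite -mulr_suml; congr (_ * _).
rewrite -(big_mkord xpredT (fun i => cos (i%:R * pi / N%:R) - cos (i.+1%:R * pi / N%:R) : R)).
rewrite -[LHS]opprK -sumrN; under eq_bigr do rewrite opprB.
rewrite telescope_sumr// mul0r mul0r cos0 mulrAC divff// mul1r cospi; ring.
Qed.

Lemma sin_shift (x : R) : exists s, 0 <= x + s < pi *+ 2 /\ forall y, sin (y + s) = sin y.
Proof.
have p2 : 0 < pi *+ 2 :> R by rewrite mulrn_wgt0 ?pi_gt0.
pose n := (Num.truncn (`|x| / (pi *+ 2))).+1.
have xn : 0 <= x + (pi *+ 2) *+ n.
  have /andP[_ b] := truncn_itv (divr_ge0 (normr_ge0 x) (ltW p2)).
  rewrite ltr_pdivrMr// mulr_natl -/n in b.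
  have := ler_norm (- x); rewrite normrN; move: (_ *+ n) b => c; lra.
have /andP[a b] := truncn_itv (divr_ge0 xn (ltW p2)).
set m := Num.truncn _ in a b.
rewrite ler_pdivlMr// mulr_natl in a; rewrite ltr_pdivrMr// mulr_natl [_ *+ m.+1]mulrS in b.
exists ((pi *+ 2) *+ n - (pi *+ 2) *+ m); split.
  by rewrite addrA subr_ge0 a ltrBlDr.
move=> y; rewrite -(periodicn (@sinD2pi R) m) addrA subrK.
exact: (periodicn (@sinD2pi R)).
Qed.

Lemma sin_lt0_pi (x : R) : pi < x < pi *+ 2 -> sin x < 0.
Proof.
move=> /andP[a b]; have := sinDpi (x - pi); rewrite subrK => ->.
by rewrite oppr_lt0; apply: sin_gt0_pi; rewrite subr_gt0 a ltrBlDr -mulr2n.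
Qed.

(** A step of length at most 1 that does not change the sign of the sine stays
    in the same half period, since half periods with the same sign are at
    distance [pi] from each other. *)
Lemma arc_step (a b : R) : `|a - b| <= 1 -> (0 <= sin a) = (0 <= sin b) ->
  0 <= a <= pi *+ 2 -> (0 <= sin a -> a <= pi) -> (sin a < 0 -> pi < a < pi *+ 2) ->
  [/\ 0 <= b <= pi *+ 2, 0 <= sin b -> b <= pi & sin b < 0 -> pi < b < pi *+ 2].
Proof.
have p2 := pi_ge2 R.
rewrite ler_norml => /andP[l u] ab /andP[a0 a2] ap an.
have [sa|sa] := leP 0 (sin a).
  have sb : 0 <= sin b by rewrite -ab.
  have ap' := ap sa.
  have b0 : 0 <= b.
    rewrite leNgt; apply/negP => b0.
    have : 0 < sin (- b) by apply: sin_gt0_pi; lra.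
    by rewrite sinN oppr_gt0 ltNge sb.
  have bp : b <= pi.
    rewrite leNgt; apply/negP => bp.
    have : sin b < 0 by apply: sin_lt0_pi; lra.
    by rewrite ltNge sb.
  by split => //; [lra|rewrite ltNge sb].
have sb : sin b < 0 by rewrite ltNge -ab -ltNge.
have /andP[ap' ap''] := an sa.
have b0 : pi < b.
  rewrite ltNge; apply/negP => bp.
  have : 0 <= sin b by apply: sin_ge0_pi; lra.
  by rewrite leNgt sb.
have b2 : b < pi *+ 2.
  rewrite ltNge; apply/negP => bp.
  have : 0 <= sin (b - pi *+ 2) by apply: sin_ge0_pi; lra.
  by have := @sinD2pi R (b - pi *+ 2); rewrite subrK => <-; rewrite leNgt sb.
by split => [||_]; [lra|rewrite leNgt sb|lra].
Qed.

End Samples.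

(** * Oscillation on monochromatic components, and measures of sets of cells *)

Section Patches.
Context {R : realType}.
Variable M : nat.
Local Notation N := M.+1.
Local Notation V := ('I_M.+1 * 'I_M.+1)%type.
Local Notation gadj := (nadj (@grid_nbs M)).
Local Notation root := ((ord0, ord0) : V).

(** After a shift that puts the phase of [h] into the first period, the phase
    stays in one half period along a path of a single colour ([arc_step]). *)
Lemma mono_comp_osc (f : S2 R -> R) (e : R) (h v : V) : 0 <= e ->
  (forall u w : V, gadj u w -> value f u - value f w <= e) ->
  v \in mono_comp gadj (colour f e) h -> `|value f v - value f h| <= pi * e.
Proof.
move=> e0 step; rewrite inE => hv.
have col_hv := mono_col hv.
have norm_step u w : gadj u w -> `|value f u - value f w| <= e.
  by move=> uw; rewrite ler_norml step// lerNl opprB step// gadj_sym.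
have [e00|en0] := eqVneq e 0.
  suff -> : value f v = value f h by rewrite subrr normr0 e00 mulr0.
  case/connectP: hv => p + ->; elim: p h {col_hv} => //= w p ih u /andP[/andP[uw _] /ih ->].
  by have := norm_step _ _ uw; rewrite e00 normr_le0 subr_eq0 => /eqP.
have ep : 0 < e by rewrite lt_neqAle eq_sym en0.
pose a (u : V) : R := (value f u - value f root) / e.
have [s [/andP[s0 s2] ss]] := sin_shift (a h).
pose I u := [/\ 0 <= a u + s <= pi *+ 2, 0 <= sin (a u + s) -> a u + s <= pi &
  sin (a u + s) < 0 -> pi < a u + s < pi *+ 2].
have Ih : I h.
  split; first by rewrite s0 ltW.
    move=> sh; rewrite leNgt; apply/negP => hp.
    have : sin (a h + s) < 0 by apply: sin_lt0_pi; rewrite hp s2.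
    by rewrite ltNge sh.
  move=> sh; rewrite s2 andbT ltNge; apply/negP => hp.
  have : 0 <= sin (a h + s) by apply: sin_ge0_pi; rewrite s0 hp.
  by rewrite leNgt sh.
have Iv : I v.
  case/connectP: hv => p + ->; elim: p h Ih {col_hv s0 s2} => //= w p ih u [i1 i2 i3].
  move=> /andP[/andP[uw /eqP c] wp]; apply: (ih w _ wp).
  apply: (@arc_step _ (a u + s)) => //.
    have -> : a u + s - (a w + s) = (value f u - value f w) / e by rewrite /a; field.
    by rewrite normrM normfV (gtr0_norm ep) ler_pdivrMr// mul1r norm_step.
  by rewrite !ss.
have avh : `|a v - a h| <= pi.
  case: Ih Iv => [/andP[h1 h2] h3 h4] [/andP[v1 v2] v3 v4].
  have [sh|sh] := leP 0 (sin (a h + s)).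
    have sv : 0 <= sin (a v + s) by move: sh; rewrite !ss -/(colour f e h) col_hv.
    have := h3 sh; have := v3 sv => *; rewrite ler_norml; apply/andP; split; lra.
  have sv : sin (a v + s) < 0.
    by move: sh; rewrite !ss !ltNge -/(colour f e h) col_hv.
  move: (h4 sh) (v4 sv) => /andP[? ?] /andP[? ?]; rewrite ler_norml; apply/andP; split; lra.
have -> : value f v - value f h = (a v - a h) * e by rewrite /a; field.
by rewrite normrM (gtr0_norm ep) ler_wpM2r.
Qed.

Local Notation mu := (@lebesgue_measure R).
Local Notation RR := (measurableTypeR R * measurableTypeR R)%type.

Lemma sphz_inj_in (z w : R * R) : 0 < z.1 < pi -> 0 < z.2 < 2 * pi ->
  0 <= w.1 <= pi -> 0 <= w.2 <= 2 * pi -> sphz w = sphz z -> w = z.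
Proof.
move: z w => [p t] [q s] /= /andP[p0 pp] /andP[t0 t2] rq rs.
rewrite /sphz /= => e.
have [h0 h1 h2] := coord_sph p t; have [k0 k1 k2] := coord_sph q s.
rewrite e h0 h1 h2 in k0 k1 k2.
have pq : p = q by apply: (@cos_inj R) => //; rewrite in_itv /= ?(ltW p0) ?(ltW pp).
subst q; have sp : sin p != 0 by rewrite gt_eqF// sin_gt0_pi// p0.
have [|->//|] := @angle_eq R t s _ rs (mulfI sp k0) (mulfI sp k1).
- by rewrite !ltW.
- by case=> -[a b]; move: t0 t2; rewrite a ltxx.
Qed.

(** On the open rectangle of coordinates each point of the set is counted by
    the rectangle of one of the cells of [U]. *)
Lemma mass_cells (U : {set V}) (C : set (S2 R)) : Smeasurable C ->
  C `<=` (fun x => exists2 v, v \in U & cell_set v x) ->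
  (mass C <= ((\sum_(v in U) area v) * (2 * (pi / N%:R)))%:E)%E.
Proof.
move=> mC CU.
pose pf (v : V) (z : RR) : \bar R := (rect_dens (mesh M v.1) (mesh M v.1.+1) (2 * mesh M v.2) (2 * mesh M v.2.+1) z)%:E.
have pf0 v z : (0 <= pf v z)%E.
  by rewrite lee_fin rect_dens_ge0// ?mesh_ge0// mesh_lepi.
have mpf v : measurable_fun setT (pf v).
  by apply/measurable_EFinP; exact: measurable_rect_dens.
have -> : ((\sum_(v in U) area v) * (2 * (pi / N%:R)))%:E = (\int[mu \x mu]_z (\sum_(v <- enum U) pf v z))%E :> \bar R.
  rewrite ge0_integral_sum//.
  rewrite big_enum /= mulr_suml -sumEFin; apply: eq_bigr => v vU.
  rewrite /pf integral_rect_dens ?mesh_ge0 ?mesh_lt ?mesh_lepi// ?ltr_pM2l ?mesh_lt//.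
  by congr EFin; rewrite mulrC meshS /area; congr (_ * _); ring.
apply: ge0_le_integral => //.
- by move=> z _; exact: mass_integrand_ge0.
- exact: measurable_mass_integrand.
- exact: emeasurable_sum.
move=> z _; rewrite big_enum /=.
have s0 (P : pred V) : (0 <= \sum_(v | P v) pf v z)%E by apply: sume_ge0.
rewrite /polar_density !indicE; case: (boolP (sphz z \in C)) => [|_]; last by rewrite mulr0.
rewrite inE mulr1 => /CU[v vU [w wv wz]].
case: (boolP (z.1 \in _)) => z1; last by rewrite mulr0 mul0r.
case: (boolP (z.2 \in _)) => z2; last by rewrite mulr0.
rewrite inE /= in_itv /= in z1; rewrite inE /= in_itv /= in z2.
have [w1 w2] := in_cell_range wv.
have e := sphz_inj_in z1 z2 w1 w2 wz; subst w.
rewrite (bigD1 v)//= !mulr1; apply: (@le_trans _ _ (pf v z)); last by rewrite leeDl.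
rewrite /pf /rect_dens !indicE; case: wv => wv1 wv2.
by rewrite !mem_set ?mulr1//= in_itv.
Qed.

Lemma nu_cells (U : {set V}) (C : set (S2 R)) : Smeasurable C ->
  C `<=` (fun x => exists2 v, v \in U & cell_set v x) ->
  2 * \sum_(v in U) area v <= \sum_(v : V) area v :> R ->
  (nu C <= (2^-1)%:E)%E.
Proof.
move=> mC CU; rewrite total_areaE// ler_pM2l// => le.
rewrite nu_mass//; apply: (le_trans (lee_wpmul2l _ (mass_cells mC CU))).
  by rewrite lee_fin invr_ge0 mulr_ge0// pi_ge0.
rewrite -EFinM lee_fin.
have pn : 0 < 2 * (pi / N%:R) :> R by rewrite mulr_gt0// divr_gt0// pi_gt0.
apply: (@le_trans _ _ ((4 * pi)^-1 * (N%:R * (2 * (pi / N%:R))))).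
  by rewrite ler_wpM2l ?invr_ge0 ?mulr_ge0 ?pi_ge0// ler_pM2r.
rewrite le_eqVlt; apply/orP; left; apply/eqP.
have : pi != 0 :> R by rewrite gt_eqF// pi_gt0.
by move: (pi : R) => p pn0; field; rewrite nat1r pnatr_eq0.
Qed.

End Patches.

Section NuFacts.
Context {R : realType}.
Local Notation mu := (@lebesgue_measure R).
Local Notation RR := (measurableTypeR R * measurableTypeR R)%type.

Lemma nuT : nu [set: S2 R] = 1%E.
Proof.
rewrite /nu; set I := (\int[_]_(_ in _) _)%E.
have -> : I = (\int[mu]_(x in `[0%R, pi]) ((2 * pi)%:E * (sin x)%:E))%E.
  apply: eq_integral => x _.
  transitivity (\int[mu]_(y in `[0%R, (2 * pi)%R]) (sin x)%:E)%E.
    by apply: eq_integral => y _; rewrite indicT mulr1.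
  by rewrite integral_cst//= lebesgue_measure_itv /= lte_fin mulr_gt0 ?pi_gt0// -EFinB subr0 muleC.
rewrite ge0_integralZl//.
- rewrite integral_sin ?pi_gt0// cos0 cospi -!EFinM; congr EFin.
  have : pi != 0 :> R by rewrite gt_eqF// pi_gt0.
  by move: (pi : R) => p pn0; field.
- apply/measurable_EFinP; apply: measurable_funTS.
  by apply: continuous_measurable_fun; exact: continuous_sin.
- by move=> x /= /(@sin_ge0_in R 0 pi); rewrite lee_fin; apply.
- by rewrite lee_fin mulr_ge0 ?pi_ge0.
Qed.

Lemma subinterval (t p e : R) : 0 <= t <= p -> 0 < p -> 0 < e ->
  exists a b, [/\ 0 < a, a < b, b < p & forall x, a <= x <= b -> `|t - x| < e].
Proof.
move=> /andP[t0 tp] p0 e0; pose l := Num.max 0 (t - e); pose u := Num.min p (t + e).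
have [l0 le] : 0 <= l /\ t - e <= l by rewrite /l !le_max !lexx orbT.
have [up ue] : u <= p /\ u <= t + e by rewrite /u !ge_min !lexx orbT.
have lu : l < u by rewrite /l /u gt_max !lt_min; apply/andP; split; apply/andP; split; lra.
exists (l + (u - l) / 3), (l + (u - l) / 3 * 2).
have d0 : 0 < (u - l) / 3 by rewrite divr_gt0 ?subr_gt0.
have d3 : u = l + (u - l) / 3 * 3 by field.
move: ((u - l) / 3) d0 d3 => d d0 d3.
split; try lra.
by move=> x /andP[ax xb]; rewrite ltr_norml; apply/andP; split; lra.
Qed.

(** An open set contains the image of a small coordinate rectangle away from
    the boundary, also near the poles and the date line. *)
Lemma nu_open_gt0 (A : set (S2 R)) : open A -> A !=set0 -> (0 < nu A)%E.
Proof.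
move=> oA [x Ax]; have [p [t [hp ht e]]] := sph_surj x.
have oO : open (@sphz R @^-1` A).
  by apply: open_comp => // z _; exact: sph_continuous2.
have : nbhs (p, t) (@sphz R @^-1` A) by move: oO; rewrite openE; apply; rewrite /sphz /= -e.
move=> [[P Q] /= [/nbhs_ballP[e1 /= e10 h1] /nbhs_ballP[e2 /= e20 h2]] PQ].
have [a [b [a0 ab bp hab]]] := subinterval hp (pi_gt0 R) e10.
have [|c [d [c0 cd d2 hcd]]] := subinterval ht _ e20; first by rewrite mulr_gt0// pi_gt0.
rewrite nu_mass; last exact: open_Smeasurable.
apply: mule_gt0; first by rewrite lte_fin invr_gt0 mulr_gt0// pi_gt0.
apply: (@lt_le_trans _ _ (\int[mu \x mu]_z (rect_dens a b c d z)%:E)%E).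
  rewrite integral_rect_dens//; [|exact: ltW|exact: ltW].
  have ai : a \in `[0, pi] by rewrite in_itv /= !ltW// (lt_trans ab).
  have bi : b \in `[0, pi] by rewrite in_itv /= !ltW// (lt_trans a0).
  by rewrite lte_fin mulr_gt0 ?subr_gt0 ?ltr_cos.
apply: ge0_le_integral => //.
- by move=> z _; rewrite lee_fin rect_dens_ge0// ltW.
- by apply/measurable_EFinP; exact: measurable_rect_dens.
- exact: measurable_mass_integrand (open_Smeasurable oA).
move=> z _; rewrite lee_fin /rect_dens /polar_density.
rewrite ![\1_`[_, _]%classic _]indicE.
case: (boolP (z.1 \in _)) => z1; last by rewrite mulr0 mul0r mulr_ge0 ?polar_density_ge0// indicE.
case: (boolP (z.2 \in _)) => z2; last by rewrite mulr0 mulr_ge0 ?polar_density_ge0// indicE.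
rewrite inE /= in_itv /= in z1; rewrite inE /= in_itv /= in z2.
rewrite !indicE !mem_set ?mulr1//.
- by apply: (PQ z); split; [apply: h1; exact: hab|apply: h2; exact: hcd].
- by case/andP: z2 => u v; rewrite /= in_itv /= (lt_le_trans c0 u) (le_lt_trans v d2).
- by case/andP: z1 => u v; rewrite /= in_itv /= (lt_le_trans a0 u) (le_lt_trans v bp).
Qed.

End NuFacts.

(** * Big sets *)

Section CellUnions.
Context {R : realType}.
Variable M : nat.
Local Notation N := M.+1.
Local Notation V := ('I_M.+1 * 'I_M.+1)%type.
Local Notation gadj := (nadj (@grid_nbs M)).

Definition cells (U : set V) : set (S2 R) := \bigcup_(v in U) cell_set v.

Lemma cells_closed U : closed (cells U).
Proof.
by apply: closed_bigcup => [|v _]; [exact: finite_finset|exact: cell_closed].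
Qed.

Lemma in_some_cell (U : set V) x : (forall v, cell_set v x -> U v) -> cells U x.
Proof. by move=> xU; have [v vx] := cell_cover M x; exists v => //; exact: xU. Qed.

(** The union of the cells around [x]: a small connected neighbourhood, whence
    the local connectedness of the sphere. *)
Definition star (x : S2 R) := cells [set v | cell_set v x].

Lemma star_refl x : star x x.
Proof. by apply: in_some_cell. Qed.

Lemma star_connected x : connected (star x).
Proof. by apply: bigcup_connected => [|v _]; [exists x|exact: cell_connected]. Qed.

Lemma star_nbhs x : nbhs x (star x).
Proof.
have oU : open (~` cells [set v | ~ cell_set v x]) by rewrite openC; exact: cells_closed.
have : nbhs x (~` cells [set v | ~ cell_set v x]).
  by apply: open_nbhs_nbhs; split => // -[v]; apply.
apply: filterS => y yx; apply: in_some_cell => v vy.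
by apply: contrapT => vx; apply: yx; exists v.
Qed.

Lemma star_small x y : star x y -> S2dist x y <= 4 * (pi / N%:R).
Proof. by move=> [v vx vy]; exact: cell_small vx vy. Qed.

End CellUnions.

Section LocalConnectivity.
Context {R : realType}.
Implicit Types (A K L O W : set (S2 R)).

Lemma small_mesh (d : R) : 0 < d -> exists M : nat, 4 * (pi / M.+1%:R) < d.
Proof.
move=> d0; exists (Num.truncn (4 * pi / d)).
rewrite mulrA ltr_pdivrMr// [ltRHS]mulrC -ltr_pdivrMr//.
by have /andP[] := truncn_itv (divr_ge0 (mulr_ge0 (ler0n R 4) (pi_ge0 R)) (ltW d0)).
Qed.

Lemma component_open O x : open O -> open (connected_component O x).
Proof.
move=> oO; rewrite openE => y Cy; have Oy := connected_component_sub Cy.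
have : nbhs y O by move: oO; rewrite openE; apply.
move=> /nbhs_S2dist[d d0 dO]; have [M Md] := small_mesh d0.
rewrite (same_connected_component Cy).
apply: filterS (star_nbhs M y); apply: connected_component_max.
- exact: star_refl.
- by move=> z /star_small yz; apply: dO; exact: le_lt_trans Md.
- exact: star_connected.
Qed.

Lemma component_closure K x : closed K ->
  closure (connected_component (~` K) x) `<=` connected_component (~` K) x `|` K.
Proof.
move=> cK z clz; have [Kz|nKz] := pselect (K z); [by right|left].
have oC : open (connected_component (~` K) z) by apply: component_open; rewrite openC.
have Cz := connected_component_refl (nKz : (~` K) z).
have [|y [xy zy]] := clz (connected_component (~` K) z).
  by move: oC; rewrite openE; apply.
exact: connected_component_trans xy (connected_component_sym zy).
Qed.

Lemma S2_connected : connected [set: S2 R].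
Proof.
have -> : [set: S2 R] = \bigcup_(t in [set: R]) [set sph p t | p in `[0, pi]].
  apply/seteqP; split => // x _; have [p [t [hp _ ->]]] := sph_surj x.
  by exists t => //; exists p => //=; rewrite in_itv.
apply: bigcup_connected => [|t _].
  exists (sph 0 0) => t _; exists 0; first by rewrite /= in_itv /= lexx pi_ge0.
  by apply: eq_sph => //; rewrite sin0 !mul0r.
apply: connected_continuous_connected; first exact: segment_connected.
apply: continuous_subspaceT => p.
apply: (@continuous_comp _ _ _ (fun p : R => (p, t)) (@sphz R)); last exact: sph_continuous2.
exact: (cvg_pair (f := fun q : R => q) (g := fun=> t) (@cvg_id _ (nbhs p)) (@cst_continuous R R t p)).
Qed.

Lemma clopen_full A : A !=set0 -> open A -> closed A -> A = setT.
Proof. by move=> A0 oA cA; apply: S2_connected => //; exists A; rewrite ?setTI. Qed.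

(** Otherwise the component would be open and closed. *)
Lemma component_touches K x : closed K -> K !=set0 -> ~ K x ->
  closure (connected_component (~` K) x) `&` K !=set0.
Proof.
move=> cK [k Kk] nKx; apply/set0P/eqP => e.
have : connected_component (~` K) x = setT.
  apply: clopen_full.
  - by exists x; exact: connected_component_refl.
  - by apply: component_open; rewrite openC.
  rewrite closure_id; apply/seteqP; split; first exact: subset_closure.
  move=> z clz; case: (component_closure cK clz) => // Kz.
  by have : (closure (connected_component (~` K) x) `&` K) z by []; rewrite e.
by move=> h; have : connected_component (~` K) x k by [rewrite h]; move/connected_component_sub.
Qed.

End LocalConnectivity.

Section BigSets.
Context {R : realType}.
Implicit Types (A K L O W : set (S2 R)).

Definition big K := [/\ closed K, connected K &
  forall y, ~ K y -> (nu (connected_component (~` K) y) <= (2^-1)%:E)%E].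

Lemma nu_ge0 A : Smeasurable A -> (0 <= nu A)%E.
Proof.
move=> mA; rewrite nu_mass// mule_ge0 ?mass_ge0// lee_fin invr_ge0 mulr_ge0// pi_ge0//.
Qed.

Lemma nu_le A B : Smeasurable A -> Smeasurable B -> A `<=` B -> (nu A <= nu B)%E.
Proof.
move=> mA mB AB; rewrite !nu_mass// lee_wpmul2l ?mass_le//.
by rewrite lee_fin invr_ge0 mulr_ge0// pi_ge0.
Qed.

Lemma nuU A B : Smeasurable A -> Smeasurable B -> A `&` B = set0 -> nu (A `|` B) = (nu A + nu B)%E.
Proof.
move=> mA mB AB; rewrite !nu_mass ?massU//; last exact: SmeasurableU.
by rewrite ge0_muleDr ?mass_ge0.
Qed.

Lemma big_nonempty K : big K -> K !=set0.
Proof.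
move=> [_ _ K2]; apply/set0P/eqP => K0.
have [x _] : [set: S2 R] !=set0 by exists (sph 0 0).
have := K2 x; rewrite K0 setC0.
have -> : connected_component [set: S2 R] x = setT.
  by apply/seteqP; split => // y _; apply: connected_component_max S2_connected _ _.
rewrite nuT => /(_ id); by rewrite lee_fin leNgt invf_lt1 ?ltr1n.
Qed.

Lemma big_sup K L : big K -> closed L -> connected L -> K `<=` L -> big L.
Proof.
move=> [cK _ K2] cL kL KL; split => // y nLy.
have nKy : ~ K y by move/KL.
apply: le_trans (K2 y nKy); apply: nu_le.
- by apply: open_Smeasurable; apply: component_open; rewrite openC.
- by apply: open_Smeasurable; apply: component_open; rewrite openC.
apply: connected_component_max.
- exact: connected_component_refl.
- by move=> z /connected_component_sub + /KL.
- exact: component_connected.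
Qed.

(** Connectedness makes the two open sets overlap, and the overlap has
    positive measure, so their measures add up to more than 1. *)
Lemma half_cover A B : open A -> open B -> A !=set0 -> B !=set0 -> A `|` B = setT ->
  (nu A <= (2^-1)%:E)%E -> (nu B <= (2^-1)%:E)%E -> False.
Proof.
move=> oA oB A0 B0 AB hA hB.
have AB0 : A `&` B !=set0.
  apply/set0P/eqP => e; have AT : A = setT.
    apply: clopen_full => //; have -> : A = ~` B.
      apply/seteqP; split => x; first by move=> Ax Bx; have : (A `&` B) x by []; rewrite e.
      by move=> nB; have : (A `|` B) x by [rewrite AB]; case.
    by rewrite closedC.
  by move: e; rewrite AT setTI => e; case: B0; rewrite e.
have pos := nu_open_gt0 (openI oA oB) AB0.
have mA := open_Smeasurable oA; have mB := open_Smeasurable oB.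
have mD : Smeasurable (B `&` ~` A) by apply: SmeasurableI => //; exact: SmeasurableC.
have e1 : nu [set: S2 R] = (nu A + nu (B `&` ~` A))%E.
  have E : A `|` (B `&` ~` A) = setT by rewrite setUIr setUCr setIT AB.
  by rewrite -E; apply: nuU => //; apply/seteqP; split => // x [Ax [_]].
have e2 : nu B = (nu (A `&` B) + nu (B `&` ~` A))%E.
  have E : (A `&` B) `|` (B `&` ~` A) = B by rewrite [A `&` B]setIC -setIUr setUCr setIT.
  rewrite -[in LHS]E.
  apply: nuU => //; first exact: SmeasurableI.
  by apply/seteqP; split => // x [[Ax _] [_]].
rewrite nuT in e1; move: e1 e2 pos hA hB (nu_ge0 mA) (nu_ge0 mD); clear.
case: (nu A) => [a||]//; case: (nu (B `&` ~` A)) => [d||]//; case: (nu (A `&` B)) => [b||]//;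
  case: (nu B) => [c||]//.
rewrite -!EFinD => -[e1] -[e2]; rewrite !lee_fin lte_fin => *; lra.
Qed.

(** If [K] and [L] are disjoint, let [A] be the component of the complement of
    [K] that contains [L], and [B] the other way round. A component of the
    complement of [K] other than [A] has its closure connected to [K] and
    disjoint from [L], so it lies in [B]. Hence [A] and [B] cover the sphere,
    against [half_cover]. *)
Lemma big_meet K L : big K -> big L -> K `&` L !=set0.
Proof.
move=> bK bL; have [k Kk] := big_nonempty bK; have [l Ll] := big_nonempty bL.
case: bK bL => [cK kK K2] [cL kL L2].
apply/set0P/eqP => KL.
have KCL : K `<=` ~` L by move=> x Kx Lx; have : (K `&` L) x by []; rewrite KL.
have LCK : L `<=` ~` K by move=> x Lx Kx; exact: KCL Kx Lx.
pose A := connected_component (~` K) l; pose B := connected_component (~` L) k.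
have LA : L `<=` A by exact: connected_component_max.
have KB : K `<=` B by exact: connected_component_max.
apply: (@half_cover A B).
- by apply: component_open; rewrite openC.
- by apply: component_open; rewrite openC.
- by exists l; exact: LA.
- by exists k; exact: KB.
- apply/seteqP; split => // x _; have [Ax|nAx] := pselect (A x); [by left|right].
  have [Kx|nKx] := pselect (K x); first exact: KB.
  pose W := connected_component (~` K) x.
  have WL z : closure W z -> ~ L z.
    move=> /(component_closure cK)[Wz Lz|/KCL//]; apply: nAx.
    exact: connected_component_trans (LA _ Lz) (connected_component_sym Wz).
  have [z [Wz Kz]] : closure W `&` K !=set0 by apply: component_touches => //; exists k.
  suff : closure W `|` K `<=` B.
    by apply; left; apply: subset_closure; exact: connected_component_refl.
  apply: connected_component_max.
  + by right.
  + by move=> y [/WL//|/KCL].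
  + apply: connectedU => //; first by exists z.
    by apply: connected_closure; exact: component_connected.
- exact: K2 (LCK _ Ll).
- exact: L2 (KCL _ Kk).
Qed.

End BigSets.

Section PatchBig.
Context {R : realType}.
Variable M : nat.
Hypothesis M0 : (0 < M)%N.
Local Notation N := M.+1.
Local Notation V := ('I_M.+1 * 'I_M.+1)%type.
Local Notation gadj := (nadj (@grid_nbs M)).
Variable col : V -> bool.
Hypothesis first_mono : forall j j', col (ord0, j) = col (ord0, j').
Hypothesis last_mono : forall j j', col (ord_max, j) = col (ord_max, j').

Lemma mono_comp_cells_connected h : connected (@cells R M [set` mono_comp gadj col h]).
Proof.
set P := mono_comp gadj col h.
have hP : h \in P by rewrite inE; exact: connect0.
suff chain v : v \in P -> exists C : set (S2 R), [/\ connected C, C `<=` cells [set` P],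
    cell_set h `<=` C & cell_set v `<=` C].
  pose good (C : set (S2 R)) := [/\ connected C, C `<=` cells [set` P] & cell_set h `<=` C].
  have -> : cells [set` P] = \bigcup_(C in good) C.
    apply/seteqP; split => [x [v vP vx]|x [C [_ CP _]]]; last exact: CP.
    by have [C [c1 c2 c3 c4]] := chain v vP; exists C => //; exact: c4.
  apply: bigcup_connected => [|C []//].
  have [x hx] : exists x : S2 R, cell_set h x.
    by exists (sample_point h); exact: sample_in_cell.
  by exists x => C [_ _]; apply.
move=> vP; have := mono_comp_reach (@gadj_sym M) hP vP => /connectP[p].
elim/last_ind: p v vP => [|p w ih] v vP.
  by move=> _ ->; exists (cell_set h); split => //; [exact: cell_connected|exact: bigcup_sup].
rewrite rcons_path last_rcons => /andP[pth /and3P[uP wP uw]] e; subst v.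
have [C [c1 c2 c3 c4]] := ih _ uP pth (erefl _).
exists (C `|` cell_set w); split.
- apply: connectedU => //; last exact: cell_connected.
  by have [x [xu xw]] := @adj_cells_meet R M _ _ uw; exists x; split => //; exact: c4.
- by rewrite subUset; split => //; exact: bigcup_sup.
- by apply: subset_trans c3 _; exact: subsetUl.
- exact: subsetUr.
Qed.

(** The first cell of the path inside the component would pull its predecessor
    into it. *)
Lemma mono_avoids h u v : u \notin mono_comp gadj col h -> mono gadj col u v ->
  reach gadj (~: mono_comp gadj col h) u v.
Proof.
move=> uP /connectP[p + ->]; elim: p u uP => [|w p ih] u uP /=; first by move=> _; exact: connect0.
move=> /andP[/andP[uw /eqP c] pth].
have wP : w \notin mono_comp gadj col h.
  apply: contra uP => wP; apply: (mono_comp_trans wP).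
  by apply: mono1; rewrite // gadj_sym.
by apply: connect_trans (ih w wP pth); apply: reach1; rewrite ?finset.in_setC.
Qed.

(** The cells outside the component fall into regions, and cells of different
    regions do not meet: neighbours lie in the same region, and so do the
    cells around a pole, which have one colour. So a component of the
    complement stays within the cells of one region. *)
Lemma mono_comp_big h :
  (forall x, x \notin mono_comp gadj col h ->
     2 * \sum_(v in region gadj (~: mono_comp gadj col h) x) area v <= \sum_(v : V) area v :> R) ->
  big (@cells R M [set` mono_comp gadj col h]).
Proof.
set P := mono_comp gadj col h => small; split; first exact: cells_closed.
  exact: mono_comp_cells_connected.
move=> y nKy; have [x xy] := cell_cover M y.
have xP : x \notin P by apply/negP => xP; apply: nKy; exists x.
set W := region gadj (~: P) x; set C := connected_component _ _.
have WP v : v \in W -> v \notin P.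
  have /fintype.subsetP WP : W \subset ~: P by apply: region_sub; rewrite finset.in_setC.
  by move/WP; rewrite finset.in_setC.
pose A := @cells R M [set` W]; pose B := @cells R M [set v | v \notin P /\ v \notin W].
have CAB z : C z -> A z \/ B z.
  move=> /connected_component_sub nKz; have [v vz] := cell_cover M z.
  have vP : v \notin P by apply/negP => vP; apply: nKz; exists v.
  by have [vW|vW] := boolP (v \in W); [left|right]; exists v.
have AB z : A z -> B z -> False.
  move=> [w wW wz] [v [vP vW] vz]; move/negP: vW; apply.
  have {}wW : w \in W := wW; have wP := WP w wW; have WE u : (u \in W) = reach gadj (~: P) x u by rewrite /W inE.
  have same u : mono gadj col w u -> u \in W.
    by move=> wu; rewrite WE; move: wW; rewrite WE => /connect_trans; apply; exact: mono_avoids.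
  have [wv|[w0 v0]|[wl vl]] : [\/ gadj w v, w.1 = ord0 /\ v.1 = ord0 | w.1 = ord_max /\ v.1 = ord_max].
  - by apply: (@meet_cells_adj R); exists z.
  - rewrite WE; move: wW; rewrite WE => /connect_trans; apply.
    by apply: reach1; rewrite ?finset.in_setC.
  - apply: same; case: (w) (v) w0 v0 => [i j] [i' j'] /= -> ->; exact: row_mono.
  - apply: same; case: (w) (v) wl vl => [i j] [i' j'] /= -> ->; exact: row_mono.
apply: (nu_cells (U := W)); last exact: small.
  by apply: open_Smeasurable; apply: component_open; rewrite openC; exact: cells_closed.
have -> : C = C `&` A; last by move=> z [].
apply/esym; apply: component_connected.
- exists y; split; first exact: connected_component_refl.
  by exists x => //; rewrite /= /W inE; exact: connect0.
- exists (~` B); first by rewrite openC; exact: cells_closed.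
  apply/seteqP; split => z [Cz h2]; split => //; first by move/(AB z h2).
  by case: (CAB z Cz).
- by exists A => //; exact: cells_closed.
Qed.

End PatchBig.

(** * Existence of medians *)

Lemma pi_le4 {R : realType} : pi <= 4 :> R.
Proof. by have := @pihalf_lt2 R; lra. Qed.

Section SelectedPatch.
Context {R : realType}.
Variable M : nat.
Hypothesis M0 : (0 < M)%N.
Local Notation N := M.+1.
Local Notation V := ('I_M.+1 * 'I_M.+1)%type.
Local Notation gadj := (nadj (@grid_nbs M)).
Local Notation root := ((ord0, ord0) : V).

Lemma selected_comp_big (f : S2 R -> R) (e : R) (o : seq (V * V)) :
  let col := colour f e in
  let h := select col root o (branch_sums o (@area R M)) (\sum_v @area R M v) in
  search_tree col (@grid_nbs M) root o -> (forall v, v \in unzip1 o) ->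
  big (@cells R M [set` mono_comp gadj col h]).
Proof.
move=> col h tree all_o.
have first_mono j j' : col (ord0, j) = col (ord0, j').
  by rewrite /col /colour (value_first_row f j j').
have last_mono j j' : col (ord_max, j) = col (ord_max, j').
  by rewrite /col /colour (value_last_row M0 f j j').
apply: mono_comp_big => // x xP.
apply: (centroid_big (@gadj_sym M) (@grid_simply_connected M) _ tree all_o _ xP).
  move=> [i j] [i' j']; rewrite !inE /= => /eqP-> /eqP->; exact: row_mono.
exact: area_ge0.
Qed.

Lemma mono_comp_value (f : S2 R -> R) (e d : R) (h : V) x : 0 <= e ->
  (forall u w : V, gadj u w -> value f u - value f w <= e) ->
  (forall (v : V) x y, cell_set v x -> cell_set v y -> `|f x - f y| <= d) ->
  cells [set` mono_comp gadj (colour f e) h] x -> `|f x - value f h| <= d + pi * e.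
Proof.
move=> e0 step small [v vP vx].
have -> : f x - value f h = (f x - value f v) + (value f v - value f h) by ring.
apply: (le_trans (ler_normD _ _)); apply: lerD; last exact: mono_comp_osc.
by apply: small vx _; exact: sample_in_cell.
Qed.

End SelectedPatch.

Section Medians.
Context {R : realType}.
Implicit Types (A K L O W : set (S2 R)) (g : S2 R -> R).

Lemma uniform_on_cells g (d : R) : continuous g -> 0 < d ->
  exists2 M : nat, (0 < M)%N & forall v x y, @cell_set R M v x -> cell_set v y -> `|g x - g y| <= d.
Proof.
move=> gc d0.
have /compact_near_coveringP cov := @S2_compact R.
have := cov nat \oo (fun M x => forall y, S2dist x y <= 4 * (pi / M.+1%:R) -> `|g x - g y| <= d) _.
case=> [x _|n _ hn].
  have d20 : 0 < d / 2 by rewrite divr_gt0.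
  have nx : \forall y \near x, `|g x - g y| < d / 2 by exact: near_continuous.
  have [r r0 rP] := nbhs_S2dist nx.
  have r20 : 0 < r / 2 by rewrite divr_gt0.
  have [m mr] := small_mesh r20.
  exists ([set y | S2dist x y < r / 2], [set k | (m <= k)%N]).
    by split; [exact: S2dist_nbhs|exists m].
  move=> [x' k] /= [xx' mk] y x'y.
  have xy : S2dist x y < r.
    rewrite -(ltr_pXn2r (n := 2)) ?nnegrE ?S2dist_ge0 ?(ltW r0)//.
    apply: (le_lt_trans (S2dist_detour _ x' _)).
    have x'y' : S2dist x' y < r / 2.
      apply: (le_lt_trans x'y); apply: le_lt_trans mr.
      by rewrite ler_pM2l// ler_wpM2l ?pi_ge0// lef_pV2 ?posrE ?ltr0n// ler_nat.
    have e : r ^+ 2 = 2 * (r / 2) ^+ 2 + 2 * (r / 2) ^+ 2 by field.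
    by rewrite e ltrD// ltr_pM2l// ltrXn2r// ?nnegrE ?S2dist_ge0 ?(ltW r20).
  have h1 : `|g x - g x'| < d / 2 by apply: rP; apply: lt_le_trans xx' _; lra.
  have h2 := rP _ xy.
  have -> : g x' - g y = - (g x - g x') + (g x - g y) by ring.
  by apply: (le_trans (ler_normD _ _)); rewrite normrN; lra.
exists n.+1 => // v x y vx vy; apply: (hn n.+1 (leqnSn n) x) => //.
exact: cell_small vx vy.
Qed.

(** The selected component of a fine grid serves: neighbouring cells meet, so
    samples of neighbours differ by twice the oscillation [d / 18] on cells,
    and [18 = 2 * (1 + 4 * 2)] as [pi] is at most 4. *)
Lemma big_small_osc g (d : R) : continuous g -> 0 < d ->
  exists2 K, big K & forall x y, K x -> K y -> `|g x - g y| <= d.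
Proof.
move=> gc d0; have d180 : 0 < d / 18 by rewrite divr_gt0.
have [M M0 small] := uniform_on_cells gc d180.
pose e := 2 * (d / 18); have e0 : 0 <= e by rewrite mulr_ge0// ltW.
have step u w : nadj (@grid_nbs M) u w -> value g u - value g w <= e.
  move=> uw; have [z [uz wz]] := @adj_cells_meet R M u w uw.
  have h1 := small u _ _ (@sample_in_cell R M M0 u) uz.
  have h2 := small w _ _ wz (@sample_in_cell R M M0 w).
  rewrite /value /e; move: h1 h2 => /(le_trans (ler_norm _)) h1 /(le_trans (ler_norm _)) h2.
  by lra.
have [vs [tree all_o]] : exists o, search_tree (colour g e) (@grid_nbs M) (ord0, ord0) o /\ forall v, v \in unzip1 o.
  have deg (v : 'I_M.+1 * 'I_M.+1) : (size (grid_nbs v) <= 9)%N by rewrite grid_deg.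
  eexists; exact: (search_complete (colour g e) (ord0, ord0) deg (@gadj_conn M) (leqnn _)).
have := selected_comp_big M0 tree all_o.
set h := select _ _ _ _ _ => Kbig.
exists (cells [set` mono_comp (nadj (@grid_nbs M)) (colour g e) h]) => // x y Kx Ky.
have hx := mono_comp_value M0 e0 step small Kx; have hy := mono_comp_value M0 e0 step small Ky.
have -> : g x - g y = (g x - value g h) - (g y - value g h) by ring.
apply: (le_trans (ler_normB _ _)); apply: (le_trans (lerD hx hy)).
have p4 : pi * e <= 4 * e by rewrite ler_wpM2r// pi_le4.
by rewrite /e in p4 *; lra.
Qed.

(** Compactness of the sphere. *)
Lemma nested_closed_sub (F : nat -> set (S2 R)) O : (forall n, closed (F n)) ->
  (forall m n, (m <= n)%N -> F n `<=` F m) -> open O -> \bigcap_n F n `<=` O ->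
  exists n, F n `<=` O.
Proof.
move=> cF dF oO FO.
have /compact_near_coveringP cov := @S2_compact R.
have := cov nat \oo (fun n x => F n x -> O x) _.
case=> [x _|n _ hn]; last by exists n => x; apply: hn => //=.
have [Ox|nOx] := pselect (O x).
  exists (O, setT); first by split; [exact: open_nbhs_nbhs|exact: filterT].
  by move=> [y k] [/= Oy _].
have [m nFx] : exists m, ~ F m x.
  by apply: contrapT => /forallNP h; apply: nOx; apply: FO => k _; apply: contrapT; exact: h.
exists (~` F m, [set k | (m <= k)%N]).
  by split; [apply: open_nbhs_nbhs; split; [rewrite openC|]|exists m].
by move=> [y k] [/= nFy mk] /(dF _ _ mk).
Qed.

Lemma mass_nu A : Smeasurable A -> mass A = ((4 * pi)%:E * nu A)%E.
Proof.
move=> mA; rewrite nu_mass// muleA -EFinM divff ?mul1e//.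
by rewrite gt_eqF// mulr_gt0// pi_gt0.
Qed.

(** Connectedness: a separation of the intersection extends to disjoint open
    sets, which by compactness already separate one [F n]. Measure: a
    complementary component of the intersection is the increasing union of
    those of the [F n] at the same point. *)
Lemma big_bigcap (F : nat -> set (S2 R)) : (forall n, big (F n)) ->
  (forall m n, (m <= n)%N -> F n `<=` F m) -> big (\bigcap_n F n).
Proof.
move=> bF dF; set I := \bigcap_n F n.
have cF n : closed (F n) by case: (bF n).
have cI : closed I by apply: closed_bigI.
have IF n : I `<=` F n by move=> x; apply.
split => //.
  move=> B B0 [U' oU' BU'] [C cC BC].
  have cB : closed B by rewrite BC; exact: closedI.
  have cD : closed (I `&` ~` U') by apply: closedI => //; rewrite closedC.
  have BD : B `&` (I `&` ~` U') = set0.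
    by apply/seteqP; split => // x [+ [_ nU']]; rewrite BU' => -[].
  have /(@normal_openP R) nrm := compact_normal S2_hausdorff (@S2_compact R).
  have [U [W [oU oW BU DW UW]]] := nrm _ _ cB cD BD.
  have [|n FUW] := nested_closed_sub cF dF (openU oU oW).
    move=> x Ix; have [Ox|nOx] := pselect (U' x); first by left; apply: BU; rewrite BU'.
    by right; apply: DW.
  have [_ kF _] := bF n.
  have e : F n `&` U = F n.
    apply: kF.
    - by case: B0 => b Bb; exists b; split; [apply: IF; move: Bb; rewrite BU' => -[]|exact: BU].
    - by exists U.
    - exists (~` W); first by rewrite closedC.
      apply/seteqP; split => x [Fx h]; split => //.
        by move=> Wx; have : (U `&` W) x by []; rewrite UW.
      by case: (FUW x Fx).
  apply/seteqP; split => x; first by rewrite BU' => -[].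
  move=> Ix; rewrite BU'; split => //; apply: contrapT => nOx.
  have Wx : W x by apply: DW.
  have Ux : U x by have := IF n x Ix; rewrite -e => -[].
  by have : (U `&` W) x by []; rewrite UW.
move=> y nIy; pose U n := connected_component (~` F n) y.
have oU n : open (U n) by apply: component_open; rewrite openC.
have mU n : Smeasurable (U n) by exact: open_Smeasurable.
have ndU m n : (m <= n)%N -> U m `<=` U n.
  move=> mn; have [Fy|nFy] := pselect (F m y).
    by rewrite /U connected_component_out; [move=> z []|move/(_ Fy)].
  have nFny : ~ F n y by move/(dF _ _ mn).
  apply: connected_component_max.
  - exact: connected_component_refl.
  - by move=> z /connected_component_sub nFz /(dF _ _ mn).
  - exact: component_connected.
have nuUn n : (nu (U n) <= (2^-1)%:E)%E.
  have [Fy|nFy] := pselect (F n y); last by case: (bF n) => _ _; apply.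
  rewrite /U connected_component_out; last by move/(_ Fy).
  rewrite nu_mass; last by apply: open_Smeasurable; exact: open0.
  rewrite /mass integral0_eq ?mule0 ?lee_fin// => z _.
  by rewrite indicE in_set0 mulr0.
(* the union is open, and closed within the complement of the intersection *)
have CU : connected_component (~` I) y = \bigcup_n U n.
  have [n0 nFy] : exists n, ~ F n y.
    by apply: contrapT => /forallNP h; apply: nIy => k _; apply: contrapT; exact: h.
  have UC : \bigcup_n U n `<=` connected_component (~` I) y.
    move=> z [n _ Uz]; have nFny : ~ F n y.
      by move=> Fy; move: Uz; rewrite /U connected_component_out; [case|move/(_ Fy)].
    apply: connected_component_max Uz.
    - exact: connected_component_refl.
    - by move=> w /connected_component_sub nFw /(IF n).
    - exact: component_connected.
  apply/seteqP; split => //.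
  suff <- : connected_component (~` I) y `&` \bigcup_n U n = connected_component (~` I) y by move=> z [].
  apply: component_connected.
  - exists y; split; first exact: connected_component_refl.
    by exists n0 => //; exact: connected_component_refl.
  - by exists (\bigcup_n U n) => //; apply: bigcup_open => n _.
  exists (closure (\bigcup_n U n)); first exact: closed_closure.
  apply/seteqP; split => z [Cz h]; split => //; first exact: subset_closure.
  have [n1 nFz] : exists n, ~ F n z.
    apply: contrapT => /forallNP h'; apply: (connected_component_sub Cz) => k _.
    by apply: contrapT; exact: h'.
  have oz : open (connected_component (~` F n1) z) by apply: component_open; rewrite openC.
  have [|w [[k _ Uw] zw]] := h (connected_component (~` F n1) z).
    by apply: open_nbhs_nbhs; split => //; exact: connected_component_refl.
  exists (maxn n1 k) => //.
  have yw := ndU _ _ (leq_maxr n1 k) _ Uw.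
  apply: (connected_component_trans yw); apply: connected_component_sym.
  suff : connected_component (~` F n1) z `<=` connected_component (~` F (maxn n1 k)) z by apply.
  apply: connected_component_max.
  - exact: connected_component_refl.
  - by move=> u /connected_component_sub nFu /(dF n1 _ (leq_maxl _ _)).
  - exact: component_connected.
have pi4 : 0 < 4 * pi :> R by rewrite mulr_gt0// pi_gt0.
rewrite CU nu_mass; last by apply: open_Smeasurable; apply: bigcup_open.
have : (mass (\bigcup_n U n) <= ((4 * pi) * 2^-1)%:E)%E.
  apply: mass_bigcup_le => // n; rewrite mass_nu// [leRHS]EFinM lee_wpmul2l//.
  by rewrite lee_fin ltW.
move=> /(lee_wpmul2l (_ : 0 <= ((4 * pi)^-1)%:E)%E) h; apply: (le_trans (h _)).
  by rewrite lee_fin invr_ge0 ltW.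
by rewrite -EFinM mulrA mulVf ?mul1r// gt_eqF.
Qed.

(** Take big sets [K n] on which [g] varies by at most [1 / n.+1]. As they
    meet each other, their values converge to some [t], and [K n] lies in a
    component of the set where [g] is within [2 / n.+1] of [t]. These
    components are big and nested, and [g = t] on their big intersection, so
    the component of the level set around it is a median. *)
Lemma median_exists g : continuous g -> exists m, is_median g m.
Proof.
move=> gc.
have inv_gt0 (n : nat) : 0 < n.+1%:R^-1 :> R by rewrite invr_gt0.
have /choice[K KP] : forall n : nat, exists K : set (S2 R), big K /\
    forall x y, K x -> K y -> `|g x - g y| <= n.+1%:R^-1.
  by move=> n; have [L] := big_small_osc gc (inv_gt0 n); exists L.
have /choice[p pK] : forall n, exists x, K n x.
  by move=> n; have [bK _] := KP n; exact: big_nonempty bK.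
have close m n : g (p m) - m.+1%:R^-1 <= g (p n) + n.+1%:R^-1.
  have [bm om] := KP m; have [bn on] := KP n; have [z [mz nz]] := big_meet bm bn.
  have := om _ _ (pK m) mz; have := on _ _ nz (pK n).
  rewrite !ler_norml => /andP[_ +] /andP[_ +]; move: (m.+1%:R^-1) (n.+1%:R^-1) => a b; lra.
(* the intervals around the values of g on the K n meet pairwise, and t is the
   supremum of their left ends *)
pose S := [set g (p m) - m.+1%:R^-1 | m in [set: nat]].
have hS : has_sup S.
  by split; [exists (g (p 0%N) - 1%:R^-1); exists 0%N|exists (g (p 0%N) + 1%:R^-1) => _ [m _ <-]; exact: close].
pose t := sup S.
have tP n : `|g (p n) - t| <= n.+1%:R^-1.
  have h1 : g (p n) - n.+1%:R^-1 <= t by apply: sup_upper_bound => //; exists n.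
  have h2 : t <= g (p n) + n.+1%:R^-1.
    by apply: ge_sup; [case: hS|move=> _ [m _ <-]; exact: close].
  by move: (n.+1%:R^-1) h1 h2 => a h1 h2; rewrite ler_norml; apply/andP; split; lra.
pose L n := [set x | `|g x - t| <= 2 * n.+1%:R^-1].
have cL n : closed (L n).
  apply: (@preimage_closed _ _ (fun x => `|g x - t|) [set s | s <= 2 * n.+1%:R^-1]); last exact: closed_le.
  move=> x _; move: x; apply: continuous_near => x e e0.
  apply: filterS (near_continuous x gc e0) => y; apply: le_lt_trans.
  apply: (le_trans (ler_dist_dist _ _)).
  by have -> : g x - t - (g y - t) = g x - g y by ring.
have LK n : K n `<=` L n.
  move=> x Kx; have [_ on] := KP n; have h1 := on _ _ Kx (pK n); have h2 := tP n.
  rewrite /L /=; have -> : g x - t = (g x - g (p n)) + (g (p n) - t) by ring.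
  by apply: (le_trans (ler_normD _ _)); move: (n.+1%:R^-1) h1 h2 => a; lra.
pose F n := connected_component (L n) (p n).
have KF n : K n `<=` F n.
  by apply: connected_component_max; [exact: pK|exact: LK|case: (KP n) => -[]].
have bF n : big (F n).
  have [bK _] := KP n; apply: big_sup bK _ _ (KF n); last exact: component_connected.
  exact: component_closed.
have dF1 n : F n.+1 `<=` F n.
  have [z [Fz1 Fz]] := big_meet (bF n.+1) (bF n).
  rewrite {2}/F (same_connected_component Fz); apply: connected_component_max => //.
    apply: subset_trans (@connected_component_sub _ _ _) _ => x /=; move/le_trans; apply.
    by rewrite ler_pM2l// lef_pV2 ?posrE// ler_nat.
  exact: component_connected.
have dF m n : (m <= n)%N -> F n `<=` F m.
  elim: n => [|n ih]; first by rewrite leqn0 => /eqP->.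
  rewrite leq_eqVlt => /orP[/eqP->//|mn]; exact: subset_trans (dF1 n) (ih mn).
have bI := big_bigcap bF dF; set I := \bigcap_n F n in bI.
have gI x : I x -> g x = t.
  move=> Ix; apply/eqP; rewrite -subr_eq0 -normr_le0; apply/ler_addgt0Pl => e e0.
  rewrite addr0; have [n ne] : exists n : nat, 2 * n.+1%:R^-1 <= e.
    exists (Num.truncn (2 / e)).
    rewrite ler_pdivrMr// [leRHS]mulrC -ler_pdivrMr//.
    by have /andP[_ /ltW] := truncn_itv (divr_ge0 (ler0n R 2) (ltW e0)).
  by apply: le_trans ne; have /connected_component_sub := Ix n Logic.I.
have [x Ix] := big_nonempty bI.
exists (connected_component (g @^-1` [set g x]) x).
have cg : closed (g @^-1` [set g x]).
  by apply: preimage_closed => [y _|]; [exact: gc|exact: closed_eq].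
have : big (connected_component (g @^-1` [set g x]) x).
  apply: (big_sup bI); first exact: component_closed.
    exact: component_connected.
  apply: connected_component_max => //; last by case: bI.
  by move=> y Iy; rewrite /= !gI.
by case=> _ _ h; split; [exists x|].
Qed.

Lemma median_big g m : continuous g -> is_median g m -> big m.
Proof.
move=> gc [[x ->] h]; split => //; last exact: component_connected.
apply: component_closed; apply: preimage_closed => [y _|]; [exact: gc|exact: closed_eq].
Qed.

End Medians.

(** * Error bound and conclusion *)

(** Monotonicity, applied to [f <= g + c], and [zeta (g + c) = zeta g + c],
    which is linearity on the algebra generated by [g]. *)
Lemma quasi_state_lipschitz {R : realType} {X : topologicalType} (zeta : (X -> R) -> R)
    (f g : X -> R) (c : R) : quasi_state zeta -> continuous f -> continuous g ->
  (forall x, `|f x - g x| <= c) -> `|zeta f - zeta g| <= c.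
Proof.
move=> [one mon lin] fc gc fg.
have shift (h : X -> R) (b : R) : continuous h ->
    continuous (fun x => h x + b) /\ zeta (fun x => h x + b) = zeta h + b.
  move=> hc; split.
    apply: continuous_near => x e e0; apply: filterS (near_continuous x hc e0) => y.
    by have -> : h x + b - (h y + b) = h x - h y by ring.
  have := lin h hc id (fun=> 1) (fun x => @cvg_id _ (nbhs x)) (fun x => @cst_continuous R R 1 x) 1 b.
  have -> : (fun x => 1 * id (h x) + b * 1) = (fun x => h x + b).
    by apply/funext => x; rewrite mul1r mulr1.
  by move=> ->; rewrite mul1r (_ : (fun=> 1) \o h = (fun=> 1))// one mulr1.
have half (h k : X -> R) : continuous h -> continuous k ->
    (forall x, `|h x - k x| <= c) -> zeta h - zeta k <= c.
  move=> hc kc hk; have [kcc e] := shift k c kc.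
  rewrite lerBlDl -e; apply: mon => // x.
  by rewrite -lerBlDl (le_trans (ler_norm _)).
rewrite ler_norml half// lerNl opprB half// => x.
by rewrite distrC.
Qed.

Section LipschitzConstant.
Context {R : realType}.
Variable f : S2 R -> R.
Hypothesis lip : S2_lipschitz f.

Let S : set R := [set q | exists x y : S2 R, x <> y /\ q = `|f x - f y| / S2dist x y].

Let S_has_sup : has_sup S.
Proof.
case: lip => L hL; split.
  exists (`|f (sph 0 0) - f (sph pi 0)| / S2dist (sph 0 0) (sph pi 0)); exists (sph 0 0), (sph pi 0).
  split => // e; have [_ _ c0] := coord_sph (0 : R) 0; have [_ _ c1] := coord_sph (pi : R) 0.
  by move: c0; rewrite e c1 cos0 cospi; lra.
exists `|L| => _ [x [y [_ ->]]].
have [d0|] := ltrP 0 (S2dist x y).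
  by rewrite ler_pdivrMr// (le_trans (hL x y))// ler_wpM2r ?ler_norm// ltW.
by move=> d0; have -> : S2dist x y = 0 by [apply/eqP; rewrite eq_le d0 S2dist_ge0]; rewrite invr0 mulr0.
Qed.

Lemma lip_const_bound x y : `|f x - f y| <= lip_const f * S2dist x y.
Proof.
case: lip => L hL; have [d0|d0] := eqVneq (S2dist x y) 0.
  by rewrite d0 mulr0; have := hL x y; rewrite d0 mulr0.
have dp : 0 < S2dist x y by rewrite lt_neqAle eq_sym d0 S2dist_ge0.
rewrite -ler_pdivrMr//; apply: sup_upper_bound => //; exists x, y; split => // e.
have := hL x y; rewrite e subrr normr0 => _; move: d0; rewrite e /S2dist /Defs.edist.
rewrite big1 ?sqrtr0 ?eqxx// => i _; by rewrite subrr expr0n.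
Qed.

Lemma lip_const_ge0 : 0 <= lip_const f.
Proof.
have [q [x [y [xy e]]]] := proj1 S_has_sup.
apply: (@le_trans _ _ q); first by rewrite e divr_ge0// S2dist_ge0.
by apply: sup_upper_bound => //; exists x, y.
Qed.

End LipschitzConstant.

(** A Morse function close to [f] has a median, which meets the big set. *)
Lemma big_value {R : realType} (f : S2 R -> R) (L : R) (K : set (S2 R)) (y D : R)
    (zeta : (S2 R -> R) -> R) : 0 <= L -> (forall x y, `|f x - f y| <= L * S2dist x y) ->
  big K -> (forall x, K x -> `|f x - y| <= D) -> median_quasi_state zeta -> `|y - zeta f| <= D.
Proof.
move=> L0 lip bK KD [qz zm]; apply/ler_addgt0Pl => e e0.
have e20 : 0 < e / 2 by rewrite divr_gt0.
have [g [gc mg fg]] := morse_dense L0 e20 lip.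
have fc := lipschitz_continuous L0 lip.
have [m med] := median_exists gc.
have [z [mz Kz]] := big_meet (median_big gc med) bK.
have h1 := KD z Kz; have h2 := fg z.
have h3 := quasi_state_lipschitz qz fc gc fg.
rewrite (zm g mg m med z mz) in h3.
have -> : y - zeta f = - (f z - y) + (f z - g z) - (zeta f - g z) by ring.
apply: (le_trans (ler_normB _ _)); apply: (le_trans (lerD (ler_normD _ _) h3)).
rewrite normrN; have -> : e + D = D + e / 2 + e / 2 by field.
by rewrite lerD2r lerD.
Qed.

(** With [pi <= 4] and [M + 1 >= 46], the left side is at most [L / M.+1]
    times [12 + 16 * 46 / 45 + 32], about 60.4. *)
Lemma grid_error {R : realType} (M : nat) (L : R) : (45 <= M)%N -> 0 <= L ->
  L * (3 * (pi / M.+1%:R)) + pi * (L * (pi / M%:R + 2 * (pi / M.+1%:R))) <=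
  (197 + 778 / 1000) / M.+1%:R * L.
Proof.
move=> M45 L0; set u : R := M.+1%:R^-1; set w : R := M%:R^-1.
have M0 : 0 < M%:R :> R by rewrite ltr0n (leq_trans _ M45).
have u0 : 0 <= u by rewrite invr_ge0.
have wu : w <= 46 / 45 * u.
  have M45' : 45 <= M%:R :> R by rewrite ler_nat.
  have -> : w = (M%:R + 1) * u * w by rewrite natr1 /u divff ?mul1r// pnatr_eq0.
  rewrite mulrAC ler_wpM2r// mulrDl divff ?gt_eqF// mul1r.
  have : w <= 45^-1 by rewrite lef_pV2 ?posrE// ltr0n.
  by lra.
have w0 : 0 <= w by rewrite invr_ge0 ltW.
have p4 := @pi_le4 R; have p0 := pi_ge0 R.
have pu : pi * u <= 4 * u by rewrite ler_wpM2r.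
have pw : pi * w <= 4 * w by rewrite ler_wpM2r.
have s0 : 0 <= pi * w + 2 * (pi * u) by rewrite addr_ge0 ?mulr_ge0.
have ps : pi * (pi * w + 2 * (pi * u)) <= 4 * (pi * w + 2 * (pi * u)) by rewrite ler_wpM2r.
have -> : L * (3 * (pi * u)) + pi * (L * (pi * w + 2 * (pi * u))) =
  (3 * (pi * u) + pi * (pi * w + 2 * (pi * u))) * L by ring.
rewrite ler_wpM2r//.
move: (pi * (pi * w + 2 * (pi * u))) ps => a ps.
by move: (pi * w) (pi * u) ps pu pw s0 => b c *; lra.
Qed.

Theorem theorem1p4 (R : realType) :
  exists (C : R) (P : com) (K : R),
    197 + 778 / 1000 <= C < 197 + 779 / 1000 /\
    forall (f : S2 R -> R) (N : nat), S2_lipschitz f -> (46 <= N)%N ->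
    exists (t : nat) (y : R),
      [/\ computes P f N t y,
          t%:R <= K * N%:R ^+ 2 * ln N%:R
        & forall zeta : (S2 R -> R) -> R, median_quasi_state zeta ->
            `|y - zeta f| <= C / N%:R * lip_const f].
Proof.
have ln46 : 0 < ln 46 :> R by rewrite ln_gt0// ltr1n.
have [c cE] : exists c, c = (250 * 100)%N by exists (250 * 100)%N.
(* ln 46 in the denominator turns the linear bound in N * N into one with ln N
   *)
exists (197 + 778 / 1000), median_program, (c%:R / ln 46); split.
  by apply/andP; split; [exact: lexx|lra].
move=> f [//|M] lip; rewrite ltnS => M45.
have M0 : (0 < M)%N by exact: leq_trans M45.
have L0 := lip_const_ge0 lip; have lipL := lip_const_bound lip.
set L := lip_const f in L0 lipL *.
have [t [e [vs [run time [e0 step scale] tree all_vs]]]] := median_program_correct f M.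
rewrite -cE in time.
exists t, (value f (select (colour f e) (ord0, ord0) vs (branch_sums vs (@area R M)) (\sum_v @area R M v))).
split=> [//||zeta med].
  apply: (@le_trans _ _ (c%:R * M.+1%:R ^+ 2)).
    by rewrite expr2 -!natrM ler_nat.
  rewrite [leRHS]mulrAC ler_wpM2r ?sqr_ge0// -mulrA ler_peMr// mulrC ler_pdivlMr// mul1r.
  by rewrite ler_ln ?posrE ?ltr0n// ler_nat.
have eL : e <= L * (pi / M%:R + 2 * (pi / M.+1%:R)).
  case: scale => [->|[v [x [vx ->]]]]; first by rewrite mulr_ge0// addr_ge0 ?mulr_ge0 ?divr_ge0 ?pi_ge0.
  by apply: le_trans (ler_norm _) _; exact: lip_sample.
apply: le_trans _ (grid_error M45 L0).
apply: (big_value L0 lipL (selected_comp_big M0 tree all_vs) _ med) => x Kx.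
apply: (le_trans (mono_comp_value M0 e0 step (lip_cell L0 lipL) Kx)).
by rewrite lerD2l ler_wpM2l// pi_ge0.
Qed.
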